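(* Let $\mathfrak g$ be a seven-dimensional complex Lie algebra which admits a (complex) codimension one Abelian ideal $\mathfrak u$. Let $e_7\in\mathfrak g\setminus\mathfrak u$, let $V_2$ be a two-dimensional subspace of $\mathfrak u$ and $V_4$ a four-dimensional subspace of $\mathfrak u$ such that $\mathfrak u=V_2\oplus V_4$, and let $\omega\in\Lambda^2V_4^*$ be a non-degenerate two-form on $V_4$. Let $\lambda_1,\dots,\lambda_6$ be the diagonal elements of a fixed complex Jordan normal form of $\mathrm{ad}(e_7)|_{\mathfrak u}$, numbered from the upper left to the lower right, and for $i=1,\dots,6$ let $\mathrm{JB}(i)$ be the number of the Jordan block containing the $i$-th diagonal element. Then the following are equivalent: (a) $\mathfrak g$ admits a cocalibrated $(\mathrm G_2)_{\mathbb C}$-structure. (b) $\mathrm{ad}(e_7)|_{\mathfrak u}\in\mathfrak{gl}(\mathfrak u)$ is similar under $\mathrm{GL}(\mathfrak u)$ to an element of $$\Big\{f\in\mathfrak{gl}(\mathfrak u)\ \Big|\ f|_{V_2}=f_2+h,\ f_2\in\mathfrak{gl}(V_2),\ h\in\mathrm{Hom}(V_2,V_4),\ f|_{V_4}=-\tfrac{\mathrm{tr}(f_2)}{2}\mathrm{id}_{V_4}+f_4,\ f_4\in\mathfrak{sp}(V_4,\omega)\Big\}.$$ (c) There exists a partition of $\{1,\dots,6\}$ into three subsets $I_1,I_2,I_3$, each of cardinality two, such that the following is true: (i) $\sum_{i\in I_1}\lambda_i=\sum_{i\in I_2}\lambda_i=-\sum_{i\in I_3}\lambda_i$. (ii)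 If there are $i_1\in I_1$, $i_2\in I_2$ such that $\mathrm{JB}(i_1)=\mathrm{JB}(i_2)$, then $\lambda_{i_1}=\lambda_{i_2}=-\frac{\sum_{i\in I_3}\lambda_i}{2}$ or $\mathrm{JB}(j_1)=\mathrm{JB}(j_2)$ for the uniquely determined $j_k\in I_k$ such that $\{i_k,j_k\}=I_k$, $k=1,2$. (iii) If there exists $i_2\in I_2$ such that $\mathrm{JB}(j)=\mathrm{JB}(i_2)$ for all $j\in I_1$, or if there exists $i_1\in I_1$ such that $\mathrm{JB}(j)=\mathrm{JB}(i_1)$ for all $j\in I_2$, then $\lambda_j=-\frac{\sum_{i\in I_3}\lambda_i}{2}$ for all $j\in I_1\cup I_2$ and $\mathrm{JB}(j)=\mathrm{JB}(k)$ for all $j,k\in I_1\cup I_2$.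
   Context: Write $E^{ijk}=E^i\wedge E^j\wedge E^k$ etc. Let $W$ be a seven-dimensional complex vector space. A $(\mathrm G_2)_{\mathbb C}$-structure on $W$ is a pair $(\varphi_{\mathbb C},\mathrm{vol}_{\mathbb C})\in\Lambda^3W^*\times\Lambda^7W^*$ (complex multilinear forms) such that there is a complex basis $E_1,\dots,E_7$ of $W$ (an adapted basis) with dual basis $E^1,\dots,E^7$, $\mathrm{vol}_{\mathbb C}=E^{1234567}$ and $\varphi_{\mathbb C}=E^{127}+E^{347}+E^{567}+E^{135}-E^{146}-E^{236}-E^{245}$. It induces a non-degenerate symmetric complex bilinear form $g_{\mathbb C}$ on $W$ by $g_{\mathbb C}(v,w)\,\mathrm{vol}_{\mathbb C}=\frac16(v\lrcorner\varphi_{\mathbb C})\wedge(w\lrcorner\varphi_{\mathbb C})\wedge\varphi_{\mathbb C}$, for which $g_{\mathbb C}(E_j,E_k)=\delta_{jk}$. The Hodge star $\star_{\varphi_{\mathbb C}}:\Lambda^kW^*\to\Lambda^{7-k}W^*$ is defined by $\psi\wedge\phi=g_{\mathbb C}(\star_{\varphi_{\mathbb C}}\psi,\phi)\,\mathrm{vol}_{\mathbb C}$ for all $\phi\in\Lambda^{7-k}W^*$. In an adapted basis, $\star_{\varphi_{\mathbb C}}\varphi_{\mathbb C}=E^{1234}+E^{1256}+E^{3456}-E^{2467}+E^{2357}+E^{1457}+E^{1367}$. On a complex Lie algebra $\mathfrak g$, $d$ is the exterior derivative on $\Lambda^*\mathfrak g^*$ determined by $(d\alpha)(X,Y)=-\alpha([X,Y])$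 for $\alpha\in\mathfrak g^*$. A cocalibrated $(\mathrm G_2)_{\mathbb C}$-structure on a seven-dimensional complex Lie algebra $\mathfrak g$ is a $(\mathrm G_2)_{\mathbb C}$-structure $(\varphi_{\mathbb C},\mathrm{vol}_{\mathbb C})$ on $\mathfrak g$ with $d\star_{\varphi_{\mathbb C}}\varphi_{\mathbb C}=0$. The Jordan blocks of the fixed complex Jordan normal form are numbered consecutively $1,\dots,m$ from the upper left to the lower right. $\mathfrak{sp}(V_4,\omega)=\{f\in\mathfrak{gl}(V_4):\omega(f v,w)+\omega(v,f w)=0\ \forall v,w\in V_4\}$. ''Similar under $\mathrm{GL}(\mathfrak u)$'' means conjugate by an element of $\mathrm{GL}(\mathfrak u)$. *)

(* Defs.v *)
From HB Require Import structures.
From mathcomp Require Import all_boot all_order all_fingroup all_algebra.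

Set Implicit Arguments.
Unset Strict Implicit.
Unset Printing Implicit Defensive.

Import GRing.Theory Num.Theory.
Local Open Scope ring_scope.

Record lie_bracket (K : fieldType) (g : lmodType K) := LieBracket {
  bracket :> {bilinear g -> g -> g};
  bracket_alt : forall x, bracket x x = 0;
  bracket_jacobi : forall x y z,
    bracket x (bracket y z) + bracket y (bracket z x)
      + bracket z (bracket x y) = 0
}.

Section Ideals.
Variables (K : fieldType) (g : vectType K) (br : lie_bracket g).

Definition lie_ideal (u : {vspace g}) :=
  forall x y, y \in u -> br x y \in u.

Definition lie_abelian (u : {vspace g}) :=
  forall x y, x \in u -> y \in u -> br x y = 0.

(* [vsproj u] only inverts [vsval] here: when [u] is an ideal, [br x] maps
   [u] to itself. *)
Definition ad_restr (u : {vspace g}) (x : g) : 'End(subvs_of u) :=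
  linfun (vsproj u \o br x \o vsval).

End Ideals.

Definition kform (K : numFieldType) (W : vectType K) (k : nat) :=
  ('I_k -> W) -> K.

Section Forms.
Variables (K : numFieldType) (W : vectType K).
Implicit Types (k p q : nat) (g : W -> W -> K).

Definition multilinear k (a : kform W k) :=
  forall (v : 'I_k -> W) (i : 'I_k),
    scalar (fun x : W => a (@dfwith _ (fun=> W) v i x)).

Definition alternating k (a : kform W k) :=
  multilinear a /\
  forall (v : 'I_k -> W) (i j : 'I_k), i != j -> v i = v j -> a v = 0.

(* Normalised so that (a /\ b)(v, w) = a(v) b(w) - a(w) b(v) on 1-forms. *)
Definition wedge p q (a : kform W p) (b : kform W q) : kform W (p + q) :=
  fun v => (p`! * q`!)%:R^-1 *
    \sum_(s : 'S_(p + q)) (-1) ^+ s *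
      a (fun i => v (s (lshift q i))) * b (fun j => v (s (rshift p j))).

Definition contract k (x : W) (a : kform W k.+1) : kform W k :=
  fun v => a (fun i => if unlift ord0 i is Some j then v j else x).

(* Chevalley-Eilenberg formula
     sum_(i < j) (-1)^(i+j) a([v_i, v_j], v_0, .., ^v_i, .., ^v_j, .., v_k.+1)
   for the antiderivation with (d a)(x, y) = - a([x, y]) on 1-forms.  Since
   i < j, we have v_i = v (lift j i), and l |-> v (lift j (lift i l)) lists the
   remaining arguments in order. *)
Definition ext_diff (br : lie_bracket W) k (a : kform W k.+1) :
    kform W k.+2 :=
  fun v => \sum_(j < k.+2) \sum_(i < k.+1 | (i < j)%N) (-1) ^+ (i + j) *
    a (fun l => if unlift ord0 l is Some m then v (lift j (lift i m))
                else br (v (lift j i)) (v j)).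

(* The form induced by [g] on k-forms, i.e. the one with
     <a_1 /\ .. /\ a_k, b_1 /\ .. /\ b_k> = det (g^-1(a_i, b_j)),
   written in coordinates with the inverse Gram matrix; it does not depend on
   the basis. *)
Definition form_metric g k (a b : kform W k) : K :=
  let e := vbasis {:W} in
  let G := \matrix_(i, j) g e`_i e`_j : 'M_(\dim {:W}) in
  k`!%:R^-1 *
    \sum_(s : {ffun 'I_k -> 'I_(\dim {:W})})
      \sum_(t : {ffun 'I_k -> 'I_(\dim {:W})})
        (\prod_l invmx G (s l) (t l)) *
          a (fun l => e`_(s l)) * b (fun l => e`_(t l)).

Definition is_hodge_star g p q (vol : kform W (p + q)) (psi : kform W p)
    (star_psi : kform W q) :=
  alternating star_psi /\
  forall phi : kform W q, alternating phi ->
    forall v, wedge psi phi v = form_metric g star_psi phi * vol v.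

End Forms.

Section G2.
Variables (K : numFieldType) (W : vectType K).
Implicit Types (E : 7.-tuple W) (phi : kform W 3) (vol : kform W 7).

(* Indices run from 1 to 7: [dual_covector E i] is E^i. *)
Definition dual_covector E (i : nat) : kform W 1 :=
  fun v => coord E (inord i.-1) (v ord0).

Unset Implicit Arguments.
Fixpoint dual_wedge E (s : seq nat) : kform W (size s) :=
  if s is i :: s' then wedge (dual_covector E i) (dual_wedge E s')
  else fun=> 1.
Set Implicit Arguments.

Definition standard_vol E : kform W 7 :=
  dual_wedge E [:: 1; 2; 3; 4; 5; 6; 7]%N.

Definition standard_phi E : kform W 3 := fun v =>
  dual_wedge E [:: 1; 2; 7]%N v + dual_wedge E [:: 3; 4; 7]%N v
  + dual_wedge E [:: 5; 6; 7]%N v + dual_wedge E [:: 1; 3; 5]%N v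
  - dual_wedge E [:: 1; 4; 6]%N v - dual_wedge E [:: 2; 3; 6]%N v
  - dual_wedge E [:: 2; 4; 5]%N v.

Definition G2_structure phi vol :=
  exists E, [/\ basis_of {:W} E, vol =1 standard_vol E & phi =1 standard_phi E].

(* As [vol] is nonzero, this determines [g]. *)
Definition G2_metric phi vol (g : W -> W -> K) :=
  forall x y (v : 'I_7 -> W),
    g x y * vol v =
      6^-1 * wedge (wedge (contract x phi) (contract y phi)) phi v.

(* The metric and the 4-form star(phi) exist and are unique. *)
Definition cocalibrated (br : lie_bracket W) phi vol :=
  G2_structure phi vol /\
  exists (g : W -> W -> K) (star_phi : kform W 4),
    [/\ G2_metric phi vol g,
        is_hodge_star (p := 3) (q := 4) g vol phi star_phi &
        forall v, ext_diff br star_phi v = 0].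

End G2.

Section LinearAlgebra.
Variable K : fieldType.

Definition lftrace (V : vectType K) (f : 'End(V)) : K :=
  \tr (passmx.mxof (vbasis {:V}) (vbasis {:V}) f).

Definition similar_GL (V : vectType K) (f f' : 'End(V)) :=
  exists P : 'End(V), lker P == 0%VS /\ f' = (P \o f \o P^-1)%VF.

Definition in_sp (V : vectType K) (omega : V -> V -> K) (f : 'End(V)) :=
  forall v w, omega (f v) w + omega v (f w) = 0.

Definition sp_block_form (U : vectType K) (V2 V4 : {vspace U})
    (omega : subvs_of V4 -> subvs_of V4 -> K) (f : 'End(U)) :=
  exists (f2 : 'End(subvs_of V2)) (h : 'Hom(subvs_of V2, subvs_of V4))
         (f4 : 'End(subvs_of V4)),
    [/\ in_sp omega f4,
        forall x, f (vsval x) = vsval (f2 x) + vsval (h x) &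
        forall y, f (vsval y) = - (lftrace f2 / 2) *: vsval y + vsval (f4 y)].

Definition jordan_block n (a : K) : 'M[K]_n :=
  \matrix_(i, j) (a *+ (i == j) + (i.+1 == j)%:R).

(* [J] is block diagonal with [m] nonempty Jordan blocks, and [JB i] is the
   number, counted from 1, of the block containing the diagonal entry
   [J i i]. *)
Definition jordan_matrix n (J : 'M[K]_n) (JB : 'I_n -> nat) :=
  exists (m : nat) (p : 'I_m -> nat) (a : 'I_m -> K)
         (pn : (\sum_k p k = n)%N),
    [/\ forall k, (0 < p k)%N,
        J = castmx (pn, pn) (\mxdiag_(k < m) jordan_block (p k) (a k)) &
        forall i, JB i = (tagnat.sig1 (cast_ord (esym pn) i)).+1].

Definition jordan_normal_form (V : vectType K) (f : 'End(V)) n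
    (J : 'M[K]_n) (JB : 'I_n -> nat) :=
  jordan_matrix J JB /\
  exists b : n.-tuple V, basis_of {:V} b /\
    forall j : 'I_n, f b`_j = \sum_i J i j *: b`_i.

Definition jordan_condition (lambda : 'I_6 -> K) (JB : 'I_6 -> nat) :=
  exists I1 I2 I3 : {set 'I_6},
    let mu := - ((\sum_(i in I3) lambda i) / 2) in
    [/\ [/\ #|I1| = 2%N, #|I2| = 2%N, #|I3| = 2%N &
            partition [set I1; I2; I3] [set: 'I_6]],
        \sum_(i in I1) lambda i = \sum_(i in I2) lambda i /\
        \sum_(i in I2) lambda i = - \sum_(i in I3) lambda i,
        forall i1 i2, i1 \in I1 -> i2 \in I2 -> JB i1 = JB i2 ->
          (lambda i1 = lambda i2 /\ lambda i2 = mu) \/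
          (forall j1 j2, [set i1; j1] = I1 -> [set i2; j2] = I2 ->
             JB j1 = JB j2) &
        (exists2 i2, i2 \in I2 & forall j, j \in I1 -> JB j = JB i2) \/
        (exists2 i1, i1 \in I1 & forall j, j \in I2 -> JB j = JB i1) ->
          (forall j, j \in I1 :|: I2 -> lambda j = mu) /\
          (forall j k, j \in I1 :|: I2 -> k \in I1 :|: I2 -> JB j = JB k)].

End LinearAlgebra.

Arguments sp_block_form {K U} V2 V4 omega f.

(* Main.v *)
Require Import Defs.
From HB Require Import structures.
From mathcomp Require Import all_boot all_order all_fingroup all_algebra.
From mathcomp Require Import reals complex.
From mathcomp Require Import ring zify.
Import GRing.Theory Num.Theory.
Local Open Scope ring_scope.
Set Implicit Arguments.
Unset Strict Implicit.
Unset Printing Implicit Defensive.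

(** Let [D] be the adjoint action of [e7] and [tau] the covector with kernel [u]
    and [tau e7 = 1].  The bracket is [tau x *: D y - tau y *: D x], so the
    derivative of a form [a] is, up to sign, the action of the derivation [D] on
    [tau /\ a] (lemma [ext_diff_lie_form]).

    For [a] the Hodge dual of the three-form, the volume form turns the five-form
    [tau /\ a] into the bivector [B] of the cross product with the vector dual to
    [tau], and the action of [D] on five-forms into that of [\tr D - D] on
    bivectors.  Hence the structure is cocalibrated if and only if
    [D *m B + B *m D^T = \tr D *: B] ([resid_eq0P]).  This says that [D] preserves
    the support of [B] and that [D - \tr D / 2] is there in the symplectic
    algebra of [B] ([bivector_invariant]).  The cross product kills its own
    vector, so the support lies in [u]; its dimension is even and greater
    than two ([cross_mx_indecomposable]), so it is four or six ([cocalibrated_sp]).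
    Conversely the bivector of a null covector has rank four, and an adapted basis
    can be chosen so that [tau] is null and the support is any given four-space in
    [u] with a given non-degenerate bivector ([sp_cocalibrated]).

    Existence of a [D]-invariant four-space in [u] on which [D - \tr D / 2] is
    symplectic is the predicate [sp_sub].  It is statement (b) written in a
    basis, because the trace of the block form is [- \tr f_2]
    ([block_form_sp_sub], [sp_sub_block_form]).

    It is also statement (c).  The latter amounts to the existence of four indices
    whose eigenvalues split into two pairs with sum [\tr D] and whose blocks are
    arranged in one of three ways ([jordan_pattern]).  Given such indices, initial
    segments of the Jordan chains span a suitable four-space ([pattern_sp_sub]).
    Given the four-space, the Jordan types that occur in the symplectic algebra
    of a four-space are few, and the number of blocks with a given eigenvalue and
    at least a given size can only grow from a subspace to the whole space
    ([sp4_pattern], [jcount_sub]).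

    If the support of [B] is all of [u], then [\tr D = 0] and [D] is symplectic on
    [u]; symplectic reduction along an eigenvector leads back to dimension four,
    again without increasing the block counts ([sp_reduction], [sp6_pattern]). *)

(** * Skew-symmetric matrices *)

Section SkewMatrices.
Variable K : numFieldType.

(** Symplectic elimination: a nonzero entry [t] at [(i, j)] splits off the rank two
    summand built from rows [i] and [j].  The remainder has zero columns [i] and
    [j], so its rank is smaller and its summands are independent of the new one. *)
Lemma skew_normal_form n (B : 'M[K]_n) : B^T = - B ->
  exists (k : nat) (X1 X2 : 'M[K]_(k, n)),
    row_free (col_mx X1 X2) /\ B = X1^T *m X2 - X2^T *m X1.
Proof.
move: {2}(\rank B).+1 (ltnSn (\rank B)) => r; elim: r B => // r IHr B.
rewrite ltnS => rB skB.
have [->|/matrix0Pn[i [j Bij0]]] := eqVneq B 0.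
  exists 0%N, 0, 0; split; last by rewrite !mulmx0 subr0.
  by rewrite -row_leq_rank.
have Bsk a b : B a b = - B b a.
  by move/matrixP/(_ b a): skB; rewrite !mxE.
have Bd a : B a a = 0.
  by have /eqP := Bsk a a; rewrite -addr_eq0 -mulr2n mulrn_eq0 => /eqP.
pose t := B i j.
pose y : 'rV[K]_n := t^-1 *: row i B; pose z : 'rV[K]_n := row j B.
pose B' := B - (y^T *m z - z^T *m y).
have y_i : y *m (delta_mx i 0 : 'cV_n) = 0.
  by apply/matrixP => a b; rewrite -colE !mxE Bd mulr0.
have y_j : y *m (delta_mx j 0 : 'cV_n) = 1.
  by apply/matrixP => a b; rewrite -colE !mxE !ord1 eqxx mulVf.
have z_j : z *m (delta_mx j 0 : 'cV_n) = 0.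
  by apply/matrixP => a b; rewrite -colE !mxE Bd.
have z_i : z *m (delta_mx i 0 : 'cV_n) = - t *: 1.
  by apply/matrixP => a b; rewrite -colE !mxE Bsk !ord1 eqxx mulr1.
have colB a : B *m (delta_mx a 0 : 'cV_n) = - (row a B)^T.
  by apply/matrixP => b c; rewrite -colE !mxE; exact: Bsk.
have t0 : t != 0 by [].
have B'i : B' *m (delta_mx i 0 : 'cV_n) = 0.
  rewrite mulmxBl mulmxBl -!mulmxA y_i z_i mulmx0 subr0 colB -scalemxAr mulmx1.
  by rewrite /y scaleNr opprK linearZ /= scalerA mulfV // scale1r addNr.
have B'j : B' *m (delta_mx j 0 : 'cV_n) = 0.
  rewrite mulmxBl mulmxBl -!mulmxA y_j z_j mulmx0 sub0r opprK mulmx1.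
  by rewrite colB addrC subrr.
have skB' : B'^T = - B'.
  rewrite /B' raddfB /= raddfB /= skB !trmx_mul !trmxK.
  by rewrite !opprB addrC.
have sB' : (B' <= B)%MS.
  by rewrite addmx_sub ?eqmx_opp ?addmx_sub ?eqmx_opp ?mulmx_sub ?scalemx_sub
    ?row_sub.
have rB' : (\rank B' < r)%N.
  rewrite (leq_trans _ rB) // ltnNge; apply/negP => le_rk.
  have /eqmxP eqB : (B' == B)%MS by rewrite -(geq_leqif (mxrank_leqif_eq sB')).
  have /submxP[C BC] : (B <= B')%MS by rewrite eqB.
  have : B *m (delta_mx j 0 : 'cV_n) = 0 by rewrite BC -mulmxA B'j mulmx0.
  by rewrite -colE => /matrixP/(_ i 0); rewrite !mxE; apply/eqP.
have [k [X1 [X2 [Xfree B'E]]]] := IHr B' rB' skB'.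
have Xd a : B' *m (delta_mx a 0 : 'cV_n) = 0 ->
    X1 *m (delta_mx a 0 : 'cV_n) = 0 /\ X2 *m (delta_mx a 0 : 'cV_n) = 0.
  move=> B'a; set d := delta_mx a 0 : 'cV_n in B'a *.
  have: (col_mx (X2 *m d) (- (X1 *m d)))^T *m col_mx X1 X2 = 0.
    apply: trmx_inj; rewrite trmx0 -B'a B'E trmx_mul trmxK tr_col_mx mul_row_col.
    by rewrite mulmxN mulmxBl -!mulmxA.
  move/eqP; rewrite mulmx_free_eq0 // -trmx0 (inj_eq trmx_inj).
  rewrite -[0](@col_mx0 _ k k) => /eqP/eq_col_mx[-> /eqP].
  by rewrite oppr_eq0 => /eqP.
have [Xi1 Xi2] := Xd _ B'i; have [Xj1 Xj2] := Xd _ B'j.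
exists (k + 1)%N, (col_mx X1 y), (col_mx X2 z); split.
  apply: inj_row_free => v.
  rewrite -[v]hsubmxK -[lsubmx v]hsubmxK -[rsubmx v]hsubmxK.
  set a1 := lsubmx _; set a2 := rsubmx (lsubmx v).
  set b1 := lsubmx _; set b2 := rsubmx (rsubmx v).
  rewrite !mul_row_col => E0.
  have b20 : b2 = 0.
    have: (a1 *m X1 + a2 *m y + (b1 *m X2 + b2 *m z)) *m
       (delta_mx i 0 : 'cV_n) = 0 by rewrite E0 mul0mx.
    rewrite !mulmxDl -!mulmxA Xi1 Xi2 y_i z_i !mulmx0 !add0r -scalemxAr mulmx1.
    by move/eqP; rewrite scaler_eq0 oppr_eq0 (negPf t0) => /eqP.
  have a20 : a2 = 0.
    have: (a1 *m X1 + a2 *m y + (b1 *m X2 + b2 *m z)) *m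
       (delta_mx j 0 : 'cV_n) = 0 by rewrite E0 mul0mx.
    by rewrite !mulmxDl -!mulmxA Xj1 Xj2 y_j z_j !mulmx0 !add0r addr0 mulmx1.
  move: E0; rewrite a20 b20 !mul0mx !addr0 -mul_row_col => /eqP.
  rewrite mulmx_free_eq0 // -[0](@row_mx0 _ _ k k) => /eqP/eq_row_mx[-> ->].
  by rewrite !row_mx0.
rewrite !tr_col_mx !mul_row_col opprD addrACA -B'E.
by rewrite subrK.
Qed.

Definition Omega k : 'M[K]_(k + k) := block_mx 0 1%:M (- 1%:M) 0.

Lemma Omega_skew k : (Omega k)^T = - Omega k.
Proof.
by rewrite /Omega tr_block_mx opp_block_mx !trmx0 !linearN /= !trmx1 oppr0 opprK.
Qed.

Lemma Omega_sqr k : Omega k *m Omega k = - 1%:M.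
Proof.
rewrite /Omega mulmx_block !mulmx0 !mul0mx !mulmxN !mulNmx !mulmx1 !add0r !addr0.
by rewrite [in RHS]scalar_mx_block opp_block_mx !oppr0.
Qed.

Lemma Omega_unit k : Omega k \in unitmx.
Proof.
suff /mulmx1_unit[] : Omega k *m (- Omega k) = 1%:M by [].
by rewrite mulmxN Omega_sqr opprK.
Qed.

Lemma mul_tr_Omega_mul k n (X1 X2 : 'M[K]_(k, n)) :
  (col_mx X1 X2)^T *m Omega k *m col_mx X1 X2 = X1^T *m X2 - X2^T *m X1.
Proof.
rewrite tr_col_mx mul_row_block !mulmx0 mulmxN !mulmx1 add0r addr0.
by rewrite mul_row_col mulNmx addrC.
Qed.

Lemma skew_normal_formE n (B : 'M[K]_n) : B^T = - B ->
  exists (k : nat) (X : 'M[K]_(k + k, n)),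
    [/\ row_free X, B = X^T *m Omega k *m X & \rank B = (k + k)%N].
Proof.
move=> /skew_normal_form[k [X1 [X2 [Xf ->]]]]; exists k, (col_mx X1 X2).
rewrite -mul_tr_Omega_mul; split=> //.
rewrite mxrankMfree // -[RHS](mxrank_unit (Omega_unit k)).
rewrite -[LHS]mxrank_tr -[RHS]mxrank_tr trmx_mul trmxK.
by rewrite mxrankMfree.
Qed.

Lemma skew_rank_even n (B : 'M[K]_n) : B^T = - B -> ~~ odd (\rank B).
Proof. by case/skew_normal_formE=> k [X [_ _ ->]]; rewrite addnn odd_double. Qed.

(** All non-degenerate two-forms on a four-space are equivalent, so that the choice
    of the two-form in the statements about four-spaces does not matter. *)
Lemma skew_unit_congr (W1 W2 : 'M[K]_4) :
  W1^T = - W1 -> W1 \in unitmx -> W2^T = - W2 -> W2 \in unitmx ->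
  exists2 C : 'M[K]_4, C \in unitmx & W2 = C *m W1 *m C^T.
Proof.
have std (W : 'M[K]_4) : W^T = - W -> W \in unitmx ->
    exists2 X : 'M[K]_4, X \in unitmx & W = X^T *m Omega 2 *m X.
  case/skew_normal_formE=> k [X [Xf WE rW]] uW.
  move: rW; rewrite mxrank_unit // => /eqP; rewrite addnn -[4%N]/(2.*2)%N.
  rewrite (inj_eq double_inj) => /eqP k2.
  by move: X Xf WE; rewrite -k2 => X Xf WE; exists X; rewrite // -row_free_unit.
move=> sk1 u1 sk2 u2.
have [X1 uX1 E1] := std _ sk1 u1; have [X2 uX2 E2] := std _ sk2 u2.
exists (X2^T *m (invmx X1)^T).
  by rewrite unitmx_mul !unitmx_tr uX2 unitmx_inv.
rewrite E1 E2 trmx_mul !trmxK -!mulmxA (mulmxA X1) mulmxV // mul1mx.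
congr (_ *m _); rewrite !mulmxA; congr (_ *m _).
by rewrite -[_ *m X1^T]trmx_mul mulmxV // trmx1 mul1mx.
Qed.

(** Multiplication by [invmx W] on both sides exchanges the condition on a two-form
    and the one on its inverse bivector. *)
Lemma sp_transpose n (M W : 'M[K]_n) t : W \in unitmx ->
  M^T *m W + W *m M = t *: W <->
  M *m invmx W + invmx W *m M^T = t *: invmx W.
Proof.
move=> uW; split=> E.
  have := congr1 (fun Z => invmx W *m Z *m invmx W) E.
  rewrite mulmxDr mulmxDl !mulmxA mulVmx // mul1mx -scalemxAr mulVmx //.
  by rewrite -scalemxAl mul1mx -[_ *m W *m invmx W]mulmxA mulmxV // mulmx1 addrC.
have := congr1 (fun Z => W *m Z *m W) E.
rewrite mulmxDr mulmxDl !mulmxA mulmxV // mul1mx -scalemxAr mulmxV //.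
by rewrite -scalemxAl mul1mx -[_ *m invmx W *m W]mulmxA mulVmx // mulmx1 addrC.
Qed.

(** The row space of [X] is the support of the bivector [B], hence is preserved by
    an endomorphism that multiplies [B] by a scalar, and [M] is the induced map. *)
Lemma bivector_invariant k n (X : 'M[K]_(k + k, n)) (N : 'M[K]_n) t :
  row_free X ->
  let B := X^T *m Omega k *m X in
  N^T *m B + B *m N = t *: B <->
  exists2 M : 'M[K]_(k + k), X *m N = M *m X &
    M *m Omega k + Omega k *m M^T = t *: Omega k.
Proof.
move=> Xf B.
have Oinv : invmx (Omega k) = - Omega k.
  rewrite -[RHS](mulKmx (Omega_unit k)) mulmxN Omega_sqr opprK mulmx1 //.
have spE M : M *m Omega k + Omega k *m M^T = t *: Omega k <->
    M^T *m Omega k + Omega k *m M = t *: Omega k.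
  rewrite sp_transpose ?Omega_unit // Oinv !(mulmxN, mulNmx) scalerN -opprD.
  by split=> [->|/oppr_inj].
have BN M : X *m N = M *m X -> N^T *m B + B *m N =
    X^T *m (M^T *m Omega k + Omega k *m M) *m X.
  move=> XN; rewrite /B -!mulmxA XN !mulmxA -trmx_mul XN trmx_mul.
  by rewrite mulmxDr mulmxDl !mulmxA.
split=> [E|[M XN /spE E]]; last first.
  by rewrite (BN M XN) E -scalemxAr -scalemxAl.
have [L XL] := row_freeP Xf.
have LX : L^T *m X^T = 1%:M by rewrite -trmx_mul XL trmx1.
pose M := invmx (Omega k) *m (L^T *m (t%:M - N^T) *m X^T *m Omega k).
have XN : X *m N = M *m X.
  have : B *m N = (t%:M - N^T) *m B
    by rewrite mulmxBl mul_scalar_mx -E [X in X - _]addrC addrK.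
  move/(congr1 (fun Z => invmx (Omega k) *m (L^T *m Z))).
  rewrite /B /M !mulmxA -[_ *m L^T *m X^T]mulmxA LX mulmx1.
  by rewrite mulVmx ?Omega_unit // mul1mx.
exists M => //; apply/spE.
have: X^T *m (M^T *m Omega k + Omega k *m M) *m X = X^T *m (t *: Omega k) *m X.
  by rewrite -BN // E -scalemxAr -scalemxAl.
move/(congr1 (fun Z => L^T *m Z *m L)).
by rewrite !mulmxA LX !mul1mx -!mulmxA XL !mulmx1.
Qed.

End SkewMatrices.

(** * Counting Jordan blocks; symplectic reduction *)

Section JordanCount.
Variable K : fieldType.

(** The number of Jordan blocks of [M] with eigenvalue [a] and size greater than
    [k]: such a block contributes its eigenvector. *)
Definition jcount n (M : 'M[K]_n) (a : K) (k : nat) : nat :=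
  \rank ((M - a%:M) ^+ k :&: kermx (M - a%:M))%MS.

Lemma jcountE n (M : 'M[K]_n) a k :
  (\rank ((M - a%:M) ^+ k.+1) + jcount M a k = \rank ((M - a%:M) ^+ k))%N.
Proof. by rewrite exprSr mxrank_mul_ker. Qed.

Lemma tr_mxX n (M : 'M[K]_n) k : (M ^+ k)^T = M^T ^+ k.
Proof.
by elim: k => [|k IHk]; rewrite ?expr0 ?trmx1 // exprS exprSr -IHk trmx_mul.
Qed.

(** By [jcountE] the counts depend only on the ranks of the powers. *)
Lemma jcount_tr n (M : 'M[K]_n) a k : jcount M^T a k = jcount M a k.
Proof.
apply/(@addnI (\rank ((M - a%:M) ^+ k.+1))); rewrite jcountE.
have trE j : \rank ((M^T - a%:M) ^+ j) = \rank ((M - a%:M) ^+ j).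
  by rewrite -[RHS]mxrank_tr tr_mxX linearB /= tr_scalar_mx.
by rewrite -trE jcountE trE.
Qed.

Lemma intertwine_shift m n (V : 'M[K]_(m, n)) (A : 'M[K]_n) (L : 'M[K]_m) a k :
  V *m A = L *m V -> V *m (A - a%:M) ^+ k = (L - a%:M) ^+ k *m V.
Proof.
move=> VA; elim: k => [|k IHk]; first by rewrite !expr0 mulmx1 mul1mx.
rewrite exprS mulmxA mulmxBr VA mul_mx_scalar -mul_scalar_mx -mulmxBl.
by rewrite -mulmxA IHk mulmxA exprS.
Qed.

(** [V] embeds an invariant subspace, along with the kernel and the images of
    powers that define the counts. *)
Lemma jcount_sub m n (V : 'M[K]_(m, n)) (A : 'M[K]_n) (L : 'M[K]_m) a k :
  row_free V -> V *m A = L *m V -> (jcount L a k <= jcount A a k)%N.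
Proof.
move=> Vf VA; rewrite /jcount -(mxrankMfree _ Vf); apply: mxrankS.
rewrite sub_capmx; apply/andP; split.
  rewrite (submx_trans (submxMr _ (capmxSl _ _))) //.
  by rewrite -(intertwine_shift _ _ VA) submxMl.
rewrite (submx_trans (submxMr _ (capmxSr _ _))) //.
apply/sub_kermxP; rewrite -mulmxA.
have := @intertwine_shift _ _ V A L a 1 VA; rewrite !expr1 => ->.
by rewrite mulmxA mulmx_ker mul0mx.
Qed.

(** Transposition turns a quotient into a subspace. *)
Lemma jcount_quo m n (Q : 'M[K]_(n, m)) (L : 'M[K]_n) (M : 'M[K]_m) a k :
  row_free Q^T -> L *m Q = Q *m M -> (jcount M a k <= jcount L a k)%N.
Proof.
move=> Qf LQ; rewrite -[jcount M _ _]jcount_tr -[jcount L _ _]jcount_tr.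
by apply: (jcount_sub _ _ Qf); rewrite -!trmx_mul LQ.
Qed.

Lemma row_base_of_rank m n r (A : 'M[K]_(m, n)) : \rank A = r ->
  exists Z : 'M[K]_(r, n), row_free Z /\ (Z :=: A)%MS.
Proof.
move=> <-; exists (row_base A).
by split; [exact: row_base_free|exact: eq_row_base].
Qed.

Lemma row_free_complete m p n (Y : 'M[K]_(m, n)) : row_free Y -> (m + p)%N = n ->
  exists Z : 'M[K]_(p, n), row_full (Y + Z)%MS.
Proof.
move=> Yf mpn; have [|Z [_ ZY]] := @row_base_of_rank n n p (Y^C)%MS.
  by rewrite mxrank_compl (eqP Yf) -mpn addKn.
by exists Z; rewrite /row_full (adds_eqmx (eqmx_refl Y) ZY); apply: addsmx_compl_full.
Qed.

End JordanCount.

Section SymplecticReduction.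
Variable K : numClosedFieldType.

Lemma eigenvector_exists n (M : 'M[K]_n.+1) :
  exists a (v : 'rV[K]_n.+1), v *m M = a *: v /\ v != 0.
Proof.
have /closed_rootP[a] : size (char_poly M) != 1%N by rewrite size_char_poly.
rewrite -eigenvalue_root_char => /eigenvalueP[v vM v0].
by exists a, v.
Qed.

(** Symplectic reduction: the orthogonal of an eigenvector [v] is invariant, and the
    form descends to its quotient by [v].  The quotient is represented by the
    vectors [Z] orthogonal to [v] and to a partner [w] of [v].  It is a quotient of
    a subspace, which bounds the block counts. *)
Lemma sp_reduction n (M W : 'M[K]_n.+2) :
  W^T = - W -> W \in unitmx -> M *m W + W *m M^T = 0 ->
  exists M' W' : 'M[K]_n,
    [/\ W'^T = - W', W' \in unitmx, M' *m W' + W' *m M'^T = 0 &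
        forall a k, (jcount M' a k <= jcount M a k)%N].
Proof.
move=> skW uW MW; have [a [v [vM v0]]] := eigenvector_exists M.
have MWE : M *m W = - (W *m M^T) by apply/eqP; rewrite -addr_eq0 MW.
have skE m p (x : 'M_(m, _)) (y : 'M_(p, _)) :
    (x *m W *m y^T)^T = - (y *m W *m x^T).
  by rewrite !trmx_mul trmxK skW mulNmx mulmxN mulmxA.
have [w wv] : exists w : 'rV[K]_n.+2, w *m W *m v^T = 1%:M.
  have : W *m v^T != 0.
    apply: contraNneq v0 => E; rewrite -(inj_eq trmx_inj) trmx0.
    by rewrite -(mulKmx uW v^T) E mulmx0.
  case/matrix0Pn=> i [j nz]; exists (((W *m v^T) i j)^-1 *: delta_mx 0 i).
  rewrite -mulmxA -scalemxAl -rowE; apply/matrixP=> x y.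
  by rewrite !ord1 !mxE in nz *; rewrite mulVf.
have vw : v *m W *m w^T = - 1%:M by rewrite -[LHS]trmxK skE wv linearN /= trmx1.
have alt (x : 'rV_n.+2) : x *m W *m x^T = 0.
  apply/matrixP=> i j; rewrite !ord1 [RHS]mxE.
  have /matrixP/(_ 0 0) := skE _ _ x x; rewrite mxE [RHS]mxE => /eqP.
  by rewrite -addr_eq0 -mulr2n mulrn_eq0 => /eqP.
have vv := alt v; have ww := alt w.
pose P := row_mx (W *m v^T) (W *m w^T).
have rP : \rank (kermx P) = n.
  rewrite mxrank_ker -[\rank P]mxrank_tr.
  suff /eqP-> : row_free P^T by rewrite subn2.
  apply: inj_row_free => x; rewrite tr_row_mx -[x]hsubmxK mul_row_col.
  rewrite !trmx_mul !trmxK skW !mulmxN -opprD => /eqP; rewrite oppr_eq0 => /eqP E.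
  have E' (z : 'rV_n.+2) : (lsubmx x *m (v *m W) + rsubmx x *m (w *m W)) *m z^T = 0.
    by rewrite E mul0mx.
  have := E' w; have := E' v.
  rewrite !mulmxDl -!mulmxA !(mulmxA _ W) vv vw wv ww !mulmx0 add0r addr0.
  rewrite mulmxN !mulmx1 => -> /eqP; rewrite oppr_eq0 => /eqP ->.
  by rewrite row_mx0.
have [Z [Zf ZE]] := row_base_of_rank rP.
have : Z *m P = 0 by apply/sub_kermxP; rewrite ZE.
rewrite /P mul_mx_row -row_mx0 => /eq_row_mx[].
rewrite !mulmxA => Zv Zw.
have vZ : v *m W *m Z^T = 0 by rewrite -[LHS]trmxK skE Zv oppr0 trmx0.
have wZ : w *m W *m Z^T = 0 by rewrite -[LHS]trmxK skE Zw oppr0 trmx0.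
(* Pairing a relation with [w] and [v] isolates the coefficients of [v] and [w]. *)
have indep (x y : 'M_1) (z : 'rV_n) :
    x *m v + y *m w + z *m Z = 0 -> [/\ x = 0, y = 0 & z = 0].
  move=> E; have E' (t : 'rV_n.+2) : (x *m v + y *m w + z *m Z) *m W *m t^T = 0.
    by rewrite E !mul0mx.
  have := E' v; have := E' w.
  rewrite !mulmxDl -!mulmxA !(mulmxA v W) !(mulmxA w W) !(mulmxA Z W).
  rewrite vv vw wv ww Zv Zw !mulmx0 !addr0 ?add0r mulmxN !mulmx1.
  move/eqP; rewrite oppr_eq0 => /eqP x0 y0.
  by move: E; rewrite x0 y0 !mul0mx !add0r => /eqP; rewrite mulmx_free_eq0 // => /eqP.
pose T := col_mx (col_mx v w) Z.
have Tf : row_free T.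
  apply: inj_row_free => x; rewrite -[x]hsubmxK -[lsubmx x]hsubmxK.
  by rewrite !mul_row_col => /indep[-> -> ->]; rewrite !row_mx0.
have Ttf : row_free T^T by rewrite row_free_unit unitmx_tr -row_free_unit.
have Wf : row_free W by rewrite row_free_unit.
have Tfull : row_full T by rewrite /row_full; move: Tf; rewrite /row_free.
have /submxP[C ZM] : (Z *m M <= T)%MS by rewrite submx_full.
move: ZM; rewrite -[C]hsubmxK -[lsubmx C]hsubmxK !mul_row_col.
set al := lsubmx _; set be := rsubmx (lsubmx C); set M' := rsubmx C => ZM.
have be0 : be = 0.
  have : Z *m M *m W *m v^T = 0.
    rewrite -[Z *m M *m W]mulmxA MWE mulmxN mulNmx -mulmxA -mulmxA -trmx_mul vM.
    by rewrite linearZ /= -!scalemxAr mulmxA Zv scaler0 oppr0.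
  rewrite ZM !mulmxDl -!mulmxA !(mulmxA v W) !(mulmxA w W) !(mulmxA Z W).
  by rewrite vv wv Zv !mulmx0 add0r addr0 mulmx1.
move: ZM; rewrite be0 mul0mx addr0 => ZM.
pose W' := Z *m W *m Z^T.
exists M', W'; split.
- by rewrite skE.
- rewrite -row_free_unit; apply: inj_row_free => y yW'.
  have : y *m Z *m W *m T^T = 0.
    rewrite !tr_col_mx !mul_mx_row -!(mulmxA y) Zv Zw.
    by rewrite !mulmx0 yW' !row_mx0.
  move=> yZ; apply/eqP; rewrite -(mulmx_free_eq0 _ Zf) -(mulmx_free_eq0 _ Wf).
  by rewrite -(mulmx_free_eq0 _ Ttf) yZ.
- have M'W : M' *m W' = Z *m M *m W *m Z^T.
    rewrite ZM !mulmxDl -!(mulmxA al) vZ mulmx0 add0r.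
    by rewrite /W' !mulmxA.
  have -> : W' *m M'^T = - (M' *m W')^T.
    by rewrite trmx_mul skE mulNmx opprK.
  have symMW : (M *m W)^T = M *m W by rewrite trmx_mul skW mulNmx MWE.
  by rewrite M'W -[Z *m M *m W]mulmxA trmx_mul trmxK trmx_mul symMW !mulmxA subrr.
(* On the orthogonal of [v], spanned by [v] and [Z], the matrix is [L]. *)
move=> b k.
pose L : 'M_(1 + n) := block_mx a%:M 0 al M'.
apply: (@leq_trans (jcount L b k)).
  apply: (@jcount_quo _ _ _ (col_mx 0 1%:M)).
    apply: inj_row_free => x; rewrite tr_col_mx trmx0 trmx1 mul_mx_row mulmx1.
    by rewrite mulmx0 -row_mx0 => /eq_row_mx[].
  by rewrite mul_block_col mul_col_mx !mulmx0 !mul0mx !mulmx1 mul1mx !add0r.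
apply: (@jcount_sub _ _ _ (col_mx v Z)).
  apply: inj_row_free => x; rewrite -[x]hsubmxK mul_row_col => E.
  have [] := indep (lsubmx x) 0 (rsubmx x); rewrite ?mul0mx ?addr0 //.
  by move=> -> _ ->; rewrite row_mx0.
by rewrite mul_col_mx vM ZM mul_block_col mul0mx addr0 mul_scalar_mx.
Qed.

End SymplecticReduction.

(** * Jordan matrices by their entries *)

Section JordanMatrices.
Variable K : fieldType.

(** Trades the block matrix and its dependent block sizes for properties of single
    entries. *)
Lemma jordan_entries n (J : 'M[K]_n) (JB : 'I_n -> nat) : jordan_matrix J JB ->
  [/\ forall i j : 'I_n, JB i = JB j -> J i i = J j j,
      forall i j : 'I_n,
        J i j = J i i *+ (i == j) + ((i.+1 == j) && (JB i == JB j))%:R &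
      forall i j : 'I_n, (i <= j)%N -> (JB i <= JB j)%N].
Proof.
case=> m [p [a [pn [p_gt0 -> JBE]]]]; case: _ / pn JB JBE => JB JBE.
rewrite castmx_id.
have JBE' i : JB i = (tagnat.sig1 i).+1 by rewrite JBE cast_ord_id.
have ME i j : (\mxdiag_(k < m) jordan_block (p k) (a k)) i j =
    a (tagnat.sig1 i) *+ (i == j) + ((i.+1 == j) && (JB i == JB j))%:R.
  rewrite /mxdiag /mxblock mxE !JBE' eqSS val_eqE.
  have [eq_ij|ne_ij] := eqVneq; last first.
    rewrite mxE andbF addr0; case: eqVneq => // ij.
    by rewrite ij eqxx in ne_ij.
  have rij := (tagnat.rect i, tagnat.rect j).
  rewrite -!val_eqE /= [in RHS]rij.1 [in RHS]rij.2.
  move: (tagnat.sig2 i) (tagnat.sig2 j); rewrite -eq_ij => s2i s2j.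
  rewrite conform_mx_id mxE -addnS !eqn_add2l andbT.
  by rewrite -val_eqE.
split=> [i j|i j|i j ij].
- rewrite !ME !eqxx !(gtn_eqF (ltnSn _)) /= !addr0 !mulr1n !JBE' => -[].
  by move/val_inj=> ->.
- by rewrite !ME eqxx (gtn_eqF (ltnSn _)) /= addr0 mulr1n.
by rewrite !JBE' ltnS; apply: tagnat.le_sig1.
Qed.

Section Entries.
Variables (n : nat) (J : 'M[K]_n) (JB : 'I_n -> nat).
Hypothesis JBJ : forall i j, JB i = JB j -> J i i = J j j.
Hypothesis JE : forall i j : 'I_n,
  J i j = J i i *+ (i == j) + ((i.+1 == j) && (JB i == JB j))%:R.
Hypothesis JBle : forall i j : 'I_n, (i <= j)%N -> (JB i <= JB j)%N.

(** The first indices of the blocks with eigenvalue [a] and size greater than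
    [k]. *)
Definition block_head (a : K) (k : nat) : {set 'I_n} :=
  [set s : 'I_n | [&& J s s == a,
     [forall i : 'I_n, (i.+1 == s) ==> (JB i != JB s)] &
     [exists j : 'I_n, (j == s + k :> nat)%N && (JB j == JB s)]]].

Lemma jordan_shift_mul (a : K) (v : 'cV[K]_n) (i : 'I_n) :
  ((J - a%:M) *m v) i 0 = (J i i - a) * v i 0 +
    \sum_(j : 'I_n | (j == i.+1 :> nat) && (JB j == JB i)) v j 0.
Proof.
rewrite mxE; under eq_bigr do rewrite mxE JE !mxE.
rewrite [in RHS]big_mkcond [X in _ = X + _](_ : _ =
   \sum_j (if j == i then (J i i - a) * v j 0 else 0)); last first.
  by rewrite -big_mkcond big_pred1_eq.
rewrite -big_split; apply: eq_bigr => j _ /=.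
rewrite [i == j]eq_sym [i.+1 == _]eq_sym [JB i == _]eq_sym.
case: (j == i); case: (_ && _) => /=; rewrite ?mulr1n ?mulr0n; ring.
Qed.

Lemma jordan_pow_mul (a : K) (v : 'cV[K]_n) k (i : 'I_n) : J i i = a ->
  ((J - a%:M) ^+ k *m v) i 0 =
    \sum_(j : 'I_n | (j == i + k :> nat)%N && (JB j == JB i)) v j 0.
Proof.
elim: k i => [|k IHk] i Jii.
  rewrite expr0 mul1mx (eq_bigl (pred1 i)) ?big_pred1_eq // => j.
  by rewrite addn0 val_eqE /=; case: eqVneq => // ->; rewrite eqxx.
rewrite exprS -mulmxA jordan_shift_mul Jii subrr mul0r add0r.
under eq_bigr => j /andP[_ /eqP Bj] do rewrite (IHk j (etrans (JBJ Bj) Jii)).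
have [ltin|geni] := ltnP i.+1 n; last first.
  rewrite big_pred0 ?big_pred0 // => j; apply/negbTE; rewrite negb_and;
    by apply/orP; left; rewrite neq_ltn (leq_trans (ltn_ord j)) //;
       apply: leq_trans geni _; rewrite -addn1 leq_add2l.
pose i1 := Ordinal ltin.
have [B1|B1] := eqVneq (JB i1) (JB i).
  rewrite (big_pred1 i1) => [|j]; last first.
    rewrite /= -[j == i1]val_eqE /=; case: eqVneq => //= ji.
    by rewrite (_ : j = i1) ?B1 ?eqxx //; apply: val_inj.
  by apply: eq_bigl => j /=; rewrite addSnnS B1.
rewrite big_pred0 => [|j]; last first.
  apply/negbTE/negP => /andP[/eqP ji Bj]; case/negP: B1.
  by rewrite -(_ : j = i1) //; apply: val_inj.
rewrite big_pred0 // => j; apply/negbTE/negP => /andP[/eqP ji /eqP Bj].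
case/negP: B1; rewrite eqn_leq -{1}Bj !JBle //= ?ji //.
by rewrite -addSnnS leq_addr.
Qed.

(** Row [j] of the equation isolates the coordinate at the successor of [j] in its
    block, so that only the first index of a block survives.  In a block with
    another eigenvalue all coordinates vanish, from the last one upwards. *)
Lemma jordan_ker_support (a : K) (v : 'cV[K]_n) (i : 'I_n) :
  (J - a%:M) *m v = 0 ->
  (J i i != a) || [exists j : 'I_n, (j.+1 == i) && (JB j == JB i)] -> v i 0 = 0.
Proof.
move=> Jv; have Jv0 l : ((J - a%:M) *m v) l 0 = 0 by rewrite Jv mxE.
have other d (l : 'I_n) : (n - l <= d)%N -> J l l != a -> v l 0 = 0.
  elim: d l => [|d IHd] l; first by rewrite leqn0 subn_eq0 leqNgt ltn_ord.
  move=> ld Jll; have := Jv0 l; rewrite jordan_shift_mul big1 ?addr0.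
    by move/eqP; rewrite mulf_eq0 subr_eq0 (negPf Jll) => /eqP.
  move=> j /andP[/eqP jl /eqP Bj]; apply: IHd; last by rewrite (JBJ Bj).
  by rewrite jl; have := ltn_ord l; lia.
case/orP=> [|/existsP[j /andP[/eqP ji /eqP Bj]]]; first exact: other.
have [Jii|] := eqVneq (J j j) a; last by rewrite (JBJ Bj); apply: other.
have := Jv0 j; rewrite jordan_shift_mul Jii subrr mul0r add0r.
rewrite (big_pred1 i) // => l; rewrite ji val_eqE /=.
by case: eqVneq => //= ->; rewrite Bj eqxx.
Qed.

Lemma rank_le_support m (A : 'M[K]_(m, n)) (S : {set 'I_n}) :
  (forall i j, j \notin S -> A i j = 0) -> (\rank A <= #|S|)%N.
Proof.
move=> A0; pose D := \matrix_(i < #|S|, j < n) ((enum_val i == j)%:R : K).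
suff -> : A = (\matrix_(i, j) A i (enum_val j)) *m D.
  by rewrite (leq_trans (mxrankM_maxr _ _)) // rank_leq_row.
apply/matrixP=> i j; rewrite mxE; have [jS|jS] := boolP (j \in S).
  rewrite (bigD1 (enum_rank_in jS j)) //= !mxE enum_rankK_in // eqxx mulr1.
  rewrite big1 ?addr0 // => l; rewrite !mxE => lj.
  rewrite (_ : _ == j = false) ?mulr0 //; apply: contraNF lj => /eqP lj.
  by apply/eqP/enum_val_inj; rewrite enum_rankK_in.
rewrite A0 // big1 // => l _; rewrite !mxE.
rewrite (_ : _ == j = false) ?mulr0 //; apply: contraNF jS => /eqP <-.
exact: enum_valP.
Qed.

(** A kernel vector is supported on first indices of blocks, and a vector in the
    image of the [k]-th power has no component in the last [k] indices of a
    block with eigenvalue [a]. *)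
Lemma jcount_le_heads (a : K) k : (jcount J^T a k <= #|block_head a k|)%N.
Proof.
rewrite /jcount; set C := (_ :&: _)%MS; apply: rank_le_support => r i iS.
have Cker : (J - a%:M) *m (row r C)^T = 0.
  apply: trmx_inj; rewrite trmx_mul trmxK trmx0 linearB /= tr_scalar_mx.
  by apply/sub_kermxP; rewrite (submx_trans (row_sub _ _)) // capmxSr.
have /submxP[w rw] : (row r C <= (J^T - a%:M) ^+ k)%MS.
  by rewrite (submx_trans (row_sub _ _)) // capmxSl.
have Cpow : (row r C)^T = (J - a%:M) ^+ k *m w^T.
  by rewrite rw trmx_mul tr_mxX linearB /= trmxK tr_scalar_mx.
have -> : C r i = (row r C)^T i 0 by rewrite !mxE.
have [Jii|Jii] := eqVneq (J i i) a; last first.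
  by apply: (jordan_ker_support Cker); rewrite Jii.
have [ex|nex] := boolP [exists j : 'I_n, (j.+1 == i) && (JB j == JB i)].
  by apply: (jordan_ker_support Cker); rewrite ex orbT.
rewrite Cpow jordan_pow_mul // big_pred0 // => j.
apply: contraNF iS => ij; rewrite inE Jii eqxx /=; apply/andP; split.
  apply/forallP=> l; apply/implyP=> li; apply: contraNneq nex => Bl.
  by apply/existsP; exists l; rewrite li Bl eqxx.
by apply/existsP; exists j.
Qed.
End Entries.
End JordanMatrices.

(** * The partition condition in terms of four indices *)

Section Patterns.
Variables (K : numFieldType) (lam : 'I_6 -> K) (JB : 'I_6 -> nat).

(** The pairs [{p, q}] and [{r, s}] have no block in common, or have two blocks in
    common that each of them meets once, or lie in a single block. *)
Definition pattern4 (c : K) (p q r s : 'I_6) :=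
  [/\ uniq [:: p; q; r; s], lam p + lam q = c *+ 2, lam r + lam s = c *+ 2 &
   [\/ [/\ JB p <> JB r, JB p <> JB s, JB q <> JB r & JB q <> JB s],
       [/\ JB p = JB r, JB q = JB s & JB p <> JB q] |
       [/\ JB p = JB q, JB q = JB r & JB r = JB s]]].

(** The partition condition for [I1 = {p, q}] and [I2 = {r, s}]; then [- c *+ 2] is
    the sum over [I3]. *)
Definition jordan_pattern c :=
  \sum_i lam i = c *+ 2 /\ exists p q r s, pattern4 c p q r s.

Hypothesis JBlam : forall i j, JB i = JB j -> lam i = lam j.

Lemma uniq4 (T : eqType) (p q r s : T) : uniq [:: p; q; r; s] ->
  [/\ p != q, p != r, p != s & [/\ q != r, q != s & r != s]].
Proof.
by rewrite /= !inE !negb_or => /and4P[/and3P[-> -> ->] /andP[-> ->] -> _].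
Qed.

Lemma sum_setU (A B : {set 'I_6}) : [disjoint A & B] ->
  \sum_(i in A :|: B) lam i = \sum_(i in A) lam i + \sum_(i in B) lam i.
Proof. by move=> dAB; rewrite -bigU //; apply: eq_bigl => i; rewrite !inE. Qed.

Lemma set2_other (T : finType) (p q j : T) :
  p != q -> [set p; j] = [set p; q] -> j = q.
Proof.
move=> pq /setP/(_ q); rewrite !inE eqxx orbT eq_sym (negPf pq) /=.
by move/eqP.
Qed.

(** Suppose that [i1] in [I1] and [i2] in [I2] share a block.  If one of the pairs
    lies in that block, then so do both by (iii).  Otherwise, if the remaining
    indices [j1] and [j2] do not share a block, all four eigenvalues are equal
    by (ii), and regrouping the indices as [{i1, i2}] and [{j1, j2}] gives pairs
    without common block. *)
Lemma jordan_condition_pattern : jordan_condition lam JB ->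
  exists c, jordan_pattern c.
Proof.
case=> I1 [I2 [I3 /=]]; set mu := - (_ / _); case.
case=> c1 c2 c3 part [S12 S23] cii ciii.
have cov : I1 :|: I2 :|: I3 = setT.
  apply/setP=> i; rewrite [RHS]inE.
  have: i \in cover [set I1; I2; I3] by rewrite (cover_partition part) inE.
  by case/bigcupP=> B; rewrite !inE => /orP[/orP[]|]/eqP-> ->; rewrite ?orbT.
have cU : #|I1 :|: I2 :|: I3| = 6%N by rewrite cov cardsT card_ord.
have d12 : [disjoint I1 & I2].
  have := cardsU (I1 :|: I2) I3; have := cardsU I1 I2.
  rewrite cU c1 c2 c3 -setI_eq0 -cards_eq0; lia.
have d3 : [disjoint I1 :|: I2 & I3].
  have := cardsU (I1 :|: I2) I3; have := cardsU I1 I2.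
  rewrite cU c1 c2 c3 -setI_eq0 -cards_eq0; lia.
have sum : \sum_i lam i = mu *+ 2.
  rewrite (eq_bigl (fun i => i \in I1 :|: I2 :|: I3)); last first.
    by move=> i; rewrite cov inE.
  rewrite sum_setU // sum_setU // S12 S23 subrK /mu; set X := \sum_(i in I3) _.
  by field.
have S3 : - \sum_(i in I3) lam i = mu *+ 2.
  by rewrite /mu; set X := \sum_(i in I3) _; field.
have key p q r s : [set p; q] = I1 -> [set r; s] = I2 ->
    [/\ uniq [:: p; q; r; s], lam p + lam q = mu *+ 2 & lam r + lam s = mu *+ 2].
  move=> E1 E2; have pq : p != q by move: c1; rewrite -E1 cards2; case: (_ != _).
  have rs : r != s by move: c2; rewrite -E2 cards2; case: (_ != _).
  have := S3; rewrite -S23 -S12 -{1}E1 big_setU1 ?inE // big_set1 => Lpq.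
  have := S3; rewrite -S23 -E2 big_setU1 ?inE // big_set1 => Lrs.
  split=> //; move: d12; rewrite -E1 -E2 disjoints_subset.
  move=> /subsetP sub; have := sub p; have := sub q.
  rewrite !inE !eqxx orbT /= => /(_ isT) nq /(_ isT) np; rewrite !inE.
  by move: nq np; rewrite !negb_or pq rs => /andP[-> ->] /andP[-> ->].
have cross i1 i2 j1 j2 : [set i1; j1] = I1 -> [set i2; j2] = I2 ->
    JB i1 = JB i2 -> exists p q r s, pattern4 mu p q r s.
  move=> F1 F2 B12; have [u4 L1 L2] := key _ _ _ _ F1 F2.
  have [m1 m1' m2 m2'] : [/\ i1 \in I1, j1 \in I1, i2 \in I2 & j2 \in I2].
    by rewrite -F1 -F2 !inE !eqxx !orbT.
  have same : JB i1 = JB j1 \/ JB i2 = JB j2 ->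
      exists p q r s, pattern4 mu p q r s.
    move=> Bsame; have [|_ Bjk] := ciii.
      case: Bsame => Bsame; [left; exists i2|right; exists i1] => // j;
        by rewrite -(F1, F2) !inE => /orP[]/eqP->; rewrite -?Bsame.
    exists i1, j1, i2, j2; split=> //; constructor 3.
    by split; apply: Bjk; rewrite inE ?m1 ?m1' ?m2 ?m2' ?orbT.
  have [B1|/eqP B1] := eqVneq (JB i1) (JB j1); first by apply: same; left.
  have [B2|/eqP B2] := eqVneq (JB i2) (JB j2); first by apply: same; right.
  have [Bj|/eqP Bj] := eqVneq (JB j1) (JB j2).
    by exists i1, j1, i2, j2; split=> //; constructor 2.
  have [[l12 l2]|Bj'] := cii _ _ m1 m2 B12; last by case: Bj; apply: Bj'.
  have l1 : lam i1 = mu by rewrite l12.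
  have lj1 : lam j1 = mu by apply: (addrI mu); rewrite -{1}l1 L1 mulr2n.
  have lj2 : lam j2 = mu by apply: (addrI mu); rewrite -{1}l2 L2 mulr2n.
  exists i1, i2, j1, j2; split; rewrite ?l1 ?l2 ?lj1 ?lj2 ?mulr2n //.
    have [] := uniq4 u4; rewrite /= !inE !negb_or => -> -> -> [] + -> ->.
    by rewrite eq_sym => ->.
  by constructor 1; rewrite -B12; split=> //; rewrite B12.
have /eqP/cards2P[p [q [pq E1]]] := c1; have /eqP/cards2P[r [s [rs E2]]] := c2.
exists mu; split=> //.
have [Bpr|/eqP Bpr] := eqVneq (JB p) (JB r).
  by apply: (cross p r q s).
have [Bps|/eqP Bps] := eqVneq (JB p) (JB s).
  by apply: (cross p s q r); rewrite // setUC.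
have [Bqr|/eqP Bqr] := eqVneq (JB q) (JB r).
  by apply: (cross q r p s); rewrite // setUC.
have [Bqs|/eqP Bqs] := eqVneq (JB q) (JB s).
  by apply: (cross q s p r); rewrite // setUC.
have [u4 L1 L2] := key p q r s (esym E1) (esym E2).
by exists p, q, r, s; split=> //; constructor 1.
Qed.

Lemma pattern_jordan_condition c : jordan_pattern c -> jordan_condition lam JB.
Proof.
case=> sum [p [q [r [s [uniq Spq Srs pat]]]]].
have [upq upr ups [uqr uqs urs]] := uniq4 uniq.
pose I1 := [set p; q]; pose I2 := [set r; s]; pose I3 := ~: (I1 :|: I2).
exists I1, I2, I3.
have c1 : #|I1| = 2%N by rewrite cards2 upq.
have c2 : #|I2| = 2%N by rewrite cards2 urs.
have d12 : [disjoint I1 & I2].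
  rewrite -setI_eq0; apply/eqP/setP => i; rewrite !inE.
  by apply/negbTE; rewrite negb_and !negb_or; case: (eqVneq i p) => [->|_] /=;
    [rewrite upr ups|case: (eqVneq i q) => [->|//] /=; rewrite uqr uqs].
have c3 : #|I3| = 2%N.
  by rewrite cardsCs setCK card_ord cardsU disjoint_setI0 // cards0 c1 c2.
have S1 : \sum_(i in I1) lam i = c *+ 2 by rewrite big_setU1 ?big_set1 // inE.
have S2 : \sum_(i in I2) lam i = c *+ 2 by rewrite big_setU1 ?big_set1 // inE.
have S3 : \sum_(i in I3) lam i = - (c *+ 2).
  have := sum; rewrite (bigID (mem (I1 :|: I2))) /= sum_setU // S1 S2.
  rewrite (eq_bigl (mem I3)) => [|i]; last by rewrite !inE.
  by move=> E; apply: (addrI (c *+ 2 + c *+ 2)); rewrite E; ring.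
have mu : - ((\sum_(i in I3) lam i) / 2) = c.
  by rewrite S3; field.
have all_c : JB p = JB q -> JB q = JB r -> JB r = JB s ->
    forall j, j \in I1 :|: I2 -> lam j = c.
  move=> B1 B2 B3 j jI; have lj : lam j = lam p.
    by apply: JBlam; move: jI; rewrite !inE => /orP[]/orP[]/eqP->;
      rewrite -?B3 -?B2 -?B1.
  have two0 : 2%:R != 0 :> K by rewrite pnatr_eq0.
  by apply: (mulIf two0); rewrite !mulr_natr lj -Spq -(JBlam B1) mulr2n.
rewrite mu; split.
- split=> //; apply/and3P; split.
  + apply/eqP/setP=> i; rewrite [RHS]inE; apply/bigcupP.
    have [iU|iU] := boolP (i \in I1 :|: I2); last first.
      by exists I3; [rewrite !inE eqxx orbT|rewrite in_setC].
    by move: iU; rewrite inE => /orP[] iI; [exists I1|exists I2] => //;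
      rewrite !inE eqxx ?orbT.
  + apply/trivIsetP=> A B.
    have d3 (A' : {set 'I_6}) : A' \subset I1 :|: I2 -> [disjoint A' & I3].
      by move=> sub; rewrite disjoints_subset setCK.
    have d13 := d3 _ (subsetUl I1 I2); have d23 := d3 _ (subsetUr I1 I2).
    by rewrite !inE => /orP[/orP[]|]/eqP-> /orP[/orP[]|]/eqP->;
      rewrite ?eqxx // ?[[disjoint I2 & I1]]disjoint_sym
        ?[[disjoint I3 & _]]disjoint_sym.
  by rewrite !inE !negb_or ![set0 == _]eq_sym -!cards_eq0 c1 c2 c3.
- by rewrite S1 S2 S3 opprK.
- move=> i1 i2 + + B12; rewrite !inE.
  case: pat => [[B1 B2 B3 B4]|[B1 B2 B3]|[B1 B2 B3]].
  + by move=> /orP[]/eqP E1 /orP[]/eqP E2; move: B12; rewrite E1 E2.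
  + move=> /orP[]/eqP E1 /orP[]/eqP E2; move: B12; rewrite E1 E2 => B12.
    * right=> j1 j2 F1 F2.
      by rewrite (set2_other upq F1) (set2_other urs F2).
    * by case: B3; rewrite B12 -B2.
    * by case: B3; rewrite B1 -B12.
    * right=> j1 j2; rewrite /I1 /I2 (setUC [set p]) (setUC [set r]) => F1 F2.
      rewrite eq_sym in upq; rewrite eq_sym in urs.
      by rewrite (set2_other upq F1) (set2_other urs F2).
  + by move=> i1I i2I; left; rewrite !(all_c B1 B2 B3) ?inE ?i1I ?i2I ?orbT.
- case: pat => [[B1 B2 B3 B4]|[B1 B2 B3]|[B1 B2 B3]].
  + case=> [[i iI Bi]|[i iI Bi]].
      have := Bi p; have := Bi q; move: iI; rewrite !inE !eqxx orbT.
      by case/orP=> /eqP-> /(_ isT) Bq /(_ isT) Bp.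
    have := Bi r; have := Bi s; move: iI; rewrite !inE !eqxx orbT.
    by case/orP=> /eqP-> /(_ isT) Bq /(_ isT) Bp; [case: B1|case: B3].
  + case=> [[i iI Bi]|[i iI Bi]]; case: B3.
      by rewrite !Bi ?inE ?eqxx ?orbT.
    by rewrite B1 B2 !Bi ?inE ?eqxx ?orbT.
  move=> _; split=> [j|j k]; first exact: all_c.
  have all_B l : l \in I1 :|: I2 -> JB l = JB p.
    by rewrite !inE => /orP[]/orP[]/eqP->; rewrite -?B3 -?B2 -?B1.
  by move=> /all_B-> /all_B->.
Qed.
End Patterns.

(** * Invariant symplectic four-spaces *)

Section SymplecticSubspace.
Variable K : numFieldType.

(** The rows of [Y] span an [N]-invariant four-space on which [N - \tr N / 2] is in
    the symplectic algebra of the bivector [W]. *)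
Definition sp_sub n (N : 'M[K]_n) (W : 'M[K]_4) :=
  exists (Y : 'M[K]_(4, n)) (M : 'M[K]_4),
    [/\ row_free Y, Y *m N = M *m Y & M *m W + W *m M^T = \tr N *: W].

Lemma sp_trace n (M W : 'M[K]_n) t : W \in unitmx ->
  M *m W + W *m M^T = t *: W -> \tr M *+ 2 = t *+ n.
Proof.
move=> uW /(congr1 (fun Z => \tr (Z *m invmx W))).
rewrite mulmxDl mxtraceD mulmxK // mxtrace_mulC mulKmx // mxtrace_tr -mulr2n => ->.
by rewrite -scalemxAl mulmxV // linearZ /= mxtrace1 mulr_natr.
Qed.

Lemma sp_sub_congr n (N : 'M[K]_n) (W1 W2 : 'M[K]_4) :
  W1^T = - W1 -> W1 \in unitmx -> W2^T = - W2 -> W2 \in unitmx ->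
  sp_sub N W1 -> sp_sub N W2.
Proof.
move=> sk1 u1 sk2 u2 [Y [M [Yf YN MW]]].
have [C uC ->] := skew_unit_congr sk1 u1 sk2 u2.
exists (C *m Y), (C *m M *m invmx C); split.
- by rewrite /row_free mxrankMfree // mxrank_unit.
- by rewrite -!mulmxA YN mulKmx.
rewrite !mulmxA mulmxKV // !trmx_mul trmx_inv -!mulmxA.
rewrite (mulmxA C^T) mulmxV ?unitmx_tr // mul1mx.
by rewrite -mulmxDr (mulmxA M) (mulmxA W1) -mulmxDl MW -scalemxAl -scalemxAr.
Qed.

Definition mx4 (s : seq (seq K)) : 'M[K]_4 := \matrix_(i, j) nth 0 (nth [::] s i) j.

(** Two normal forms of a non-degenerate bivector: [darboux2] is suited to a pair of
    orthogonal planes, [darboux4] to Jordan chains in duality. *)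
Definition darboux2 : 'M[K]_4 :=
  mx4 [:: [:: 0; 1; 0; 0]; [:: -1; 0; 0; 0]; [:: 0; 0; 0; 1]; [:: 0; 0; -1; 0]].

Definition darboux4 : 'M[K]_4 :=
  mx4 [:: [:: 0; 0; 0; 1]; [:: 0; 0; -1; 0]; [:: 0; 1; 0; 0]; [:: -1; 0; 0; 0]].

(** An endomorphism on Jordan chains put one after another; the entries [e1], [e2],
    [e3] tell where a chain continues. *)
Definition chain4 (m0 m1 m2 m3 e1 e2 e3 : K) : 'M[K]_4 :=
  mx4 [:: [:: m0; 0; 0; 0]; [:: e1; m1; 0; 0]; [:: 0; e2; m2; 0];
          [:: 0; 0; e3; m3]].

Ltac mx4_tac :=
  rewrite /darboux2 /darboux4 ?/chain4 /mx4; apply/matrixP;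
  do 2![case=> [] [|[|[|[|?]]]] //= ?];
  rewrite ?mxE ?big_ord_recl ?big_ord0 ?mxE /= ?(mulr1n, mulr0n); ring.

Lemma darboux2_skew : darboux2^T = - darboux2. Proof. mx4_tac. Qed.
Lemma darboux4_skew : darboux4^T = - darboux4. Proof. mx4_tac. Qed.

Lemma darboux2_unit : darboux2 \in unitmx.
Proof.
suff /mulmx1_unit[] : darboux2 *m (- darboux2) = 1%:M by [].
mx4_tac.
Qed.

Lemma darboux4_unit : darboux4 \in unitmx.
Proof.
suff /mulmx1_unit[] : darboux4 *m (- darboux4) = 1%:M by [].
mx4_tac.
Qed.

Lemma chain4_darboux2 m0 m1 m2 m3 e1 e3 t : m0 + m1 = t -> m2 + m3 = t ->
  let M := chain4 m0 m1 m2 m3 e1 0 e3 in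
  M *m darboux2 + darboux2 *m M^T = t *: darboux2.
Proof. by move=> /(canRL (addKr _)) -> /(canRL (addKr _)) -> M; mx4_tac. Qed.

Lemma chain4_darboux4 m0 m2 e1 e2 t : m0 + m2 = t ->
  let M := chain4 m0 m0 m2 m2 e1 e2 e1 in
  M *m darboux4 + darboux4 *m M^T = t *: darboux4.
Proof. by move=> /(canRL (addKr _)) -> M; mx4_tac. Qed.

End SymplecticSubspace.

(** * Four-spaces spanned by initial segments of Jordan chains *)

Section PatternToSubspace.
Variables (K : numFieldType) (J : 'M[K]_6) (JB : 'I_6 -> nat).
Hypothesis JBJ : forall i j, JB i = JB j -> J i i = J j j.
Hypothesis JE : forall i j : 'I_6,
  J i j = J i i *+ (i == j) + ((i.+1 == j) && (JB i == JB j))%:R.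
Hypothesis JBle : forall i j : 'I_6, (i <= j)%N -> (JB i <= JB j)%N.

Definition is_head (h : 'I_6) := forall i : 'I_6, i.+1 = h -> JB i <> JB h.

Lemma head_exists (p : 'I_6) :
  exists h, [/\ is_head h, JB h = JB p & forall l, JB l = JB p -> (h <= l)%N].
Proof.
case: (@arg_minnP _ p (fun i => JB i == JB p) (fun i => i : nat)) => // h.
move=> /eqP Bh hmin; exists h; split=> // [|l Bl]; last by apply: hmin; apply/eqP.
move=> i ih Bi; have := hmin i; rewrite Bi Bh eqxx -ih ltnn => /(_ isT).
by [].
Qed.

Lemma block_interval (h i l : 'I_6) :
  JB h = JB l -> (h <= i <= l)%N -> JB i = JB h.
Proof.
by move=> Bhl /andP[hi il]; apply/eqP; rewrite eqn_leq {1}Bhl !JBle.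
Qed.

Lemma block_nth (h l : 'I_6) k : JB h = JB l -> (h + k <= l)%N ->
  exists i : 'I_6, i = (h + k)%N :> nat /\ JB i = JB h.
Proof.
move=> Bhl hkl; have lt6 : (h + k < 6)%N by apply: leq_ltn_trans hkl _.
by exists (Ordinal lt6); split=> //; apply: (block_interval Bhl); rewrite leq_addr.
Qed.

Lemma head_col h : is_head h -> forall j, J j h = J h h *+ (j == h).
Proof.
move=> hh j; rewrite JE; case: eqVneq => [->|_] /=.
  by rewrite gtn_eqF ?addr0.
by case: eqP => [/hh Bj|_] /=; rewrite ?mulr0n ?addr0 // add0r;
  case: eqP => // /Bj.
Qed.

Lemma next_col (i l : 'I_6) : i.+1 = l -> JB i = JB l ->
  forall j, J j l = J l l *+ (j == l) + 1 *+ (j == i).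
Proof.
move=> il Bil j; rewrite JE; case: eqVneq => [->|jl] /=.
  by rewrite gtn_eqF // -val_eqE /= -il gtn_eqF.
rewrite -il eqSS val_eqE.
by case: eqVneq => [->|] //=; rewrite Bil eqxx.
Qed.

(** The basis vectors of indices [y0], [y1], [y2], [y3] span an invariant subspace
    when each column is supported on its own index and the previous one. *)
Lemma sp_sub_chain (y0 y1 y2 y3 : 'I_6) e1 e2 e3 (W : 'M[K]_4) :
  uniq [:: y0; y1; y2; y3] ->
  (forall j, J j y0 = J y0 y0 *+ (j == y0)) ->
  (forall j, J j y1 = J y1 y1 *+ (j == y1) + e1 *+ (j == y0)) ->
  (forall j, J j y2 = J y2 y2 *+ (j == y2) + e2 *+ (j == y1)) ->
  (forall j, J j y3 = J y3 y3 *+ (j == y3) + e3 *+ (j == y2)) ->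
  let M := chain4 (J y0 y0) (J y1 y1) (J y2 y2) (J y3 y3) e1 e2 e3 in
  M *m W + W *m M^T = \tr J *: W -> sp_sub J^T W.
Proof.
move=> uy C0 C1 C2 C3 M MW.
pose y (i : 'I_4) := nth y0 [:: y0; y1; y2; y3] i.
exists (\matrix_(i, j) (y i == j)%:R), M; split; last by rewrite mxtrace_tr.
  apply/row_freeP; exists (\matrix_(j, i) (y i == j)%:R).
  apply/matrixP=> i k; rewrite !mxE (bigD1 (y i)) //= !mxE eqxx mul1r.
  rewrite nth_uniq // ?ltn_ord // big1 ?addr0 => [|j]; last first.
    by rewrite eq_sym !mxE => /negPf->; rewrite mul0r.
  by rewrite eq_sym.
apply/matrixP=> i j; rewrite !mxE (bigD1 (y i)) //= !mxE eqxx mul1r.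
rewrite big1 ?addr0 => [|k]; last first.
  by rewrite eq_sym !mxE => /negPf->; rewrite mul0r.
rewrite !big_ord_recl big_ord0 !mxE /y.
case: i => [] [|[|[|[|?]]]] //= ?;
  rewrite 1?(C0 j) 1?(C1 j) 1?(C2 j) 1?(C3 j) ![j == _]eq_sym;
  case: (y0 == j); case: (y1 == j); case: (y2 == j); case: (y3 == j);
  by rewrite ?(mulr1n, mulr0n, mulr1, mulr0, mul0r, mul1r, addr0, add0r) 1?[RHS]addrC.
Qed.

Lemma block_pair_chain (p q : 'I_6) : p != q -> JB p = JB q ->
  exists y0 y1 : 'I_6,
    [/\ JB y0 = JB p, JB y1 = JB p, y0 != y1,
        forall j, J j y0 = J y0 y0 *+ (j == y0) &
        forall j, J j y1 = J y1 y1 *+ (j == y1) + 1 *+ (j == y0)].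
Proof.
move=> pq Bpq; have [h [hh Bh hmin]] := head_exists p.
have [l Bl hl] : exists2 l, JB l = JB h & (h + 1 <= l)%N.
  have := hmin p erefl; have := hmin q (esym Bpq); rewrite addn1.
  rewrite -val_eqE /= in pq; case: (ltngtP h p) => // hp.
    by exists p.
  case: (ltngtP h q) => // hq; first by exists q; rewrite ?Bh.
  by rewrite -hp hq eqxx in pq.
have [i [hi Bi]] := block_nth (esym Bl) hl.
exists h, i; split; rewrite ?Bi ?Bh //.
- by rewrite -val_eqE /= hi addn1 ltn_eqF.
- exact: head_col.
by apply: next_col; rewrite ?Bi // hi addn1.
Qed.

Lemma pair_chain (p q : 'I_6) : p != q ->
  exists (y0 y1 : 'I_6) (e : K),
    [/\ JB y0 = JB p, JB y1 = JB q, y0 != y1,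
        forall j, J j y0 = J y0 y0 *+ (j == y0) &
        forall j, J j y1 = J y1 y1 *+ (j == y1) + e *+ (j == y0)].
Proof.
move=> pq; have [Bpq|/eqP Bpq] := eqVneq (JB p) (JB q).
  have [y0 [y1 C]] := block_pair_chain pq Bpq.
  by exists y0, y1, 1; rewrite -Bpq.
have [h [hh Bh _]] := head_exists p; have [h' [hh' Bh' _]] := head_exists q.
exists h, h', 0; split=> //.
- by apply: contra_not_neq Bpq => E; rewrite -Bh E.
- exact: head_col.
by move=> j; rewrite mul0rn addr0; apply: head_col.
Qed.

(** Two pairs without common block: each pair is replaced by initial indices of its
    blocks, giving two planes that are orthogonal.  Two common blocks: two initial
    chains of length two, in duality.  One block: an initial chain of length four,
    in duality with itself. *)
Lemma pattern_sp_sub c (W : 'M[K]_4) : W^T = - W -> W \in unitmx ->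
  jordan_pattern (fun i => J i i) JB c -> sp_sub J^T W.
Proof.
move=> skW uW [trJ [p [q [r [s [u4 Spq Srs pat]]]]]].
have [upq upr ups [uqr uqs urs]] := uniq4 u4.
have neqB i j : JB i <> JB j -> i != j by apply: contra_not_neq => ->.
case: pat => [[B1 B2 B3 B4]|[B1 B2 B3]|[B1 B2 B3]].
- have [y0 [y1 [e1 [By0 By1 y01 C0 C1]]]] := pair_chain upq.
  have [y2 [y3 [e3 [By2 By3 y23 C2 C3]]]] := pair_chain urs.
  apply: (sp_sub_congr (darboux2_skew K) (darboux2_unit K) skW uW).
  apply: (sp_sub_chain (y0 := y0) (y1 := y1) (y2 := y2) (y3 := y3)
    (e1 := e1) (e2 := 0) (e3 := e3)) => //.
  + rewrite /= !inE !negb_or y01 y23 !neqB //; by rewrite ?By0 ?By1 ?By2 ?By3.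
  + by move=> j; rewrite mul0rn addr0.
  by apply: chain4_darboux2; rewrite (JBJ By0, JBJ By2) (JBJ By1, JBJ By3)
    ?Spq ?Srs.
- have [y0 [y1 [By0 By1 y01 C0 C1]]] := block_pair_chain upr B1.
  have [y2 [y3 [By2 By3 y23 C2 C3]]] := block_pair_chain uqs B2.
  apply: (sp_sub_congr (darboux4_skew K) (darboux4_unit K) skW uW).
  apply: (sp_sub_chain (y0 := y0) (y1 := y1) (y2 := y2) (y3 := y3)
    (e1 := 1) (e2 := 0) (e3 := 1)) => //.
  + rewrite /= !inE !negb_or y01 y23 !neqB //; by rewrite ?By0 ?By1 ?By2 ?By3.
  + by move=> j; rewrite mul0rn addr0.
  rewrite (JBJ By0) (JBJ By1) (JBJ By2) (JBJ By3).
  by apply: chain4_darboux4; rewrite Spq.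
have [h [hh Bh hmin]] := head_exists p.
have [l Bl hl] : exists2 l, JB l = JB h & (h + 3 <= l)%N.
  rewrite Bh; move: upq upr ups uqr uqs urs; rewrite -!val_eqE /=.
  have := hmin p erefl; have := hmin q (esym B1).
  have := hmin r (esym (etrans B1 B2)).
  have := hmin s (esym (etrans B1 (etrans B2 B3))) => hs hr hq hp *.
  have [?|?] := leqP (h + 3) p; first by exists p.
  have [?|?] := leqP (h + 3) q; first by exists q.
  have [?|?] := leqP (h + 3) r; first by exists r; rewrite // B1 B2.
  by exists s; [rewrite B1 B2 B3|lia].
have bn k : (k <= 3)%N -> exists i : 'I_6, i = (h + k)%N :> nat /\ JB i = JB h.
  by move=> k3; apply: (block_nth (esym Bl)); apply: leq_trans hl; rewrite leq_add2l.
have [y1 [y1E By1]] := bn 1%N isT; have [y2 [y2E By2]] := bn 2%N isT.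
have [y3 [y3E By3]] := bn 3%N isT.
apply: (sp_sub_congr (darboux4_skew K) (darboux4_unit K) skW uW).
apply: (sp_sub_chain (y0 := h) (y1 := y1) (y2 := y2) (y3 := y3)
    (e1 := 1) (e2 := 1) (e3 := 1)).
- by rewrite /= !inE -!val_eqE /= y1E y2E y3E; lia.
- exact: head_col.
- by apply: next_col; rewrite ?By1 // y1E addn1.
- by apply: next_col; rewrite ?By1 ?By2 // y1E y2E; lia.
- by apply: next_col; rewrite ?By2 ?By3 // y2E y3E; lia.
rewrite (JBJ By1) (JBJ By2) (JBJ By3); apply: chain4_darboux4.
by rewrite (JBJ Bh) {2}(JBJ B1) Spq.
Qed.
End PatternToSubspace.

(** * Jordan types in the symplectic algebra of a four-space *)

Section SubspaceToPattern.
Variables (K : numClosedFieldType) (J : 'M[K]_6) (JB : 'I_6 -> nat).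
Hypothesis JBJ : forall i j, JB i = JB j -> J i i = J j j.
Hypothesis JBle : forall i j : 'I_6, (i <= j)%N -> (JB i <= JB j)%N.

Let lam i := J i i.

Lemma block_head_inj a b k l (s s' : 'I_6) :
  s \in block_head J JB a k -> s' \in block_head J JB b l -> JB s = JB s' -> s = s'.
Proof.
have half (x y : 'I_6) c m : y \in block_head J JB c m -> JB x = JB y -> ~~ (x < y)%N.
  rewrite inE => /and3P[_ /forallP hy _] Bxy; apply/negP => xy.
  have y1 : (y.-1 < 6)%N by apply: leq_ltn_trans (leq_pred _) (ltn_ord y).
  have yE : y.-1.+1 = y by rewrite prednK // (leq_ltn_trans _ xy).
  have := hy (Ordinal y1); rewrite /= yE eqxx /= => /negP; case.
  by rewrite eqn_leq JBle /= ?leq_pred // -Bxy JBle //= -ltnS yE.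
move=> hs hs' B; apply/val_inj/eqP; rewrite eqn_leq; apply/andP.
by split; rewrite leqNgt; [apply: (half _ _ _ _ hs (esym B))|apply: (half _ _ _ _ hs' B)].
Qed.

Lemma block_head_lam a k s : s \in block_head J JB a k -> J s s = a.
Proof. by rewrite inE => /andP[/eqP]. Qed.

Lemma block_head_nth a k s i : s \in block_head J JB a k -> (i <= k)%N ->
  exists j : 'I_6, j = (s + i)%N :> nat /\ JB j = JB s.
Proof.
rewrite inE => /and3P[_ _ /existsP[l /andP[/eqP ls /eqP Bl]]] ik.
by apply: (block_nth JBle (esym Bl)); rewrite ls leq_add2l.
Qed.

Lemma block_head_sub a k l : (l <= k)%N ->
  block_head J JB a k \subset block_head J JB a l.
Proof.
move=> lk; apply/subsetP => s sk; have [j [js Bj]] := block_head_nth sk lk.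
move: sk; rewrite !inE => /and3P[-> -> _] /=.
by apply/existsP; exists j; rewrite js Bj !eqxx.
Qed.

(** The matrix [N] is [M - c] for the action [M] on a four-dimensional subquotient,
    so its eigenvalue [a] corresponds to the eigenvalue [c + a] of [J]. *)
Section Classification.
Variables (c : K) (N W : 'M[K]_4).
Hypotheses (skW : W^T = - W) (uW : W \in unitmx).
Hypothesis NW : N *m W + W *m N^T = 0.
Hypothesis trJ : \sum_i lam i = c *+ 2.
Hypothesis heads : forall a k,
  (jcount N a k <= #|block_head J JB (c + a) k|)%N.

Lemma eigenvector_in m (U : 'M[K]_(m, 4)) : U != 0 -> (U *m N <= U)%MS ->
  exists a (v : 'rV[K]_4), [/\ v *m N = a *: v, v != 0 & (v <= U)%MS].
Proof.
move=> U0 UN; have [r rE] : exists r, \rank U = r.+1.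
  by exists (\rank U).-1; rewrite prednK // lt0n mxrank_eq0.
have [Z [Zf ZU]] := row_base_of_rank rE.
have /submxP[L ZN] : (Z *m N <= Z)%MS.
  by rewrite (submx_trans (submxMr _ (_ : (Z <= U)%MS))) ?ZU // (submx_trans UN) // ZU.
have [a [v [vL v0]]] := eigenvector_exists L.
exists a, (v *m Z); split.
- by rewrite -mulmxA ZN mulmxA vL scalemxAl.
- by rewrite mulmx_free_eq0.
by rewrite (submx_trans (submxMl _ _)) ?ZU.
Qed.

(** [W] intertwines [N] with [- N^T]; this makes the Jordan types of [N] at [a] and
    at [- a] agree. *)
Lemma NW_pow a k :
  (N - a%:M) ^+ k *m W = (-1) ^+ k *: (W *m ((N + a%:M) ^+ k)^T).
Proof.
elim: k => [|k IHk]; first by rewrite !expr0 scale1r trmx1 mulmx1 mul1mx.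
rewrite exprSr -mulmxA.
have -> : (N - a%:M) *m W = - (W *m (N + a%:M)^T).
  rewrite mulmxBl linearD /= tr_scalar_mx mulmxDr opprD mul_scalar_mx mul_mx_scalar.
  by congr (_ - _); apply/eqP; rewrite -addr_eq0 NW.
rewrite mulmxN mulmxA IHk -scalemxAl exprS mulN1r scaleNr.
by rewrite -mulmxA -trmx_mul exprS.
Qed.

Lemma rank_opp a k : \rank ((N - a%:M) ^+ k) = \rank ((N + a%:M) ^+ k).
Proof.
have Wf : row_free W by rewrite row_free_unit.
rewrite -(mxrankMfree _ Wf) NW_pow.
rewrite mxrank_scale_nz ?signr_eq0 //.
by rewrite -mxrank_tr trmx_mul trmxK mxrankMfree // row_free_unit unitmx_tr.
Qed.

Lemma jcount_opp a k : jcount N (- a) k = jcount N a k.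
Proof.
apply/(@addnI (\rank ((N - a%:M) ^+ k.+1))); rewrite jcountE.
have := jcountE N (- a) k; rewrite raddfN /= opprK -!rank_opp.
by [].
Qed.

(** The matrix [N ^+ 2 *m W = - (N *m W *m N^T)] is skew-symmetric. *)
Lemma rank_sqr_even : ~~ odd (\rank (N ^+ 2)).
Proof.
have Wf : row_free W by rewrite row_free_unit.
rewrite -(mxrankMfree _ Wf); apply: skew_rank_even.
have NWE : N *m W = - (W *m N^T) by apply/eqP; rewrite -addr_eq0 NW.
have -> : N ^+ 2 *m W = - (N *m W *m N^T).
  by rewrite expr2 -[LHS]mulmxA [in LHS]NWE mulmxN mulmxA.
by rewrite linearN /= !trmx_mul trmxK skW !mulNmx !mulmxN mulmxA.
Qed.

Lemma eigen_rank a : (0 < jcount N a 0)%N = ~~ row_free (N - a%:M).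
Proof.
have E : (\rank (N - a%:M)%R + jcount N a 0 = 4)%N.
  by have := jcountE N a 0; rewrite expr1 expr0 mxrank1.
rewrite /row_free; move: (\rank (N - a%:M)) E => r; lia.
Qed.

Lemma eigenvector_jcount a (v : 'rV[K]_4) : v *m N = a *: v -> v != 0 ->
  (0 < jcount N a 0)%N.
Proof.
move=> vN v0; rewrite eigen_rank; apply: contra v0 => Nf.
by rewrite -(mulmx_free_eq0 _ Nf) mulmxBr vN mul_mx_scalar subrr.
Qed.

(** The invariant image of [N ^+ k] contains an eigenvector, necessarily of
    eigenvalue zero. *)
Lemma nilpotent_rank_drop : (forall a, (0 < jcount N a 0)%N -> a = 0) ->
  forall k, N ^+ k != 0 -> (0 < jcount N 0 k)%N.
Proof.
move=> nil k Nk0; have [||a [v [vN v0 vNk]]] := @eigenvector_in _ (N ^+ k).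
- by [].
- by rewrite -[X in (X <= _)%MS]/(N ^+ k * N) -exprSr exprS submxMl.
have a0 : a = 0 by apply: nil; apply: eigenvector_jcount vN v0.
rewrite /jcount lt0n mxrank_eq0 raddf0 subr0; apply: contraNneq v0 => cap0.
rewrite -submx0 -cap0 sub_capmx vNk; apply/sub_kermxP.
by rewrite vN a0 scale0r.
Qed.

Lemma two_heads a k : (1 < jcount N a k)%N -> exists p q : 'I_6,
  [/\ p \in block_head J JB (c + a) k, q \in block_head J JB (c + a) k,
    JB p <> JB q, lam p = c + a & lam q = c + a].
Proof.
move/leq_trans/(_ (heads a k)) => /card_gt1P[p [q [hp hq pq]]].
exists p, q; split=> //; [|exact: block_head_lam hp|exact: block_head_lam hq].
by move/(block_head_inj hp hq)/eqP; apply/negP.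
Qed.

Lemma one_head a k : (0 < jcount N a k)%N -> exists p : 'I_6,
  p \in block_head J JB (c + a) k /\ lam p = c + a.
Proof.
move/leq_trans/(_ (heads a k)) => /card_gt0P[p hp].
by exists p; rewrite /lam (block_head_lam hp).
Qed.

Lemma lam_neq p q a b : lam p = c + a -> lam q = c + b -> a != b -> JB p <> JB q.
Proof.
by move=> lp lq ab /JBJ E; case/eqP: ab; apply: (addrI c); rewrite -lp -lq.
Qed.

Lemma JB_neq p q : JB p <> JB q -> p != q.
Proof. by apply: contra_not_neq => ->. Qed.

Lemma next_in_block a k p : p \in block_head J JB a k.+1 ->
  exists p' : 'I_6, [/\ JB p' = JB p, p != p' & lam p' = lam p].
Proof.
move=> hp; have [p' [p'E Bp']] := block_head_nth hp (ltn0Sn k).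
exists p'; split=> //; last exact: JBJ.
by rewrite -val_eqE /= p'E; lia.
Qed.

Lemma pattern_disjoint p q r s :
  p != q -> r != s -> lam p + lam q = c *+ 2 -> lam r + lam s = c *+ 2 ->
  JB p <> JB r -> JB p <> JB s -> JB q <> JB r -> JB q <> JB s ->
  jordan_pattern lam JB c.
Proof.
move=> pq rs Spq Srs B1 B2 B3 B4; split=> //; exists p, q, r, s; split=> //.
  by rewrite /= !inE !negb_or pq rs !JB_neq.
by constructor 1.
Qed.

(** Indices that can serve as one of the two pairs, for the eigenvalues [a] and
    [- a] of [N]. *)
Definition eigen_pair a p q :=
  [/\ p != q, lam p + lam q = c *+ 2, lam p = c + a & lam q = c - a].

Lemma pattern_semisimple_pair a b : a != b -> a != - b ->
  (exists p q, eigen_pair a p q) -> (exists p q, eigen_pair b p q) ->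
  jordan_pattern lam JB c.
Proof.
move=> ab anb [p [q [pq Spq lp lq]]] [r [s [rs Srs lr ls]]].
apply: (pattern_disjoint pq rs Spq Srs).
- exact: lam_neq lp lr ab.
- exact: lam_neq lp ls anb.
- by apply: lam_neq lq lr _; rewrite eqr_oppLR.
by apply: lam_neq lq ls _; rewrite eqr_opp.
Qed.

Lemma opposite_pair a : a != 0 -> (0 < jcount N a 0)%N ->
  exists p q, eigen_pair a p q.
Proof.
move=> a0 ja; have [p [_ lp]] := one_head ja.
have [|q [_ lq]] := @one_head (- a) 0; first by rewrite jcount_opp.
exists p, q; split=> //; last by rewrite lp lq; ring.
apply/JB_neq/(lam_neq lp lq); rewrite -subr_eq0 opprK -mulr2n mulrn_eq0.
by rewrite negb_or a0.
Qed.

Lemma jcount0_rank k :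
  (\rank (N ^+ k.+1) + jcount N 0 k)%N = \rank (N ^+ k).
Proof. by have := jcountE N 0 k; rewrite raddf0 subr0. Qed.

(** If zero has a single block, that block has size at least two, since otherwise
    [N ^+ 2] would have rank three. *)
Lemma zero_pair : ~~ row_free N -> exists p q, eigen_pair 0 p q.
Proof.
move=> N0; have j0 : (0 < jcount N 0 0)%N.
  by rewrite eigen_rank raddf0 subr0.
have [j1|j1] := ltnP 1 (jcount N 0 0).
  have [p [q [_ _ Bpq lp lq]]] := two_heads j1; rewrite addr0 in lp lq.
  exists p, q; split; rewrite ?lp ?lq ?addr0 ?subr0 ?mulr2n //; exact: JB_neq.
have [|p [hp lp]] := @one_head 0 1.
  have := rank_sqr_even; have := jcount0_rank 1; have := jcount0_rank 0.
  rewrite expr0 mxrank1 expr1.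
  move: (\rank N) (\rank (N ^+ 2)) => r1 r2; lia.
have [p' [Bp' pp' lp']] := next_in_block hp; rewrite addr0 in lp; rewrite lp in lp'.
by exists p, p'; split; rewrite ?lp ?lp' ?addr0 ?subr0 ?mulr2n.
Qed.

(** There are as many blocks for [a] as for [- a].  Two for each give pairs in
    different blocks.  If there is one for each, of size at least two, these two
    blocks are common to both pairs.  If both have size one, the image of
    [(N - a) (N + a)] contains an eigenvector for a third eigenvalue [b], which is
    accompanied by [- b] if it is nonzero and else falls under [zero_pair]. *)
Lemma sp4_nonzero_pattern a : a != 0 -> (0 < jcount N a 0)%N ->
  jordan_pattern lam JB c.
Proof.
move=> a0 ja0; have aNa : a != - a.
  by rewrite -subr_eq0 opprK -mulr2n mulrn_eq0 negb_or a0.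
have opp k : jcount N (- a) k = jcount N a k by apply: jcount_opp.
have [ja0'|ja0'] := ltnP 1 (jcount N a 0).
  have [p [r [_ _ Bpr lp lr]]] := two_heads ja0'.
  have [|q [s [_ _ Bqs lq ls]]] := @two_heads (- a) 0; first by rewrite opp.
  apply: (@pattern_disjoint p q r s); rewrite ?lp ?lq ?lr ?ls; try ring; try done.
  - exact/JB_neq/(lam_neq lp lq).
  - exact/JB_neq/(lam_neq lr ls).
  - exact: lam_neq lp ls _.
  by apply/nesym; apply: lam_neq lr lq _.
have [ja1|ja1] := posnP (jcount N a 1); last first.
  have [p [hp lp]] := one_head ja1.
  have [|q [hq lq]] := @one_head (- a) 1; first by rewrite opp.
  have [p' [Bp pp' lp']] := next_in_block hp.
  have [q' [Bq qq' lq']] := next_in_block hq.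
  have Bpq := lam_neq lp lq aNa.
  have Sp : lam p + lam q = c *+ 2 by rewrite lp lq; ring.
  split=> //; exists p, q, p', q'; split; rewrite ?lp' ?lq' //.
    by rewrite /= !inE !negb_or pp' qq' !JB_neq ?Bp ?Bq //; apply: nesym.
  by constructor 2.
pose U := (N - a%:M) * (N + a%:M).
have Na : GRing.comm N a%:M := scalar_mxC a N.
have UC : U = (N + a%:M) * (N - a%:M).
  by apply: commrD; apply/commr_sym; apply: commrB => //; apply: commr_sym.
have UN : N * U = U * N.
  by apply: commrM; [apply: commrB|apply: commrD].
have rk (b : K) : jcount N b 0 = 1%N -> \rank (N - b%:M) = 3%N.
  have := jcountE N b 0; rewrite expr1 expr0 mxrank1 => + jb.
  by rewrite jb addn1 => -[].
have ja : jcount N a 0 = 1%N by apply/eqP; rewrite eqn_leq ja0' ja0.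
have U0 : U != 0.
  rewrite -mxrank_eq0 -lt0n; apply: leq_trans (mxrank_mul_min _ _).
  rewrite rk // -[N + _]/(N + a%:M) -[a]opprK raddfN /= rk ?opp //.
have [|b [v [vN v0 vU]]] := eigenvector_in U0.
  by rewrite -[X in (X <= _)%MS]/(U * N) -UN submxMl.
have jb0 := eigenvector_jcount vN v0.
have not_image (d : K) : jcount N d 1 = 0%N -> (v <= (N - d%:M))%MS -> d != b.
  move=> jd vd; apply: contraNneq v0 => db.
  rewrite -submx0; move/eqP: jd; rewrite mxrank_eq0 => /eqP <-.
  rewrite sub_capmx expr1 vd; apply/sub_kermxP.
  by rewrite mulmxBr vN mul_mx_scalar db subrr.
have ab : a != b.
  by apply: not_image => //; apply: submx_trans vU _; rewrite UC submxMl.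
have anb : - a != b.
  apply: not_image; first by rewrite opp.
  by apply: submx_trans vU _; rewrite raddfN /= opprK submxMl.
have pa := opposite_pair a0 ja0.
have [b0|b0] := eqVneq b 0; last first.
  by apply: (pattern_semisimple_pair _ _ pa (opposite_pair b0 jb0));
    rewrite // -eqr_oppLR.
apply: (pattern_semisimple_pair _ _ pa (zero_pair _)); rewrite ?oppr0 //.
by move: jb0; rewrite eigen_rank b0 raddf0 subr0.
Qed.

(** The nilpotent types in the symplectic algebra are one block of size four, two
    of size two, one of size two beside two of size one, and zero.  Size three is
    excluded by [rank_sqr_even].  In the last three cases there are pairs without
    common block. *)
Lemma sp4_nilpotent_pattern : (forall a, (0 < jcount N a 0)%N -> a = 0) ->
  jordan_pattern lam JB c.
Proof.
move=> nil; have drop := nilpotent_rank_drop nil.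
have blocks2 : (1 < jcount N 0 1)%N \/ (1 < jcount N 0 2)%N ->
    jordan_pattern lam JB c.
  move=> j2; have [p [r [hp hr Bpr lp lr]]] : exists p q : 'I_6,
    [/\ p \in block_head J JB (c + 0) 1, q \in block_head J JB (c + 0) 1,
      JB p <> JB q, lam p = c + 0 & lam q = c + 0].
    case: j2 => /two_heads[p [r [hp hr Bpr lp lr]]]; exists p, r; split=> //.
      exact: (subsetP (@block_head_sub _ 2 1 isT) _ hp).
    exact: (subsetP (@block_head_sub _ 2 1 isT) _ hr).
  have [p' [Bp pp' lp']] := next_in_block hp.
  have [r' [Br rr' lr']] := next_in_block hr.
  by apply: (@pattern_disjoint p p' r r'); rewrite ?Bp ?Br ?lp' ?lr' ?lp ?lr //;
    ring.
have [N3|N3] := eqVneq (N ^+ 3) 0; last first.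
  have [p [hp lp]] := one_head (drop 3%N N3).
  have [q [qE Bq]] := block_head_nth hp (isT : (1 <= 3)%N).
  have [r [rE Br]] := block_head_nth hp (isT : (2 <= 3)%N).
  have [s [sE Bs]] := block_head_nth hp (isT : (3 <= 3)%N).
  split=> //; exists p, q, r, s; split.
  - by rewrite /= !inE -!val_eqE /= qE rE sE; lia.
  - by rewrite [lam q](JBJ Bq) -/(lam p) lp; ring.
  - by rewrite [lam r](JBJ Br) [lam s](JBJ Bs) -/(lam p) lp; ring.
  by constructor 3; rewrite Bq Br Bs.
have := jcount0_rank 2; rewrite N3 mxrank0 add0n => j2.
have [?|rN2] := ltnP 1 (\rank (N ^+ 2)); first by apply: blocks2; right; rewrite j2.
have N20 : \rank (N ^+ 2) = 0%N.
  by have := rank_sqr_even; move: (\rank _) rN2 => r; lia.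
have := jcount0_rank 1; rewrite N20 add0n expr1 => j1.
have [?|rN] := ltnP 1 (\rank N); first by apply: blocks2; left; rewrite j1.
have := jcount0_rank 0; rewrite expr1 expr0 mxrank1 => j0.
have four : (3 < #|block_head J JB c 0|)%N \/
  (2 < #|block_head J JB c 0|)%N /\ (0 < #|block_head J JB c 1|)%N.
  have := heads 0 0; have := heads 0 1; rewrite addr0 j1.
  move: (\rank N) rN j0 => r; lia.
have dist p q : p \in block_head J JB c 0 -> q \in block_head J JB c 0 ->
    p != q -> JB p <> JB q.
  by move=> hp hq /eqP pq /(block_head_inj hp hq).
have lamc p : p \in block_head J JB c 0 -> lam p = c by apply: block_head_lam.
have lam2 p q : p \in block_head J JB c 0 -> q \in block_head J JB c 0 ->
    lam p + lam q = c *+ 2 by move=> /lamc-> /lamc->; ring.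
case: four => [H4|[H3 /card_gt0P[p hp1]]].
  have /card_gt0P[p hp] : (0 < #|block_head J JB c 0|)%N by apply: leq_trans H4.
  have [q [r [s [[+ + +] [qr rs sq]]]]] :
      exists q r s, [/\ q \in block_head J JB c 0 :\ p,
        r \in block_head J JB c 0 :\ p & s \in block_head J JB c 0 :\ p]
        /\ [/\ q != r, r != s & s != q].
    by apply/card_gt2P; move: H4; rewrite (cardsD1 p) hp.
  rewrite !in_setD1 ![_ == p]eq_sym => /andP[pq hq] /andP[pr hr] /andP[ps hs].
  apply: (@pattern_disjoint p q r s); rewrite ?lam2 //; apply: dist;
    by rewrite // eq_sym.
have hp := subsetP (@block_head_sub c 1 0 isT) _ hp1.
have [p' [Bp pp' lp']] := next_in_block hp1.
have [r [s [hr hs rs [pr ps]]]] : exists r s,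
    [/\ r \in block_head J JB c 0, s \in block_head J JB c 0, r != s &
     p != r /\ p != s].
  have /card_gt1P[r [s [+ + rs]]] : (1 < #|block_head J JB c 0 :\ p|)%N.
    by move: H3; rewrite (cardsD1 p) hp.
  rewrite !in_setD1 ![_ == p]eq_sym => /andP[pr hr] /andP[ps hs].
  by exists r, s; split.
apply: (@pattern_disjoint p p' r s); rewrite ?lp' ?Bp ?lam2 //; exact: dist.
Qed.

Lemma sp4_pattern : jordan_pattern lam JB c.
Proof.
have [[a [a0 ja]]|nex] := boolp.EM (exists a, a != 0 /\ (0 < jcount N a 0)%N).
  exact: sp4_nonzero_pattern a0 ja.
apply: sp4_nilpotent_pattern => a ja; apply/eqP; apply: contra_notT nex => a0.
by exists a.
Qed.

End Classification.
End SubspaceToPattern.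

Section Bridge.
Variables (K : numClosedFieldType) (J : 'M[K]_6) (JB : 'I_6 -> nat).
Hypothesis JBJ : forall i j, JB i = JB j -> J i i = J j j.
Hypothesis JE : forall i j : 'I_6,
  J i j = J i i *+ (i == j) + ((i.+1 == j) && (JB i == JB j))%:R.
Hypothesis JBle : forall i j : 'I_6, (i <= j)%N -> (JB i <= JB j)%N.

Lemma jcount_shift n (M : 'M[K]_n) a b k :
  jcount (M - b%:M) a k = jcount M (b + a) k.
Proof. by rewrite /jcount raddfD /= opprD addrA. Qed.

Lemma sp_sub_pattern (W : 'M[K]_4) : W^T = - W -> W \in unitmx ->
  sp_sub J^T W -> exists c, jordan_pattern (fun i => J i i) JB c.
Proof.
move=> skW uW [Y [M [Yf YJ MW]]]; pose c := \tr J / 2.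
have c2 : \tr J = c *+ 2 by rewrite /c; field.
exists c; apply: (sp4_pattern JBJ JBle (c := c) (N := M - c%:M) skW uW) => //.
  rewrite mulmxBl linearB /= tr_scalar_mx mulmxBr addrACA MW mxtrace_tr c2.
  by rewrite mul_scalar_mx mul_mx_scalar -opprD -scalerDl -mulr2n subrr.
move=> a k; rewrite jcount_shift.
by apply: leq_trans (jcount_sub _ _ Yf YJ) (jcount_le_heads JBJ JE JBle _ _).
Qed.

(** The trace of the last equation forces [\tr J = 0], so [M] is symplectic and
    reduction along an eigenvector leads to dimension four. *)
Lemma sp6_pattern (Y M W : 'M[K]_6) : W^T = - W -> W \in unitmx ->
  Y \in unitmx -> Y *m J^T = M *m Y -> M *m W + W *m M^T = \tr J *: W ->
  exists c, jordan_pattern (fun i => J i i) JB c.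
Proof.
move=> skW uW uY YJ MW.
have trM : \tr M = \tr J.
  by rewrite -(mulmxK uY M) -YJ mxtrace_mulC mulKmx // mxtrace_tr.
have trJ : \tr J = 0.
  have /eqP := sp_trace uW MW; rewrite trM eq_sym -subr_eq0 -mulrnBr //.
  by rewrite mulrn_eq0 => /eqP.
rewrite trJ scale0r in MW.
have [N [V [skV uV NV jN]]] := sp_reduction skW uW MW.
exists 0; apply: (sp4_pattern JBJ JBle (c := 0) (N := N) skV uV) => //.
  by rewrite mul0rn.
move=> a k; rewrite add0r; apply: leq_trans (jN a k) _.
apply: leq_trans (jcount_le_heads JBJ JE JBle _ _).
by apply: jcount_sub YJ; rewrite row_free_unit.
Qed.

End Bridge.

(** * Alternating forms and determinants *)

Section MultilinearForms.
Variables (K : numFieldType) (W : vectType K).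

Lemma scalar_sum (f : W -> K) (I : finType) (c : I -> K) (e : I -> W) :
  scalar f -> f (\sum_j c j *: e j) = \sum_j c j * f (e j).
Proof.
move=> fl; have f0 : f 0 = 0.
  have := fl (-1) 0 0; rewrite addr0 scaler0 mulN1r addNr.
  by [].
elim/big_rec2: _ => [|i y1 y2 _ <-]; first exact: f0.
exact: fl.
Qed.

Definition vcons k (x : W) (v : 'I_k -> W) : 'I_k.+1 -> W :=
  fun i => if unlift ord0 i is Some j then v j else x.

Lemma vcons_eta k (v : 'I_k.+1 -> W) :
  v = vcons (v ord0) (fun i => v (lift ord0 i)).
Proof.
by apply: boolp.funext => i; rewrite /vcons; case: unliftP => [j ->|->].
Qed.

Lemma dfwith_vcons0 k (x y : W) (v : 'I_k -> W) :
  @dfwith _ (fun=> W) (vcons x v) ord0 y = vcons y v.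
Proof.
apply: boolp.funext => i; rewrite /vcons; have [->|ni] := eqVneq i ord0.
  by rewrite dfwith_in unlift_none.
rewrite dfwith_out 1?eq_sym //.
by case: unliftP ni => [j ->|->]; rewrite ?eqxx.
Qed.

Lemma dfwith_vcons_lift k (x y : W) (v : 'I_k -> W) i :
  @dfwith _ (fun=> W) (vcons x v) (lift ord0 i) y =
  vcons x (@dfwith _ (fun=> W) v i y).
Proof.
apply: boolp.funext => l; rewrite /vcons; case: unliftP => [j ->|->].
  have [->|ij] := eqVneq i j; first by rewrite !dfwith_in.
  by rewrite !dfwith_out ?(inj_eq lift_inj) // liftK.
by rewrite dfwith_out ?unlift_none // eq_sym neq_lift.
Qed.

Lemma contract_multilinear k (a : kform W k.+1) x :
  multilinear a -> multilinear (contract x a).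
Proof.
move=> am v i b y z; have E w : contract x a w = a (vcons x w) by [].
rewrite !E -!dfwith_vcons_lift; exact: am.
Qed.

Lemma multilinear_sum k n (a : kform W k) (c : 'I_k -> 'I_n -> K) (e : 'I_n -> W) :
  multilinear a ->
  a (fun i => \sum_j c i j *: e j) =
    \sum_(t : {ffun 'I_k -> 'I_n}) (\prod_i c i (t i)) * a (fun i => e (t i)).
Proof.
elim: k a c => [|k IHk] a c am.
  have t0 (t : {ffun 'I_0 -> 'I_n}) : t = ffun0 (card_ord 0).
    by apply/ffunP; case.
  rewrite (bigD1 (ffun0 (card_ord 0))) //= big_ord0 mul1r big1 ?addr0.
    by congr a; apply: boolp.funext; case.
  by move=> t; rewrite (t0 t) eqxx.
rewrite (vcons_eta (fun i => _)) -(dfwith_vcons0 0).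
rewrite (scalar_sum _ _ (am _ _)).
under eq_bigr => j _ do rewrite dfwith_vcons0 -[a _]/(contract (e j) a _)
  (IHk _ (fun i => c (lift ord0 i)) (contract_multilinear _ am)) mulr_sumr.
pose h (p : 'I_n * {ffun 'I_k -> 'I_n}) : {ffun 'I_k.+1 -> 'I_n} :=
  [ffun i => if unlift ord0 i is Some j then p.2 j else p.1].
rewrite pair_big (reindex h) /=.
  apply: eq_bigr => -[j t] _ /=; rewrite big_ord_recl !ffunE unlift_none mulrA.
  congr (_ * _ * a _).
    by apply: eq_bigr => i _; rewrite ffunE liftK.
  apply: boolp.funext => i; rewrite ffunE /contract.
  by case: unliftP.
exists (fun t : {ffun 'I_k.+1 -> 'I_n} => (t ord0, [ffun i => t (lift ord0 i)])).
  move=> [j t] _; rewrite /h ffunE unlift_none; congr pair.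
  by apply/ffunP => i; rewrite !ffunE liftK.
move=> t _; apply/ffunP => i; rewrite ffunE /=.
by case: unliftP => [j ->|->]; rewrite ?ffunE.
Qed.

Lemma alternating_tperm k (a : kform W k) v (i j : 'I_k) :
  alternating a -> i != j -> a (fun l => v (tperm i j l)) = - a v.
Proof.
move=> [am aa] ij.
pose F x y := a (@dfwith _ (fun=> W) (@dfwith _ (fun=> W) v i x) j y).
have dfC x y : @dfwith _ (fun=> W) (@dfwith _ (fun=> W) v i x) j y =
    @dfwith _ (fun=> W) (@dfwith _ (fun=> W) v j y) i x.
  apply: boolp.funext => l; have [<-|jl] := eqVneq j l.
    by rewrite dfwith_in dfwith_out // dfwith_in.
  have [<-|il] := eqVneq i l; first by rewrite dfwith_in dfwith_out 1?eq_sym // dfwith_in.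
  by rewrite !dfwith_out.
have Fl x y z : F (x + y) z = F x z + F y z.
  by rewrite /F !dfC -[x]scale1r (am _ i 1) mul1r scale1r.
have Fr x y z : F z (x + y) = F z x + F z y.
  by rewrite /F -[x]scale1r (am _ j 1) mul1r scale1r.
have F0 x : F x x = 0.
  by rewrite /F (aa _ i j) // dfwith_in dfC dfwith_in.
have := F0 (v i + v j); rewrite Fl !Fr !F0 add0r addr0 => /eqP.
rewrite addrC addr_eq0 => /eqP E.
have -> : a v = F (v i) (v j).
  congr a; apply: boolp.funext => l; have [<-|jl] := eqVneq j l.
    by rewrite dfwith_in.
  rewrite dfwith_out //; have [<-|il] := eqVneq i l; first by rewrite dfwith_in.
  by rewrite dfwith_out.
rewrite -E; congr a; apply: boolp.funext => l; have [<-|jl] := eqVneq j l.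
  by rewrite dfwith_in tpermR.
rewrite dfwith_out //; have [<-|il] := eqVneq i l.
  by rewrite dfwith_in tpermL.
by rewrite dfwith_out // tpermD.
Qed.

Lemma alternating_perm k (a : kform W k) v (s : 'S_k) :
  alternating a -> a (fun l => v (s l)) = (-1) ^+ s * a v.
Proof.
move=> aalt; have [ts -> dts] := prod_tpermP s.
elim: ts v dts => [|[i j] ts IHts] v /=.
  move=> _; rewrite big_nil odd_perm1 mul1r.
  by congr a; apply: boolp.funext => l; rewrite perm1.
case/andP=> ij dts; rewrite big_cons odd_mul_tperm ij signr_addb /= expr1.
rewrite mulN1r mulNr -IHts // -(alternating_tperm _ aalt ij).
by congr a; apply: boolp.funext => l; rewrite permM.
Qed.

(** The wedge product of the covectors [al i], see [wedge_detform]. *)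
Definition detform k (al : 'I_k -> W -> K) : kform W k :=
  fun v => \det (\matrix_(i, j) al j (v i)).

Lemma detform_alternating k (al : 'I_k -> W -> K) :
  (forall i, scalar (al i)) -> alternating (detform al).
Proof.
move=> lin; split=> [v i b x y|v i j ij vij].
  have E z : row' i (\matrix_(l, j) al j (@dfwith _ (fun=> W) v i z l)) =
      row' i (\matrix_(l, j) al j (@dfwith _ (fun=> W) v i (b *: x + y) l)).
    by apply/matrixP=> l j; rewrite !mxE !dfwith_out // neq_lift.
  rewrite -[X in _ = _ + X]mul1r.
  rewrite /detform; apply: (@determinant_multilinear _ _ _ _ _ i) => //.
  by apply/rowP => j; rewrite !mxE !dfwith_in lin mul1r.
apply: (@determinant_alternate _ _ _ i j) => // l.
by rewrite !mxE vij.
Qed.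

Lemma detformE k (al : 'I_k -> W -> K) v :
  detform al v = \sum_(s : 'S_k) (-1) ^+ s * \prod_i al i (v (s i)).
Proof.
rewrite /detform -det_tr; apply: eq_bigr => s _; congr (_ * _).
by apply: eq_bigr => i _; rewrite !mxE.
Qed.

Definition join_perm_fun p q (s : 'S_p) (t : 'S_q) (i : 'I_(p + q)) : 'I_(p + q) :=
  match split i with inl j => lshift q (s j) | inr j => rshift p (t j) end.

Lemma join_perm_inj p q (s : 'S_p) (t : 'S_q) : injective (join_perm_fun s t).
Proof.
move=> i j; rewrite /join_perm_fun.
case: split_ordP => i' ->; case: split_ordP => j' -> /eqP;
  rewrite ?eq_lrshift ?eq_rlshift // ?eq_lshift ?eq_rshift => /eqP /perm_inj-> //.
Qed.

Definition join_perm p q (s : 'S_p) (t : 'S_q) : 'S_(p + q) :=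
  perm (@join_perm_inj p q s t).

Lemma join_permL p q (s : 'S_p) (t : 'S_q) i :
  join_perm s t (lshift q i) = lshift q (s i).
Proof. by rewrite permE /join_perm_fun -[lshift q i]/(unsplit (inl i)) unsplitK. Qed.

Lemma join_permR p q (s : 'S_p) (t : 'S_q) i :
  join_perm s t (rshift p i) = rshift p (t i).
Proof. by rewrite permE /join_perm_fun -[rshift p i]/(unsplit (inr i)) unsplitK. Qed.

Lemma sign_join_perm p q (s : 'S_p) (t : 'S_q) :
  (-1) ^+ join_perm s t = (-1) ^+ s * (-1) ^+ t :> K.
Proof.
rewrite -[LHS]det_perm -(det_perm K s) -(det_perm K t) -(det_ublock _ 0).
congr (\det _); apply/matrixP=> i j.
rewrite /perm_mx !mxE /=.
case: (split_ordP i) => i' ->; rewrite ?join_permL ?join_permR mxE;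
  case: (split_ordP j) => j' ->;
  rewrite mxE ?mxE ?eq_lrshift ?eq_rlshift ?eq_lshift ?eq_rshift //.
Qed.

(** Summing over a permutation of the arguments absorbs the permutations of the
    two determinants, each value being hit [p! q!] times. *)
Lemma wedge_detform p q (al : 'I_p -> W -> K) (be : 'I_q -> W -> K) :
  wedge (detform al) (detform be) =
  detform (fun i => match split i with inl j => al j | inr j => be j end).
Proof.
apply: boolp.funext => v; rewrite /wedge.
set ga := (X in _ = detform X v).
transitivity ((p`! * q`!)%:R^-1 *
    \sum_(s1 : 'S_p) \sum_(s2 : 'S_q) detform ga v); last first.
  rewrite !sumr_const !card_Sn -mulrnA -[detform ga v *+ _]mulr_natl mulrA mulnC.
  by rewrite mulVf ?mul1r // pnatr_eq0 muln_eq0 negb_or -!lt0n !fact_gt0.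
congr (_ * _).
under eq_bigr => s _.
  rewrite !detformE [X in X * _]mulr_sumr mulr_suml.
  under eq_bigr => s1 _ do rewrite mulr_sumr.
  over.
rewrite exchange_big; apply: eq_bigr => s1 _ /=.
rewrite exchange_big; apply: eq_bigr => s2 _ /=.
rewrite detformE [RHS](reindex_inj (mulgI (join_perm s1 s2))) /=.
apply: eq_bigr => s _; rewrite odd_permM signr_addb sign_join_perm big_split_ord /=.
have gaL i : ga (lshift q i) = al i by rewrite /ga -[lshift q i]/(unsplit (inl i)) unsplitK.
have gaR i : ga (rshift p i) = be i by rewrite /ga -[rshift p i]/(unsplit (inr i)) unsplitK.
under [X in _ = _ * (X * _)]eq_bigr do rewrite gaL permM join_permL.
under [X in _ = _ * (_ * X)]eq_bigr do rewrite gaR permM join_permR.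
move: (\prod_i _) (\prod_i _) ((-1) ^+ s) ((-1) ^+ s1) ((-1) ^+ s2) => A B x y z; ring.
Qed.

End MultilinearForms.

(** * Forms with integral coefficients in a basis *)

(** The determinant of the matrix of Kronecker symbols between [t] and [s],
    expanded along its first column. *)
Fixpoint sgn_seq (s t : seq nat) : int :=
  if s is a :: s' then
    if a \in t then
      if odd (index a t) then - sgn_seq s' (rem a t) else sgn_seq s' (rem a t)
    else 0
  else 1.

Lemma nth_rem (t : seq nat) a i : a \in t ->
  nth 0%N (rem a t) i = nth 0%N t (bump (index a t) i).
Proof.
move=> at_; rewrite remE nth_cat size_takel ?index_size // /bump.
case: (ltnP i (index a t)) => [lt|le]; first by rewrite nth_take.
by rewrite nth_drop add1n addSn subnKC.
Qed.

Lemma det_delta_seq (K : comPzRingType) k (s t : seq nat) :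
  size s = k -> size t = k -> uniq t ->
  \det (\matrix_(i < k, j < k) ((nth 0%N s j == nth 0%N t i)%:R : K)) =
    (sgn_seq s t)%:~R.
Proof.
elim: k s t => [|k IHk] [|a s] t //= sz_s sz_t t_uniq; first by rewrite det_mx00.
rewrite (expand_det_col _ ord0).
have [at_|nat_] := boolP (a \in t); last first.
  rewrite big1 // => i _; rewrite !mxE /=.
  case: eqP => [E|]; last by rewrite mul0r.
  by rewrite E mem_nth ?sz_t in nat_.
have ltk : (index a t < k.+1)%N by rewrite -sz_t index_mem.
rewrite (bigD1 (Ordinal ltk)) //= big1 ?addr0 => [|i]; last first.
  move=> ni; rewrite !mxE /=; case: eqP => [E|]; last by rewrite mul0r.
  by case/eqP: ni; apply: val_inj; rewrite /= E index_uniq // sz_t.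
rewrite !mxE /= nth_index // eqxx mul1r /cofactor addn0.
rewrite [X in \det X](_ : _ =
    \matrix_(i < k, j < k) ((nth 0%N s j == nth 0%N (rem a t) i)%:R : K)).
  rewrite IHk ?size_rem ?sz_t ?rem_uniq //; last by case: sz_s.
  rewrite -signr_odd; case: odd; rewrite ?expr0 ?mul1r ?expr1 ?mulN1r //.
  by rewrite rmorphN.
by apply/matrixP=> i j; rewrite !mxE nth_rem.
Qed.

Definition seq_sign (s t : seq nat) : int := if uniq t then sgn_seq s t else 0.

Definition index7 (a : nat) := (0 < a <= 7)%N.

Fixpoint lists7 k : seq (seq nat) :=
  if k is k'.+1 then [seq a :: l | a <- iota 1 7, l <- lists7 k'] else [:: [::]].

Lemma lists7P k l : size l = k -> all index7 l -> l \in lists7 k.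
Proof.
elim: k l => [|k IHk] [|a l] // [szl] al; have /andP[a7 l7] : index7 a && all index7 l := al.
by apply/allpairsPdep; exists a, l; rewrite mem_iota; split=> //; apply: IHk.
Qed.

(** Integral combinations of the monomials [E^(i_1 .. i_k)].  As lists of
    coefficients and indices they make the finitely many coefficient identities
    behind the metric, the Hodge dual and the closedness equation computable. *)
Definition zform := seq (int * seq nat).

Definition zsum (s : seq int) : int := foldr +%R 0 s.

Lemma zsumE (R : pzRingType) (T : Type) (s : seq T) (F : T -> int) :
  \sum_(x <- s) (F x)%:~R = (zsum (map F s))%:~R :> R.
Proof.
by elim: s => [|x s IHs]; rewrite ?big_nil //= big_cons IHs rmorphD.
Qed.

Definition zwf k (L : zform) := all (fun m => (size m.2 == k) && all index7 m.2) L.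

Definition zmul (L L' : zform) : zform :=
  [seq (m.1 * m'.1, m.2 ++ m'.2) | m <- L, m' <- L'].

(** Contraction with the basis vector [E_a]. *)
Definition zcontract (a : nat) (L : zform) : zform :=
  [seq (if odd (index a m.2) then - m.1 else m.1, rem a m.2) |
    m <- L & a \in m.2].

(** The value on the basis vectors with indices [t]. *)
Definition zeval (L : zform) (t : seq nat) : int :=
  zsum [seq m.1 * seq_sign m.2 t | m <- L].

Section AdaptedBasis.
Variables (K : numFieldType) (W : vectType K) (E : 7.-tuple W).
Hypothesis E_basis : basis_of {:W} E.

Let Efree : free E := basis_free E_basis.

Lemma coordE (x : W) : x = \sum_(j < 7) coord E j x *: E`_j.
Proof. exact: (coord_basis E_basis (memvf x)). Qed.

Definition dcov (a : nat) (x : W) : K := coord E (inord a.-1) x.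

Lemma dcov_scalar a : scalar (dcov a).
Proof. by move=> c x y; rewrite /dcov linearP. Qed.

Definition monomial k (s : seq nat) : kform W k :=
  detform (fun i : 'I_k => dcov (nth 0%N s i)).

Lemma monomial_alternating k s : alternating (@monomial k s).
Proof. by apply: detform_alternating => i; apply: dcov_scalar. Qed.

Lemma wedge_monomial p q s t : size s = p ->
  wedge (@monomial p s) (@monomial q t) = @monomial (p + q) (s ++ t).
Proof.
move=> szs; rewrite /monomial wedge_detform; congr detform.
apply: boolp.funext => i; rewrite nth_cat szs.
case: split_ordP => j -> /=; first by [].
by rewrite addKn.
Qed.

Lemma dual_wedgeE s : @dual_wedge K W E s = monomial (k := size s) s.
Proof.
elim: s => [|a s IHs] /=.
  by apply: boolp.funext => v; rewrite /monomial /detform det_mx00.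
rewrite IHs (_ : dual_covector E a = @monomial 1 [:: a]).
  by rewrite wedge_monomial.
by apply: boolp.funext => v; rewrite /monomial /detform det_mx11 mxE.
Qed.

Lemma dcov_basis a (j : 'I_7) : index7 a -> dcov a E`_j = (a == j.+1)%:R.
Proof.
case: a => [|a] // a7; rewrite /dcov coord_free // eqSS -val_eqE /=.
by case/andP: a7 => _ a7; rewrite inordK // eq_sym.
Qed.

Definition ebasis k (t : seq nat) (i : 'I_k) : W := E`_(nth 0%N t i).-1.

Lemma monomial_basis k s t : size s = k -> size t = k ->
  all index7 s -> all index7 t -> @monomial k s (ebasis t) = (seq_sign s t)%:~R.
Proof.
move=> szs szt s7 t7; rewrite /seq_sign; case: ifP => t_uniq; last first.
  have [_] := monomial_alternating k s; move/negbT/(uniqPn 0%N): t_uniq.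
  case=> i [j [ij jt Eij]] /(_ (ebasis t)) alt; rewrite szt in jt.
  by apply: (alt (Ordinal (ltn_trans ij jt)) (Ordinal jt));
    rewrite -?val_eqE /= ?(ltn_eqF ij) // /ebasis /= Eij.
rewrite -(det_delta_seq K szs szt t_uniq) /monomial /detform; congr (\det _).
apply/matrixP=> i j; rewrite !mxE /ebasis.
have t7i : index7 (nth 0%N t i) by apply: (allP t7); rewrite mem_nth ?szt.
have s7j : index7 (nth 0%N s j) by apply: (allP s7); rewrite mem_nth ?szs.
case/andP: t7i => ti0 ti7; have lt7 : ((nth 0%N t i).-1 < 7)%N by rewrite prednK.
by rewrite (dcov_basis (Ordinal lt7) s7j) /= prednK.
Qed.

Lemma standard_volE v : standard_vol E v = @monomial 7 (iota 1 7) v.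
Proof. by rewrite /standard_vol dual_wedgeE. Qed.

(** The matrix of a monomial on [v] is the product of the coordinate matrix of [v]
    and a matrix of Kronecker symbols. *)
Lemma monomial_top s v : size s = 7%N -> all index7 s ->
  @monomial 7 s v = (seq_sign s (iota 1 7))%:~R * standard_vol E v.
Proof.
move=> szs s7; rewrite standard_volE /seq_sign iota_uniq.
rewrite -(det_delta_seq K szs (size_iota 1 7) (iota_uniq 1 7)).
rewrite mulrC -det_mulmx; congr (\det _); apply/matrixP=> i j; rewrite !mxE.
have s7j : index7 (nth 0%N s j) by apply: (allP s7); rewrite mem_nth ?szs.
rewrite {1}[v i]coordE [dcov _ _]linear_sum; apply: eq_bigr => l _.
rewrite !mxE nth_iota // add1n [LHS]linearZ -dcov_basis //.
by rewrite /dcov inord_val.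
Qed.

Definition form_of k (L : zform) : kform W k :=
  fun v => \sum_(m <- L) m.1%:~R * @monomial k m.2 v.

Lemma standard_vol_basis : standard_vol E (ebasis (k := 7) (iota 1 7)) = 1.
Proof. by rewrite standard_volE monomial_basis. Qed.

Lemma form_of_basis k L t : zwf k L -> size t = k -> all index7 t ->
  @form_of k L (ebasis t) = (zeval L t)%:~R.
Proof.
move=> /allP wf szt t7; rewrite /form_of /zeval -zsumE !big_seq.
apply: eq_bigr => m /wf /andP[/eqP szm m7].
by rewrite monomial_basis // rmorphM.
Qed.

Lemma form_of_top L v : zwf 7 L ->
  @form_of 7 L v = (zeval L (iota 1 7))%:~R * standard_vol E v.
Proof.
move=> /allP wf; rewrite /form_of /zeval -zsumE mulr_suml !big_seq.
apply: eq_bigr => m /wf /andP[/eqP szm m7].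
by rewrite monomial_top // rmorphM mulrA.
Qed.

End AdaptedBasis.

(** * The metric of the standard three-form *)

Definition phi7 : zform :=
  [:: (1, [:: 1; 2; 7]%N); (1, [:: 3; 4; 7]%N); (1, [:: 5; 6; 7]%N);
      (1, [:: 1; 3; 5]%N); (-1, [:: 1; 4; 6]%N); (-1, [:: 2; 3; 6]%N);
      (-1, [:: 2; 4; 5]%N)].

Definition psi7 : zform :=
  [:: (1, [:: 1; 2; 3; 4]%N); (1, [:: 1; 2; 5; 6]%N); (1, [:: 3; 4; 5; 6]%N);
      (-1, [:: 2; 4; 6; 7]%N); (1, [:: 2; 3; 5; 7]%N); (1, [:: 1; 4; 5; 7]%N);
      (1, [:: 1; 3; 6; 7]%N)].

Section WedgeLinear.
Variables (K : numFieldType) (W : vectType K).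

Lemma wedge_suml p q (I : Type) (r : seq I) (c : I -> K) (a : I -> kform W p)
    (b : kform W q) v :
  wedge (fun w => \sum_(i <- r) c i * a i w) b v =
    \sum_(i <- r) c i * wedge (a i) b v.
Proof.
rewrite /wedge; under eq_bigr => s _ do rewrite mulr_sumr mulr_suml.
rewrite exchange_big mulr_sumr; apply: eq_bigr => i _ /=.
rewrite [RHS]mulrCA; congr (_ * _); rewrite [RHS]mulr_sumr; apply: eq_bigr => s _.
by rewrite mulrCA !mulrA.
Qed.

Lemma wedge_sumr p q (I : Type) (r : seq I) (c : I -> K) (a : kform W p)
    (b : I -> kform W q) v :
  wedge a (fun w => \sum_(i <- r) c i * b i w) v =
    \sum_(i <- r) c i * wedge a (b i) v.
Proof.
rewrite /wedge; under eq_bigr => s _ do rewrite mulr_sumr.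
rewrite exchange_big mulr_sumr; apply: eq_bigr => i _ /=.
rewrite [RHS]mulrCA; congr (_ * _); rewrite [RHS]mulr_sumr; apply: eq_bigr => s _.
by rewrite mulrCA.
Qed.

End WedgeLinear.

Section G2Algebra.
Variables (K : numFieldType) (W : vectType K) (E : 7.-tuple W).
Hypothesis E_basis : basis_of {:W} E.

Lemma wedge_form_of p q L L' : zwf p L ->
  wedge (form_of E (k := p) L) (form_of E (k := q) L') =
  form_of E (k := p + q) (zmul L L').
Proof.
move=> /allP wf; apply: boolp.funext => v.
rewrite wedge_suml /form_of /zmul big_allpairs_dep /= big_seq [RHS]big_seq.
apply: eq_bigr => m /wf /andP[/eqP szm _].
rewrite wedge_sumr mulr_sumr; apply: eq_bigr => m' _.
by rewrite wedge_monomial // rmorphM mulrA.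
Qed.

Lemma contract_monomial k s x : size s = k.+1 -> all index7 s -> uniq s ->
  contract x (@monomial K W E k.+1 s) = fun w =>
    \sum_(a < 7) coord E a x * (if a.+1 \in s then
       (-1) ^+ index a.+1 s * @monomial K W E k (rem a.+1 s) w else 0).
Proof.
move=> szs s7 us; apply: boolp.funext => w.
rewrite /contract /monomial /detform (expand_det_row _ ord0).
have s7j (j : 'I_k.+1) : index7 (nth 0%N s j).
  by apply: (allP s7); rewrite mem_nth ?szs.
under eq_bigr => j _ do rewrite mxE unlift_none.
transitivity (\sum_(j < k.+1) \sum_(a < 7) coord E a x * (
    (nth 0%N s j == a.+1)%:R * (-1) ^+ j *
    @monomial K W E k (rem (nth 0%N s j) s) w)).
  apply: eq_bigr => j _; under [RHS]eq_bigr do rewrite !mulrA.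
  rewrite -!mulr_suml /cofactor add0n -mulrA; congr (_ * (_ * _)).
    rewrite {1}(coordE E_basis x) [LHS]linear_sum; apply: eq_bigr => a _.
    by rewrite [LHS]linearZ -(dcov_basis E_basis).
  congr (\det _); apply/matrixP=> i l; rewrite !mxE liftK nth_rem.
    by rewrite index_uniq ?szs.
  by rewrite mem_nth ?szs.
rewrite exchange_big; apply: eq_bigr => a _ /=; rewrite -mulr_sumr; congr (_ * _).
case: ifP => as_; last first.
  rewrite big1 // => j _; case: eqP => [E0|]; last by rewrite !mul0r.
  by rewrite -E0 mem_nth ?szs in as_.
have ltk : (index a.+1 s < k.+1)%N by rewrite -szs index_mem.
rewrite (bigD1 (Ordinal ltk)) //= nth_index // eqxx mul1r big1 ?addr0 // => j nj.
case: eqP => [E0|]; last by rewrite !mul0r.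
by case/eqP: nj; apply: val_inj; rewrite /= -E0 index_uniq ?szs.
Qed.

Lemma contract_form_of k L x : zwf k.+1 L -> all (fun m => uniq m.2) L ->
  contract x (form_of E (k := k.+1) L) = fun w =>
    \sum_(a < 7) coord E a x * form_of E (k := k) (zcontract a.+1 L) w.
Proof.
move=> /allP wf /allP uL; apply: boolp.funext => w.
rewrite [LHS](_ : _ = \sum_(m <- L) m.1%:~R * contract x (@monomial K W E k.+1 m.2) w) //.
rewrite big_seq; under eq_bigr => m mL.
  have /andP[/eqP szm m7] := wf m mL.
  rewrite contract_monomial ?uL // mulr_sumr.
  over.
rewrite -big_seq exchange_big; apply: eq_bigr => a _ /=.
rewrite /form_of /zcontract big_map big_filter mulr_sumr [RHS]big_mkcond.
apply: eq_bigr => m _ /=; case: ifP => _; last by rewrite !mulr0.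
rewrite mulrCA; congr (_ * _); rewrite -signr_odd.
by case: odd; rewrite ?expr0 ?mul1r // expr1 rmorphN !mulNr mul1r mulrN.
Qed.

Lemma standard_phiE : standard_phi E = form_of E (k := 3) phi7.
Proof.
apply: boolp.funext => v; rewrite /standard_phi !dual_wedgeE /form_of.
by rewrite unlock /= !mulN1r !mul1r addr0 !addrA.
Qed.

Definition euclid (x y : W) : K := \sum_(a < 7) coord E a x * coord E a y.

Lemma metric_table :
  all (fun a => all (fun b =>
      zeval (zmul (zmul (zcontract a phi7) (zcontract b phi7)) phi7) (iota 1 7)
      == 6 *+ (a == b)) (iota 1 7)) (iota 1 7).
Proof. by vm_compute. Qed.

Lemma zwf_table :
  all (fun a => zwf 2 (zcontract a phi7) && all (fun b =>
      zwf 4 (zmul (zcontract a phi7) (zcontract b phi7)) &&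
      zwf 7 (zmul (zmul (zcontract a phi7) (zcontract b phi7)) phi7))
    (iota 1 7)) (iota 1 7).
Proof. by vm_compute. Qed.

(** By bilinearity the identity is one of coefficients, which is [metric_table]. *)
Lemma standard_metric x y v :
  6^-1 * wedge (wedge (contract x (standard_phi E)) (contract y (standard_phi E)))
    (standard_phi E) v = euclid x y * standard_vol E v.
Proof.
have in7 (a : 'I_7) : a.+1 \in iota 1 7 by rewrite mem_iota /= ltnS ltn_ord.
rewrite standard_phiE !contract_form_of //.
have -> : wedge (fun w => \sum_(a < 7) coord E a x *
       form_of E (k := 2) (zcontract a.+1 phi7) w)
    (fun w => \sum_(a < 7) coord E a y *
       form_of E (k := 2) (zcontract a.+1 phi7) w) =
    fun w => \sum_(a < 7) coord E a x * \sum_(b < 7) coord E b y *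
       form_of E (k := 4) (zmul (zcontract a.+1 phi7) (zcontract b.+1 phi7)) w.
  apply: boolp.funext => w; rewrite wedge_suml; apply: eq_bigr => a _.
  rewrite wedge_sumr; congr (_ * _); apply: eq_bigr => b _.
  by rewrite wedge_form_of //; have /andP[] := allP zwf_table _ (in7 a).
rewrite wedge_suml mulr_sumr /euclid mulr_suml; apply: eq_bigr => a _.
rewrite wedge_suml mulrCA -mulrA; congr (_ * _).
have /andP[_ wfa] := allP zwf_table _ (in7 a).
have eval (b : 'I_7) : wedge (form_of E (k := 4)
    (zmul (zcontract a.+1 phi7) (zcontract b.+1 phi7)))
    (form_of E (k := 3) phi7) v = 6 *+ (a == b) * standard_vol E v.
  have /andP[wf4 wf7] := allP wfa _ (in7 b).
  rewrite wedge_form_of // form_of_top //.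
  by rewrite (eqP (allP (allP metric_table _ (in7 _)) _ (in7 _))) eqSS rmorphMn.
rewrite (bigD1 a) //= big1 ?addr0 => [|b nba].
  by rewrite eval eqxx mulr1n mulrCA mulKf // pnatr_eq0.
by rewrite eval eq_sym (negPf nba) mulr0n mul0r mulr0.
Qed.

End G2Algebra.

(** * The Hodge dual of the standard three-form *)

Section Hodge.
Variables (K : numFieldType) (W : vectType K) (E : 7.-tuple W).
Hypothesis E_basis : basis_of {:W} E.

(** Antisymmetrise the multilinear expansion of [a] and sum over the permutations
    first. *)
Lemma alternating_expansion k (a : kform W k) v : alternating a ->
  a v = k`!%:R^-1 * \sum_(t : {ffun 'I_k -> 'I_7})
    a (fun i => E`_(t i)) * detform (fun i => coord E (t i)) v.
Proof.
move=> aalt; have [am _] := aalt.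
apply: (mulfI (_ : k`!%:R != 0 :> K)).
  by rewrite pnatr_eq0 -lt0n fact_gt0.
rewrite mulrA mulfV ?mul1r; last by rewrite pnatr_eq0 -lt0n fact_gt0.
transitivity (\sum_(s : 'S_k) (-1) ^+ s * a (fun l => v (s l))).
  rewrite -[in LHS]card_Sn mulr_natl -sumr_const.
  apply: eq_bigr => s _.
  by rewrite alternating_perm // mulrA -signr_addb addbb mul1r.
under [RHS]eq_bigr do rewrite detformE mulr_sumr.
rewrite exchange_big; apply: eq_bigr => s _ /=.
rewrite (_ : (fun l => v (s l)) = fun l => \sum_j coord E j (v (s l)) *: E`_j).
  rewrite (multilinear_sum (fun l j => coord E j (v (s l)))) // mulr_sumr.
  by apply: eq_bigr => t _; rewrite mulrA mulrC.
by apply: boolp.funext => l; exact: coordE.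
Qed.

(** The Gram matrix of an arbitrary basis is [T *m T^T] for the matrix [T] of
    coordinates in the orthonormal basis [E], so the inverse Gram matrix is
    absorbed by the change of basis. *)
Lemma form_metric_euclid k (g : W -> W -> K) (a b : kform W k) :
  (forall x y, g x y = euclid E x y) -> multilinear a -> multilinear b ->
  form_metric g a b = k`!%:R^-1 * \sum_(t : {ffun 'I_k -> 'I_7})
    a (fun i => E`_(t i)) * b (fun i => E`_(t i)).
Proof.
move=> gE am bm; rewrite /form_metric; set e := vbasis {:W}.
congr (_ * _).
have eB x : x = \sum_j coord e j x *: e`_j.
  by apply: coord_vbasis; rewrite memvf.
pose T := \matrix_(i, m) coord E m e`_i : 'M[K]_(\dim {:W}, 7).
pose S := \matrix_(m, i) coord e i E`_m : 'M[K]_(7, \dim {:W}).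
have TS : T *m S = 1%:M.
  apply/matrixP=> i j; rewrite !mxE.
  transitivity (coord e j (\sum_m coord E m e`_i *: E`_m)).
    rewrite linear_sum; apply: eq_bigr => m _; rewrite !mxE.
    by rewrite [RHS]linearZ.
  by rewrite -coordE // coord_free 1?eq_sym ?(basis_free (vbasisP _)).
have ST : S *m T = 1%:M.
  apply/matrixP=> i j; rewrite !mxE.
  transitivity (coord E j (\sum_m coord e m E`_i *: e`_m)).
    rewrite linear_sum; apply: eq_bigr => m _; rewrite !mxE.
    by rewrite [RHS]linearZ.
  by rewrite -eB coord_free 1?eq_sym ?(basis_free E_basis).
set G := \matrix_(i, j) _.
have GT : G = T *m T^T.
  by apply/matrixP=> i j; rewrite !mxE gE; apply: eq_bigr => m _; rewrite !mxE.
have Ginv : invmx G = S^T *m S.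
  have GS : G *m (S^T *m S) = 1%:M.
    by rewrite GT -mulmxA (mulmxA T^T) -trmx_mul ST trmx1 mul1mx.
  have [uG _] := mulmx1_unit GS.
  by rewrite -[LHS]mulmx1 -GS mulKmx.
rewrite Ginv.
have expand (f : kform W k) (t : {ffun 'I_k -> 'I_7}) : multilinear f ->
    f (fun i => E`_(t i)) = \sum_(s : {ffun 'I_k -> 'I_(\dim {:W})})
      (\prod_i S (t i) (s i)) * f (fun i => e`_(s i)).
  move=> fm; transitivity (f (fun i => \sum_j S (t i) j *: e`_j)); last first.
    exact: (multilinear_sum (fun i j => S (t i) j)).
  congr f; apply: boolp.funext => i; rewrite [LHS]eB.
  by apply: eq_bigr => j _; rewrite mxE.
under [RHS]eq_bigr => t _.
  rewrite expand // expand // mulr_suml.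
  under eq_bigr do rewrite mulr_sumr.
  over.
rewrite [RHS]exchange_big; apply: eq_bigr => s _ /=.
rewrite [RHS]exchange_big; apply: eq_bigr => s' _ /=.
transitivity (\sum_(t : {ffun 'I_k -> 'I_7})
    (\prod_i (S (t i) (s i) * S (t i) (s' i))) *
      a (fun l => e`_(s l)) * b (fun l => e`_(s' l))).
  rewrite -!mulr_suml; congr (_ * _ * _).
  rewrite -(bigA_distr_bigA (fun i m => S m (s i) * S m (s' i))).
  apply: eq_bigr => i _; rewrite mxE; apply: eq_bigr => m _.
  by rewrite mxE.
apply: eq_bigr => t _; rewrite big_split /=.
by rewrite mulrACA !mulrA.
Qed.

Lemma detform_coord_swap k (s t : {ffun 'I_k -> 'I_7}) :
  detform (fun i => coord E (t i)) (fun i => E`_(s i)) =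
  detform (fun i => coord E (s i)) (fun i => E`_(t i)).
Proof.
rewrite /detform -det_tr; congr (\det _); apply/matrixP=> i j; rewrite !mxE.
by rewrite !coord_free ?(basis_free E_basis) // eq_sym.
Qed.

(** Pairing with a coordinate determinant form reads off a coefficient. *)
Lemma form_metric_detform k (g : W -> W -> K) (a : kform W k)
    (s : {ffun 'I_k -> 'I_7}) :
  (forall x y, g x y = euclid E x y) -> alternating a ->
  form_metric g a (detform (fun i => coord E (s i))) = a (fun i => E`_(s i)).
Proof.
move=> gE aalt; have [am _] := aalt.
have dalt : alternating (detform (fun i : 'I_k => coord E (s i))).
  by apply: detform_alternating => i c x y; rewrite linearP.
rewrite (form_metric_euclid gE am dalt.1) [RHS](alternating_expansion _ aalt).
by congr (_ * _); apply: eq_bigr => t _; rewrite detform_coord_swap.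
Qed.

End Hodge.

Lemma hodge_table :
  all (fun l => zeval (zmul phi7 [:: (1, l)]) (iota 1 7) == zeval psi7 l)
    (lists7 4).
Proof. by vm_compute. Qed.

Section Cocalibrated.
Variables (K : numFieldType) (W : vectType K).

Section Basis.
Variable E : 7.-tuple W.
Hypothesis E_basis : basis_of {:W} E.

Lemma multilinear_ext k (a b : kform W k) : multilinear a -> multilinear b ->
  (forall t : {ffun 'I_k -> 'I_7}, a (fun i => E`_(t i)) = b (fun i => E`_(t i))) ->
  a = b.
Proof.
move=> am bm ab; apply: boolp.funext => v.
rewrite (_ : v = fun i => \sum_j coord E j (v i) *: E`_j); last first.
  by apply: boolp.funext => i; exact: coordE.
rewrite !(multilinear_sum (fun i j => coord E j (v i))) //.
by apply: eq_bigr => t _; rewrite ab.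
Qed.

Definition index_seq k (s : {ffun 'I_k -> 'I_7}) : seq nat :=
  [seq (s i).+1 | i <- enum 'I_k].

Lemma size_index_seq k (s : {ffun 'I_k -> 'I_7}) : size (index_seq s) = k.
Proof. by rewrite size_map size_enum_ord. Qed.

Lemma index7_index_seq k (s : {ffun 'I_k -> 'I_7}) : all index7 (index_seq s).
Proof. by apply/allP => a /mapP[i _ ->]; rewrite /index7 /= ltn_ord. Qed.

Lemma nth_index_seq k (s : {ffun 'I_k -> 'I_7}) (i : 'I_k) :
  nth 0%N (index_seq s) i = (s i).+1.
Proof. by rewrite (nth_map i) ?size_enum_ord // nth_ord_enum. Qed.

Lemma ebasis_index_seq k (s : {ffun 'I_k -> 'I_7}) :
  (fun i => E`_(s i)) = ebasis E (index_seq s).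
Proof. by apply: boolp.funext => i; rewrite /ebasis nth_index_seq. Qed.

Lemma detform_index_seq k (s : {ffun 'I_k -> 'I_7}) :
  detform (fun i => coord E (s i)) = form_of E (k := k) [:: (1, index_seq s)].
Proof.
apply: boolp.funext => v; rewrite /form_of big_seq1 mul1r /monomial.
congr (detform _ v); apply: boolp.funext => i.
by rewrite /dcov nth_index_seq inord_val.
Qed.

Lemma form_of_alternating k L : alternating (@form_of K W E k L).
Proof.
have malt m := @monomial_alternating K W E k m.
split=> [v i c x y|v i j ij vij].
  rewrite /form_of mulr_sumr -big_split /=; apply: eq_bigr => m _.
  by rewrite (malt m.2).1 mulrDr mulrCA.
by rewrite /form_of big1 // => m _; rewrite ((malt m.2).2 v i j) ?mulr0.
Qed.

Lemma wedge_phi_detform (s : {ffun 'I_4 -> 'I_7}) v :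
  wedge (standard_phi E) (detform (fun i => coord E (s i))) v =
    form_of E (k := 4) psi7 (fun i => E`_(s i)) * standard_vol E v.
Proof.
have szl := size_index_seq s; have l7 := index7_index_seq s.
rewrite detform_index_seq standard_phiE // wedge_form_of // ebasis_index_seq.
rewrite form_of_top //; last by rewrite /zwf /= size_index_seq l7.
by rewrite form_of_basis // (eqP (allP hodge_table _ (lists7P szl l7))).
Qed.

Lemma standard_hodge (g : W -> W -> K) : (forall x y, g x y = euclid E x y) ->
  is_hodge_star (p := 3) (q := 4) g (standard_vol E) (standard_phi E)
    (form_of E (k := 4) psi7).
Proof.
move=> gE; have palt := form_of_alternating 4 psi7.
split=> // a aalt v.
have aE : a = fun w => \sum_(t : {ffun 'I_4 -> 'I_7})
    (4`!%:R^-1 * a (fun i => E`_(t i))) * detform (fun i => coord E (t i)) w.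
  apply: boolp.funext => w; rewrite (alternating_expansion E_basis _ aalt).
  by rewrite mulr_sumr; apply: eq_bigr => t _; rewrite mulrA.
rewrite {1}aE [LHS]wedge_sumr.
rewrite (form_metric_euclid E_basis gE palt.1 aalt.1) mulr_sumr mulr_suml.
apply: eq_bigr => t _; rewrite wedge_phi_detform mulrA.
by congr (_ * _); rewrite -mulrA; congr (_ * _); rewrite mulrC.
Qed.

(** Wedging with coordinate determinant forms reads off every coefficient of the
    Hodge dual. *)
Lemma standard_hodge_unique (g : W -> W -> K) (star : kform W 4) :
  (forall x y, g x y = euclid E x y) ->
  is_hodge_star (p := 3) (q := 4) g (standard_vol E) (standard_phi E) star ->
  star = form_of E (k := 4) psi7.
Proof.
move=> gE [salt hs]; have palt := form_of_alternating 4 psi7.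
apply: multilinear_ext salt.1 palt.1 _ => s.
have dalt : alternating (detform (fun i => coord E (s i))).
  by apply: detform_alternating => i c x y; rewrite linearP.
have := hs _ dalt (ebasis E (k := 7) (iota 1 7)).
rewrite wedge_phi_detform (form_metric_detform E_basis _ gE salt).
by rewrite standard_vol_basis // !mulr1.
Qed.

End Basis.

(** An adapted basis determines the metric and the Hodge dual, so only the
    closedness of the standard four-form remains of the definition. *)
Lemma cocalibratedP (br : lie_bracket W) :
  (exists phi vol, cocalibrated br phi vol) <->
  (exists2 E : 7.-tuple W, basis_of {:W} E &
     forall v, ext_diff br (form_of E (k := 4) psi7) v = 0).
Proof.
split=> [[phi [vol [[E [E_basis volE phiE]] [g [star [metric hodge closed]]]]]]|].
  exists E => // v; move/boolp.funext: phiE => phiE; move/boolp.funext: volE => volE.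
  subst phi vol.
  have gE x y : g x y = euclid E x y.
    have := metric x y (ebasis E (k := 7) (iota 1 7)).
    by rewrite standard_metric // standard_vol_basis // !mulr1.
  by rewrite -(standard_hodge_unique E_basis gE hodge).
case=> E E_basis closed; exists (standard_phi E), (standard_vol E); split.
  by exists E; split.
exists (euclid E), (form_of E (k := 4) psi7); split=> //.
  by move=> x y v; rewrite standard_metric.
exact: standard_hodge.
Qed.

End Cocalibrated.

(** * The exterior derivative for an Abelian ideal of codimension one *)

Section LieDerivative.
Variables (K : numFieldType) (W : vectType K).

Definition dfw k (v : 'I_k -> W) (i : 'I_k) (x : W) : 'I_k -> W :=
  @dfwith _ (fun=> W) v i x.

Lemma dfwC k (v : 'I_k -> W) i j x y : i != j ->
  dfw (dfw v i x) j y = dfw (dfw v j y) i x.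
Proof.
move=> ij; apply: boolp.funext => l; rewrite /dfw.
have [<-|jl] := eqVneq j l; first by rewrite dfwith_in dfwith_out // dfwith_in.
have [<-|il] := eqVneq i l; first by rewrite dfwith_in dfwith_out 1?eq_sym // dfwith_in.
by rewrite !dfwith_out.
Qed.

Lemma dfw_in k (v : 'I_k -> W) i x : dfw v i x i = x.
Proof. exact: dfwith_in. Qed.

Lemma dfw_out k (v : 'I_k -> W) i j x : i != j -> dfw v i x j = v j.
Proof. exact: dfwith_out. Qed.

Lemma dfw_dfw k (v : 'I_k -> W) i x y : dfw (dfw v i x) i y = dfw v i y.
Proof.
apply: boolp.funext => l; have [<-|il] := eqVneq i l; first by rewrite !dfw_in.
by rewrite !dfw_out.
Qed.

(** The action of the endomorphism [D] on forms as a derivation, without the usual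
    sign. *)
Definition lie_form (D : W -> W) k (a : kform W k) : kform W k :=
  fun v => \sum_l a (dfw v l (D (v l))).

Lemma lie_form_alternating (D : W -> W) k (a : kform W k) :
  linear D -> alternating a -> alternating (lie_form D a).
Proof.
move=> Dlin aalt; have [am aa] := aalt; split=> [v i c x y|v i j ij vij].
  rewrite -!/(dfw _ _ _) /lie_form mulr_sumr -big_split /=.
  apply: eq_bigr => l _; have [<-|il] := eqVneq i l.
    by rewrite !dfw_in !dfw_dfw Dlin; apply: am.
  rewrite !dfw_out // ![dfw (dfw v i _) l _]dfwC //; exact: am.
rewrite /lie_form (bigD1 i) // (bigD1 j) 1?eq_sym //= big1 ?addr0; last first.
  move=> l /andP[li lj]; apply: (aa _ i j ij).
  by rewrite !dfw_out.
have -> : dfw v j (D (v j)) = fun l => dfw v i (D (v i)) (tperm i j l).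
  apply: boolp.funext => l; case: tpermP => [->|->|/eqP li /eqP lj].
  - by rewrite !dfw_out // eq_sym.
  - by rewrite !dfw_in vij.
  by rewrite !dfw_out // eq_sym.
by rewrite alternating_tperm // subrr.
Qed.

Section ExtDiff.
Variables (br : lie_bracket W) (tau : W -> K) (D : W -> W).
Hypothesis br_tau : forall x y, br x y = tau x *: D y - tau y *: D x.
Hypothesis tauD : forall x, tau (D x) = 0.

(** The wedge product of [tau] with [a]. *)
Definition wedge_tau k (a : kform W k) : kform W k.+1 :=
  fun v => \sum_(i < k.+1) (-1) ^+ i * (tau (v i) * a (fun l => v (lift i l))).

Section FourForm.
Variable a : kform W 4.
Hypothesis aalt : alternating a.

Let a4 x y z w := a (fun i : 'I_4 => nth 0 [:: x; y; z; w] i).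

Lemma four_formE f : a f = a4 (f (@Ordinal 4 0 isT)) (f (@Ordinal 4 1 isT))
  (f (@Ordinal 4 2 isT)) (f (@Ordinal 4 3 isT)).
Proof.
congr a; apply: boolp.funext => -[[|[|[|[|i]]]] lt4] //=;
  by congr f; apply: val_inj.
Qed.

Lemma four_form_vcons x f : a (vcons x f) = a4 x (f (@Ordinal 3 0 isT))
  (f (@Ordinal 3 1 isT)) (f (@Ordinal 3 2 isT)).
Proof.
congr a; apply: boolp.funext => i; rewrite /vcons.
case: unliftP => [[[|[|[|j]]] lt3] ->|->] //=; by congr f; apply: val_inj.
Qed.

Lemma four_form_swap (i j : 'I_4) f : i != j ->
  a (fun l => f (tperm i j l)) = - a f.
Proof. exact: alternating_tperm. Qed.

Lemma a4_12 x y z w : a4 y x z w = - a4 x y z w.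
Proof.
rewrite -(@four_form_swap (@Ordinal 4 0 isT) (@Ordinal 4 1 isT)) // /a4.
congr a; apply: boolp.funext => l; case: tpermP => [->|->|] //.
by case: l => [] [|[|[|[|l]]]] //= lt4 n1 n2; [case: n1|case: n2]; apply: val_inj.
Qed.

Lemma a4_23 x y z w : a4 x z y w = - a4 x y z w.
Proof.
rewrite -(@four_form_swap (@Ordinal 4 1 isT) (@Ordinal 4 2 isT)) // /a4.
congr a; apply: boolp.funext => l; case: tpermP => [->|->|] //.
by case: l => [] [|[|[|[|l]]]] //= lt4 n1 n2; [case: n1|case: n2]; apply: val_inj.
Qed.

Lemma a4_34 x y z w : a4 x y w z = - a4 x y z w.
Proof.
rewrite -(@four_form_swap (@Ordinal 4 2 isT) (@Ordinal 4 3 isT)) // /a4.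
congr a; apply: boolp.funext => l; case: tpermP => [->|->|] //.
by case: l => [] [|[|[|[|l]]]] //= lt4 n1 n2; [case: n1|case: n2]; apply: val_inj.
Qed.

Lemma a4_linear c x x' y z w : a4 (c *: x + x') y z w = c * a4 x y z w + a4 x' y z w.
Proof.
have E t : a4 t y z w = a (dfw (fun i : 'I_4 => nth 0 [:: 0; y; z; w] i)
    (@Ordinal 4 0 isT) t).
  congr a; apply: boolp.funext => -[[|[|[|[|i]]]] lt4] //=.
  - by rewrite (_ : Ordinal lt4 = Ordinal (isT : (0 < 4)%N)) ?dfw_in //; apply: val_inj.
  - by rewrite dfw_out.
  - by rewrite dfw_out.
  by rewrite dfw_out.
by rewrite !E; apply: aalt.1.
Qed.

Lemma a4_br x y z w t :
  a4 (br x y) z w t = tau x * a4 (D y) z w t - tau y * a4 (D x) z w t.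
Proof.
have a40 : a4 0 z w t = 0.
  by have := a4_linear (-1) 0 0 z w t; rewrite scaler0 add0r mulN1r addNr.
by rewrite br_tau a4_linear -scaleNr -[_ *: D x]addr0 a4_linear a40 addr0 mulNr.
Qed.

Lemma a4_D2 x y z w : a4 x (D y) z w = - a4 (D y) x z w.
Proof. exact: a4_12. Qed.

Lemma a4_D3 x y z w : a4 x z (D y) w = a4 (D y) x z w.
Proof. by rewrite a4_23 a4_12 opprK. Qed.

Lemma a4_D4 x y z w : a4 x z w (D y) = - a4 (D y) x z w.
Proof. by rewrite a4_34 a4_23 a4_12 opprK. Qed.

(** Both sides are sums of terms [tau x_i * a (D x_j) ..] once [D x_j] is moved to the
    first slot; those with [tau (D x_j)] vanish. *)
Lemma ext_diff_lie_form v :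
  ext_diff br (k := 3) a v = - lie_form D (wedge_tau a) v.
Proof.
pose xs := [:: v (@Ordinal 5 0 isT); v (@Ordinal 5 1 isT); v (@Ordinal 5 2 isT);
  v (@Ordinal 5 3 isT); v (@Ordinal 5 4 isT)].
have -> : v = fun i : 'I_5 => nth 0 xs i.
  apply: boolp.funext => -[[|[|[|[|[|i]]]]] lt5] //=; by congr v; apply: val_inj.
move: (v _) (v _) (v _) (v _) (v _) @xs => x0 x1 x2 x3 x4 xs.
have dfwE (l : 'I_5) y : dfw (fun i : 'I_5 => nth 0 xs i) l y =
    fun i : 'I_5 => nth 0 (set_nth 0 xs l y) i.
  apply: boolp.funext => i; rewrite nth_set_nth /=.
  rewrite val_eqE; have [->|il] := eqVneq i l;
    [by rewrite dfw_in|by rewrite dfw_out 1?eq_sym].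
have extE : ext_diff br (k := 3) a (fun i : 'I_5 => nth 0 xs i) =
  \sum_(j < 5) \sum_(i < 4 | (i < j)%N) (-1) ^+ (i + j) *
    a (vcons (br (nth 0 xs (lift j i)) (nth 0 xs j))
       (fun m => nth 0 xs (lift j (lift i m)))) by [].
rewrite extE /lie_form.
under eq_bigr do rewrite big_mkcond.
under [X in _ = - X]eq_bigr do rewrite dfwE /wedge_tau.
rewrite !big_ord_recl !big_ord0 /=.
rewrite !four_form_vcons ![a (fun=> nth 0 _ _)]four_formE /=.
rewrite !a4_br !tauD !a4_D2 !a4_D3 !a4_D4 /bump !leq0n !(add0n, add1n, addSn).
ring.
Qed.

End FourForm.
End ExtDiff.
End LieDerivative.

(** * Closedness as an equation for a bivector *)

(** The wedge product of [E^p] with [L]. *)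
Definition zcons (p : nat) (L : zform) : zform := [seq (m.1, p :: m.2) | m <- L].

(** Five-forms correspond to bivectors: the value at the basis vectors in
    [compl5 al be] is, up to [pair_sign], the entry at [(al, be)]. *)
Definition compl5 (al be : nat) : seq nat :=
  [seq a <- iota 1 7 | (a != al) && (a != be)].

Definition pairs7 : seq (nat * nat) :=
  [seq (al, be) | al <- iota 1 7, be <- [seq be <- iota 1 7 | al < be]%N].

(** The value of [E^p /\ psi7] on the basis vectors with indices [t]. *)
Definition theta5 p t := zeval (zcons p psi7) t.
Definition phi3 al be p := zeval phi7 [:: al; be; p].

(** The coefficient of the product of the entry [(k, j)] of [D] and the coordinate
    [p] of [tau] in the action of [D] on [tau /\ psi7], at the basis vectors with
    indices [t]. *)
Definition lie_coef k j p (t : seq nat) : int :=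
  zsum [seq (if nth 0%N t l == j then theta5 p (set_nth 0%N t l k) else 0) |
        l <- iota 0 5].

Definition pair_sign al be : int := seq_sign (compl5 al be ++ [:: al; be]) (iota 1 7).

(** The coefficient of the same product in the entry [(al, be)] of
    [\tr D *: B - D *m B - B *m D^T]. *)
Definition resid_coef k j p al be : int :=
  (if k == j then phi3 al be p else 0) - (if k == al then phi3 j be p else 0)
    - (if k == be then phi3 al j p else 0).

(** The volume form takes [E^p /\ psi7] to the contraction of [phi7] with [E_p], up
    to normalisation, and the derivation [D] of five-forms to the one of
    bivectors, corrected by the trace. *)
Lemma duality_table :
  all (fun ab => all (fun k => all (fun j => all (fun p =>
      lie_coef k j p (compl5 ab.1 ab.2) ==
        pair_sign ab.1 ab.2 * resid_coef k j p ab.1 ab.2)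
    (iota 1 7)) (iota 1 7)) (iota 1 7)) pairs7.
Proof. by vm_compute. Qed.

Lemma compl5_table : all (fun ab => [&& size (compl5 ab.1 ab.2) == 5%N,
  all index7 (compl5 ab.1 ab.2) & pair_sign ab.1 ab.2 ^+ 2 == 1]) pairs7.
Proof. by vm_compute. Qed.

Lemma sorted5_table : all (fun t => sorted ltn t ==>
  has (fun ab => t == compl5 ab.1 ab.2) pairs7) (lists7 5).
Proof. by vm_compute. Qed.

Section Closed.
Variables (K : numFieldType) (W : vectType K) (E : 7.-tuple W).
Hypothesis E_basis : basis_of {:W} E.
Variables (tau : W -> K) (D : W -> W).
Hypothesis tau_scalar : scalar tau.
Hypothesis D_linear : linear D.

Let c (p : 'I_7) := tau E`_p.
Let m (k j : 'I_7) := coord E k (D E`_j).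

(** The bivector of the cross product with the vector dual to [c]. *)
Definition cross_mx (c : 'I_7 -> K) : 'M[K]_7 :=
  \matrix_(al, be) \sum_(p < 7) c p * (phi3 al.+1 be.+1 p.+1)%:~R.

Lemma tauE x : tau x = \sum_(p < 7) c p * dcov E p.+1 x.
Proof.
rewrite {1}(coordE E_basis x) (scalar_sum _ _ tau_scalar).
by apply: eq_bigr => p _; rewrite mulrC /dcov inord_val.
Qed.

Lemma wedge_tau_monomial s v :
  wedge_tau tau (@monomial K W E 4 s) v =
    \sum_(p < 7) c p * @monomial K W E 5 (p.+1 :: s) v.
Proof.
rewrite /wedge_tau; under eq_bigr => i _ do rewrite tauE mulr_suml mulr_sumr.
rewrite exchange_big; apply: eq_bigr => p _ /=.
rewrite [in RHS]/monomial /detform (expand_det_col _ ord0) mulr_sumr.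
apply: eq_bigr => i _; rewrite mxE /cofactor addn0 /=.
rewrite mulrCA -!mulrA; congr (_ * (_ * (_ * _))).
by rewrite /monomial /detform; congr (\det _); apply/matrixP=> a b; rewrite !mxE.
Qed.

Lemma wedge_tau_psi : wedge_tau tau (form_of E (k := 4) psi7) =
  fun v => \sum_(p < 7) c p * form_of E (k := 5) (zcons p.+1 psi7) v.
Proof.
apply: boolp.funext => v.
transitivity (\sum_(l <- psi7) l.1%:~R * wedge_tau tau (@monomial K W E 4 l.2) v).
  rewrite /wedge_tau /form_of; under [RHS]eq_bigr do rewrite mulr_sumr.
  rewrite exchange_big; apply: eq_bigr => i _ /=; rewrite !mulr_sumr.
  by apply: eq_bigr => l _; rewrite [RHS]mulrCA [X in _ = _ * X]mulrCA.
under eq_bigr => l _ do rewrite wedge_tau_monomial mulr_sumr.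
rewrite exchange_big; apply: eq_bigr => p _.
rewrite /form_of /zcons big_map mulr_sumr; apply: eq_bigr => l _.
by rewrite mulrCA.
Qed.

Lemma wedge_tau_alternating : alternating (wedge_tau tau (form_of E (k := 4) psi7)).
Proof.
rewrite wedge_tau_psi; split=> [v i b x y|v i j ij vij].
  rewrite mulr_sumr -big_split; apply: eq_bigr => p _ /=.
  by rewrite (form_of_alternating E 5 _).1 mulrDr mulrCA.
by rewrite big1 // => p _; rewrite ((form_of_alternating E 5 _).2 v i j) ?mulr0.
Qed.

Lemma zcons_wf p : index7 p -> zwf 5 (zcons p psi7).
Proof. by move=> p7; rewrite /zwf /= p7. Qed.

Lemma ebasis_dfw k (t : seq nat) (l : 'I_k) (j : 'I_7) : size t = k ->
  dfw (@ebasis K W E k t) l E`_j = ebasis E (set_nth 0%N t l j.+1).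
Proof.
move=> szt; apply: boolp.funext => i; rewrite /ebasis nth_set_nth /= val_eqE.
by have [->|il] := eqVneq i l; [rewrite dfw_in|rewrite dfw_out 1?eq_sym].
Qed.

Lemma lie_form_basis (t : seq nat) : size t = 5%N -> all index7 t ->
  lie_form D (wedge_tau tau (form_of E (k := 4) psi7)) (ebasis E t) =
  \sum_(k < 7) \sum_(j < 7) \sum_(p < 7)
    m k j * c p * (lie_coef k.+1 j.+1 p.+1 t)%:~R.
Proof.
move=> szt t7; rewrite /lie_form; have [Tm _] := wedge_tau_alternating.
have t7i (l : 'I_5) : index7 (nth 0%N t l) by apply: (allP t7); rewrite mem_nth ?szt.
have slot (l : 'I_5) :
    wedge_tau tau (form_of E (k := 4) psi7) (dfw (ebasis E t) l (D (ebasis E t l)))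
    = \sum_(k < 7) \sum_(j < 7) \sum_(p < 7) m k j * c p *
       (if nth 0%N t l == j.+1 then theta5 p.+1 (set_nth 0%N t l k.+1) else 0)%:~R.
  rewrite [D _](coordE E_basis) (scalar_sum _ _ (Tm _ _)).
  apply: eq_bigr => k _; rewrite -/(dfw _ _ _) ebasis_dfw //.
  have [j tl] : exists j : 'I_7, nth 0%N t l = j.+1.
    case/andP: (t7i l) => tl0 tl7.
    have lt7 : ((nth 0%N t l).-1 < 7)%N by rewrite prednK.
    by exists (Ordinal lt7); rewrite /= prednK.
  rewrite (bigD1 j) //= [X in _ = _ + X]big1 => [|j' jj']; last first.
    by rewrite big1 // => p _; rewrite tl eqSS val_eqE eq_sym (negPf jj') mulr0.
  rewrite addr0 wedge_tau_psi mulr_sumr; apply: eq_bigr => p _.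
  rewrite tl eqxx mulrA /m /ebasis tl /=; congr (_ * _).
  rewrite form_of_basis ?zcons_wf // /index7 ?ltn_ord //.
    by rewrite size_set_nth szt; apply/maxn_idPr.
  apply/allP=> a /(nthP 0%N)[i ilt <-]; rewrite nth_set_nth /=.
  case: eqP => [_|_]; first by rewrite /index7 /= ltn_ord.
  apply: (allP t7); rewrite mem_nth //.
  by move: ilt; rewrite size_set_nth szt (maxn_idPr _).
under eq_bigr do rewrite slot.
rewrite exchange_big; apply: eq_bigr => k _ /=.
rewrite exchange_big; apply: eq_bigr => j _ /=.
rewrite exchange_big; apply: eq_bigr => p _ /=.
rewrite -mulr_sumr; congr (_ * _); rewrite /lie_coef -zsumE.
by rewrite -[iota 0 5]/(index_iota 0 5) big_mkord.
Qed.

Let Dm : 'M[K]_7 := \matrix_(k, j) m k j.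
Let B := cross_mx c.

Definition bivector_resid : 'M[K]_7 := \tr Dm *: B - Dm *m B - B *m Dm^T.

Lemma bivector_residE (al be : 'I_7) : bivector_resid al be =
  \sum_(k < 7) \sum_(j < 7) \sum_(p < 7)
    m k j * c p * (resid_coef k.+1 j.+1 p.+1 al.+1 be.+1)%:~R.
Proof.
have BE a b : B a b = \sum_(p < 7) c p * (phi3 a.+1 b.+1 p.+1)%:~R by rewrite mxE.
have split3 : \sum_(k < 7) \sum_(j < 7) \sum_(p < 7)
    m k j * c p * (resid_coef k.+1 j.+1 p.+1 al.+1 be.+1)%:~R =
  \sum_(k < 7) \sum_(j < 7) ((k == j)%:R * (m k j * B al be)
    - (k == al)%:R * (m k j * B j be) - (k == be)%:R * (m k j * B al j)).
  apply: eq_bigr => k _; apply: eq_bigr => j _.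
  rewrite !BE !mulr_sumr -!sumrB; apply: eq_bigr => p _.
  rewrite /resid_coef !eqSS !val_eqE.
  case: (k == j); case: (k == al); case: (k == be);
    rewrite /= ?rmorphB /= ?mul0r ?mul1r; ring.
have RE : bivector_resid al be = \tr Dm * B al be
    - \sum_j Dm al j * B j be - \sum_j B al j * Dm be j.
  rewrite /bivector_resid; move: Dm B => D' B'; rewrite !mxE; congr (_ - _).
  by apply: eq_bigr => j _; rewrite mxE.
rewrite split3 RE; under [RHS]eq_bigr do rewrite !sumrB.
rewrite !sumrB; congr (_ - _ - _).
- rewrite /mxtrace mulr_suml; apply: eq_bigr => k _.
  rewrite [RHS](bigD1 k) //= eqxx mul1r [X in _ = _ + X]big1 ?addr0 => [|j /negPf].
    by rewrite [Dm k k]mxE.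
  by rewrite eq_sym => ->; rewrite mul0r.
- rewrite [RHS](bigD1 al) //= [X in _ = _ + X]big1 ?addr0 => [|k /negPf kal].
    by apply: eq_bigr => j _; rewrite eqxx mul1r [Dm _ _]mxE.
  by rewrite big1 // => j _; rewrite kal mul0r.
rewrite [RHS](bigD1 be) //= [X in _ = _ + X]big1 ?addr0 => [|k /negPf kal].
  by apply: eq_bigr => j _; rewrite eqxx mul1r [Dm _ _]mxE mulrC.
by rewrite big1 // => j _; rewrite kal mul0r.
Qed.

Lemma pairs7P (al be : 'I_7) : (al < be)%N -> (al.+1, be.+1) \in pairs7.
Proof.
move=> ab; apply/allpairsPdep; exists al.+1, be.+1.
have a6 : (al <= 6)%N := ltn_ord al; have b6 : (be <= 6)%N := ltn_ord be.
by rewrite mem_filter !mem_iota !ltnS ab a6 b6.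
Qed.

Lemma lie_form_resid (al be : 'I_7) : (al < be)%N ->
  lie_form D (wedge_tau tau (form_of E (k := 4) psi7))
    (ebasis E (compl5 al.+1 be.+1)) =
  (pair_sign al.+1 be.+1)%:~R * bivector_resid al be.
Proof.
move=> ab; have ab7 := pairs7P ab; have in7 (a : 'I_7) : a.+1 \in iota 1 7.
  by rewrite mem_iota /= ltnS ltn_ord.
have /and3P[/= /eqP sz t7 _] := allP compl5_table _ ab7.
rewrite lie_form_basis // bivector_residE mulr_sumr; apply: eq_bigr => k _.
rewrite mulr_sumr; apply: eq_bigr => j _; rewrite mulr_sumr; apply: eq_bigr => p _.
have := allP (allP (allP (allP duality_table _ ab7) _ (in7 k)) _ (in7 j)) _ (in7 p).
by move=> /eqP /= ->; rewrite rmorphM mulrCA.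
Qed.

Lemma cross_mx_skew (d : 'I_7 -> K) : (cross_mx d)^T = - cross_mx d.
Proof.
have tab : all (fun a => all (fun b => all (fun p => phi3 a b p == - phi3 b a p)
    (iota 1 7)) (iota 1 7)) (iota 1 7) by vm_compute.
have in7 (a : 'I_7) : a.+1 \in iota 1 7 by rewrite mem_iota /= ltnS ltn_ord.
apply/matrixP=> a b; rewrite !mxE -sumrN; apply: eq_bigr => p _.
by rewrite (eqP (allP (allP (allP tab _ (in7 _)) _ (in7 _)) _ (in7 p))) rmorphN mulrN.
Qed.

Lemma resid_skew : bivector_resid^T = - bivector_resid.
Proof.
have skB : B^T = - B := cross_mx_skew c.
rewrite /bivector_resid !linearB /= linearZ /= !trmx_mul !trmxK skB.
by rewrite scalerN mulNmx mulmxN addrAC.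
Qed.

(** An alternating form is determined by its values at increasing lists of basis
    vectors, and these are the entries of the residual up to sign. *)
Lemma resid_eq0P : bivector_resid = 0 <->
  forall v, lie_form D (wedge_tau tau (form_of E (k := 4) psi7)) v = 0.
Proof.
split=> [R0 v|F0]; last first.
  have Rlt (al be : 'I_7) : (al < be)%N -> bivector_resid al be = 0.
    move=> ab; have /eqP := lie_form_resid ab; rewrite F0 eq_sym mulf_eq0.
    have /and3P[_ _ /eqP s1] := allP compl5_table _ (pairs7P ab).
    rewrite intr_eq0; case: eqP => [s0|_] /eqP //; by rewrite s0 in s1.
  apply/matrixP=> al be; rewrite [RHS]mxE; case: (ltngtP al be) => ab.
  - exact: Rlt.
  - have /matrixP/(_ be al) := resid_skew; rewrite [LHS]mxE [RHS]mxE => ->.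
    by rewrite Rlt ?oppr0.
  have /matrixP/(_ be al) := resid_skew; rewrite [LHS]mxE [RHS]mxE.
  rewrite (val_inj ab) => /eqP; rewrite -addr_eq0 -mulr2n mulrn_eq0 => /eqP.
  by [].
have Falt := lie_form_alternating D_linear wedge_tau_alternating.
have zm : multilinear (fun _ : 'I_5 -> W => 0 : K).
  by move=> w i b x y; rewrite mulr0 addr0.
rewrite (multilinear_ext E_basis Falt.1 zm) // => {v} t; rewrite (ebasis_index_seq E).
have [ut|] := boolP (uniq (index_seq t)); last first.
  case/(uniqPn 0%N) => i [j [ij jt Eij]]; rewrite size_index_seq in jt.
  apply: (Falt.2 _ (Ordinal (ltn_trans ij jt)) (Ordinal jt)).
    by rewrite -val_eqE /= (ltn_eqF ij).
  by rewrite /ebasis /= Eij.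
have szs : size (sort leq (index_seq t)) = 5%N by rewrite size_sort size_index_seq.
have /allP sortP := sorted5_table.
have s7 : sort leq (index_seq t) \in lists7 5.
  by apply: lists7P; rewrite // all_sort index7_index_seq.
have srt : sorted ltn (sort leq (index_seq t)).
  by rewrite ltn_sorted_uniq_leq sort_uniq ut (sort_sorted leq_total).
have := implyP (sortP _ s7) srt => /hasP[[al be] ab7 /= /eqP sE].
have /allpairsPdep[al' [be' [+ + [E1 E2]]]] := ab7; subst al' be'.
rewrite mem_filter !mem_iota => /andP[al0 al7] /and3P[ab be0 be7].
have Fs : lie_form D (wedge_tau tau (form_of E (k := 4) psi7))
    (ebasis E (sort leq (index_seq t))) = 0.
  case: al al0 al7 ab ab7 sE => // al _ al7; case: be be0 be7 => // be _ be7 ab _ ->.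
  by rewrite (@lie_form_resid (Ordinal (al7 : (al < 7)%N)) (Ordinal (be7 : (be < 7)%N)))
    // R0 mxE mulr0.
have szt : size (index_seq t) == 5%N by rewrite size_index_seq.
have szs' : size (sort leq (index_seq t)) == 5%N by rewrite szs.
have : perm_eq (Tuple szt) (Tuple szs') by rewrite /= perm_sym perm_sort.
case/tuple_permP => s sE'.
have -> : ebasis E (index_seq t) = fun i : 'I_5 => ebasis E (sort leq (index_seq t)) (s i).
  apply: boolp.funext => i; rewrite /ebasis -[index_seq t in LHS]/(tval (Tuple szt)).
  by rewrite sE' -tnth_nth tnth_mktuple (tnth_nth 0%N).
by rewrite alternating_perm // Fs mulr0.
Qed.

End Closed.

(** * The bivector of a cross product *)

Section CrossMatrix.
Variable K : numFieldType.
Implicit Types c : 'I_7 -> K.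

Definition o7 k (lt : (k < 7)%N) : 'I_7 := Ordinal lt.

Lemma cross_entry c (a b p : 'I_7) (s : int) :
  all (fun q => phi3 a.+1 b.+1 q == if q == p.+1 then s else 0) (iota 1 7) ->
  cross_mx c a b = c p * s%:~R.
Proof.
move=> /allP tab; have in7 (q : 'I_7) : q.+1 \in iota 1 7.
  by rewrite mem_iota /= ltnS ltn_ord.
rewrite mxE (bigD1 p) //= (eqP (tab _ (in7 p))) eqxx big1 ?addr0 // => q qp.
by rewrite (eqP (tab _ (in7 q))) eqSS val_eqE (negPf qp) mulr0.
Qed.

(** The cross product of a vector with itself vanishes. *)
Lemma cross_mx_kernel c : cross_mx c *m \col_j c j = 0.
Proof.
have tab : all (fun a => all (fun b => all (fun p => phi3 a b p == - phi3 a p b)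
    (iota 1 7)) (iota 1 7)) (iota 1 7) by vm_compute.
have in7 (a : 'I_7) : a.+1 \in iota 1 7 by rewrite mem_iota /= ltnS ltn_ord.
apply/colP=> a; rewrite !mxE.
under eq_bigr do rewrite !mxE mulr_suml.
set S := \sum_(b < 7) _; suff : S = - S.
  by move/eqP; rewrite -addr_eq0 -mulr2n mulrn_eq0 => /eqP.
rewrite {1}/S exchange_big /S -sumrN; apply: eq_bigr => b _; rewrite -sumrN.
apply: eq_bigr => p _.
rewrite (eqP (allP (allP (allP tab _ (in7 a)) _ (in7 p)) _ (in7 b))) rmorphN.
ring.
Qed.

(** A decomposable bivector satisfies the Pluecker relations.  On the complements of
    the seven lines of the Fano plane they say that the sum of the squares of [c]
    over the line is zero, and these seven sums determine the squares. *)
Lemma cross_mx_indecomposable c (x y : 'rV[K]_7) :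
  cross_mx c = x^T *m y - y^T *m x -> forall p, c p = 0.
Proof.
move=> Bxy.
have BE a b : cross_mx c a b = x 0 a * y 0 b - y 0 a * x 0 b.
  by rewrite Bxy !mxE !big_ord_recl !big_ord0 !mxE !addr0.
have plucker a1 a2 a3 a4 : cross_mx c a1 a2 * cross_mx c a3 a4
    - cross_mx c a1 a3 * cross_mx c a2 a4 + cross_mx c a1 a4 * cross_mx c a2 a3 = 0.
  by rewrite !BE; ring.
pose i0 := @o7 0 isT; pose i1 := @o7 1 isT; pose i2 := @o7 2 isT.
pose i3 := @o7 3 isT; pose i4 := @o7 4 isT; pose i5 := @o7 5 isT.
pose i6 := @o7 6 isT.
have e (a b p : 'I_7) (s : int) := @cross_entry c a b p s.
(* Each relation is taken on the complement of a line, where the three products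
   of entries are squares up to sign. *)
have P1 := plucker i0 i1 i2 i3; have P2 := plucker i0 i1 i4 i5.
have P3 := plucker i0 i2 i5 i6; have P4 := plucker i0 i3 i4 i6.
have P5 := plucker i1 i2 i4 i6; have P6 := plucker i1 i3 i5 i6.
have P7 := plucker i2 i3 i4 i5.
rewrite (e i0 i1 i6 1) // (e i2 i3 i6 1) // (e i0 i2 i4 1) //
  (e i1 i3 i4 (-1)) // (e i0 i3 i5 (-1)) // (e i1 i2 i5 (-1)) // in P1.
rewrite (e i0 i1 i6 1) // (e i4 i5 i6 1) // (e i0 i4 i2 (-1)) //
  (e i1 i5 i2 1) // (e i0 i5 i3 1) // (e i1 i4 i3 1) // in P2.
rewrite (e i0 i2 i4 1) // (e i5 i6 i4 1) // (e i0 i5 i3 1) //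
  (e i2 i6 i3 (-1)) // (e i0 i6 i1 (-1)) // (e i2 i5 i1 (-1)) // in P3.
rewrite (e i0 i3 i5 (-1)) // (e i4 i6 i5 (-1)) // (e i0 i4 i2 (-1)) //
  (e i3 i6 i2 1) // (e i0 i6 i1 (-1)) // (e i3 i4 i1 (-1)) // in P4.
rewrite (e i1 i2 i5 (-1)) // (e i4 i6 i5 (-1)) // (e i1 i4 i3 1) //
  (e i2 i6 i3 (-1)) // (e i1 i6 i0 1) // (e i2 i4 i0 1) // in P5.
rewrite (e i1 i3 i4 (-1)) // (e i5 i6 i4 1) // (e i1 i5 i2 1) //
  (e i3 i6 i2 1) // (e i1 i6 i0 1) // (e i3 i5 i0 (-1)) // in P6.
rewrite (e i2 i3 i6 1) // (e i4 i5 i6 1) // (e i2 i4 i0 1) //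
  (e i3 i5 i0 (-1)) // (e i2 i5 i1 (-1)) // (e i3 i4 i1 (-1)) // in P7.
have S1 : c i4 ^+ 2 + c i5 ^+ 2 + c i6 ^+ 2 = 0.
  by rewrite -P1; ring.
have S2 : c i2 ^+ 2 + c i3 ^+ 2 + c i6 ^+ 2 = 0.
  by rewrite -P2; ring.
have S3 : c i1 ^+ 2 + c i3 ^+ 2 + c i4 ^+ 2 = 0.
  by rewrite -P3; ring.
have S4 : c i1 ^+ 2 + c i2 ^+ 2 + c i5 ^+ 2 = 0.
  by rewrite -P4; ring.
have S5 : c i0 ^+ 2 + c i3 ^+ 2 + c i5 ^+ 2 = 0.
  by rewrite -P5; ring.
have S6 : c i0 ^+ 2 + c i2 ^+ 2 + c i4 ^+ 2 = 0.
  by rewrite -[0]oppr0 -P6; ring.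
have S7 : c i0 ^+ 2 + c i1 ^+ 2 + c i6 ^+ 2 = 0.
  by rewrite -P7; ring.
pose Q := c i0 ^+ 2 + c i1 ^+ 2 + c i2 ^+ 2 + c i3 ^+ 2 + c i4 ^+ 2 + c i5 ^+ 2
  + c i6 ^+ 2.
have sum0 (s t : K) : s = 0 -> t = 0 -> s + t = 0 by move=> -> ->; rewrite addr0.
(* Each point lies on three of the seven lines. *)
have Q0 : Q = 0.
  apply: (mulfI (_ : 3 != 0 :> K)); first by rewrite pnatr_eq0.
  rewrite mulr0 -[RHS](sum0 _ _ S1 (sum0 _ _ S2 (sum0 _ _ S3 (sum0 _ _ S4
    (sum0 _ _ S5 (sum0 _ _ S6 S7)))))) /Q; ring.
(* The three lines through a point cover each of the other points once. *)
have point0 (z L1 L2 L3 : K) : L1 = 0 -> L2 = 0 -> L3 = 0 ->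
    2 * z ^+ 2 = L1 + L2 + L3 - Q -> z = 0.
  move=> -> -> -> /eqP; rewrite Q0 !addr0 subrr mulf_eq0 pnatr_eq0 sqrf_eq0.
  by move/eqP.
have z0 : c i0 = 0 by apply: (point0 _ _ _ _ S5 S6 S7); rewrite /Q; ring.
have z1 : c i1 = 0 by apply: (point0 _ _ _ _ S3 S4 S7); rewrite /Q; ring.
have z2 : c i2 = 0 by apply: (point0 _ _ _ _ S2 S4 S6); rewrite /Q; ring.
have z3 : c i3 = 0 by apply: (point0 _ _ _ _ S2 S3 S5); rewrite /Q; ring.
have z4 : c i4 = 0 by apply: (point0 _ _ _ _ S1 S3 S6); rewrite /Q; ring.
have z5 : c i5 = 0 by apply: (point0 _ _ _ _ S1 S4 S5); rewrite /Q; ring.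
have z6 : c i6 = 0 by apply: (point0 _ _ _ _ S1 S2 S7); rewrite /Q; ring.
by case=> [] [|[|[|[|[|[|[|p]]]]]]] //= lt7;
  [rewrite -z0|rewrite -z1|rewrite -z2|rewrite -z3|rewrite -z4|rewrite -z5|rewrite -z6];
  congr c; apply: val_inj.
Qed.

Section NullFrame.
Variable ii : K.
Hypothesis ii2 : ii * ii = -1.

(** The covector [E^1 + i E^2] is null.  Its cross product is the bivector
    [x_0 /\ x_2 + x_1 /\ x_3], where the rows of [null_frame] below are a vector on
    which the covector is one, then [x_0, .., x_3], then two vectors that complete
    these to a basis of its kernel. *)
Definition null_covector (j : 'I_7) : K := nth 0 [:: 1; ii] j.

Definition null_rows : seq (seq K) :=
  [:: [:: 1]; [:: - ii; 1]; [:: 0; 0; 1; - ii]; [:: 0; 0; 0; 0; 0; 0; 1];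
      [:: 0; 0; 0; 0; 1; - ii]; [:: 0; 0; 1; ii]; [:: 0; 0; 0; 0; 1; ii]].

Definition null_frame : 'M[K]_7 := \matrix_(i, j) nth 0 (nth [::] null_rows i) j.

Definition null_coframe : 'M[K]_7 := \matrix_(i, j) nth 0 (nth [::]
  [:: [:: 1]; [:: ii; 1]; [:: 0; 0; 2^-1; 0; 0; 2^-1];
      [:: 0; 0; ii / 2; 0; 0; - ii / 2]; [:: 0; 0; 0; 0; 2^-1; 0; 2^-1];
      [:: 0; 0; 0; 0; ii / 2; 0; - ii / 2]; [:: 0; 0; 0; 1]] i) j.

Definition null_bivector : 'M[K]_(4, 7) :=
  \matrix_(i, j) nth 0 (nth [::] null_rows i.+1) j.

Ltac null_tac := apply/matrixP;
  do 2![case=> [] [|[|[|[|[|[|[|?]]]]]]] //= ?];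
  rewrite ?mxE ?big_ord_recl ?big_ord0 ?mxE /=
    ?(mul0r, mulr0, add0r, addr0, mul1r, mulr1, mulrN, mulNr, opprK, mulrA, ii2);
  try by [ring|field].

Lemma null_frameK : null_frame *m null_coframe = 1%:M.
Proof.
null_tac.
Qed.

Lemma null_bivectorE :
  null_bivector^T *m Omega K 2 *m null_bivector = cross_mx null_covector.
Proof.
pose X1 : 'M[K]_(2, 7) := \matrix_(i, j) nth 0 (nth [::] null_rows i.+1) j.
pose X2 : 'M[K]_(2, 7) := \matrix_(i, j) nth 0 (nth [::] null_rows i.+3) j.
have -> : null_bivector = col_mx X1 X2.
  apply/matrixP=> i j; rewrite !mxE; case: split_ordP => l ->; rewrite mxE; by [].
rewrite mul_tr_Omega_mul; apply/matrixP.
have cE (a b : 'I_7) : cross_mx null_covector a b =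
    (phi3 a.+1 b.+1 1)%:~R + ii * (phi3 a.+1 b.+1 2)%:~R.
  rewrite mxE 2!big_ord_recl big1 ?addr0 => [|p _].
    by rewrite /null_covector /= mul1r.
  by rewrite /null_covector /= nth_nil mul0r.
do 2![case=> [] [|[|[|[|[|[|[|?]]]]]]] //= ?]; rewrite cE /=;
  repeat match goal with |- context [phi3 ?a ?b ?p] =>
    let v := eval vm_compute in (phi3 a b p) in change (phi3 a b p) with v end;
  rewrite ?mxE ?big_ord_recl ?big_ord0 ?mxE /=
    ?(mul0r, mulr0, add0r, addr0, mul1r, mulr1, mulrN, mulNr, opprK, mulrA, ii2);
  rewrite ?(mulr0z, mulr1z) ?NegzE ?mulrNz;
  try by [ring|field].
Qed.
End NullFrame.

End CrossMatrix.

(** * Cocalibrated structures and invariant subspaces of the ideal *)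

Section BasisChange.
Variables (K : numFieldType) (V : vectType K) (n : nat).
Implicit Types X Y : n.-tuple V.

Lemma basis_change X Y : basis_of {:V} X -> basis_of {:V} Y ->
  (\matrix_(i < n, j < n) coord Y j X`_i) *m (\matrix_(i < n, j < n) coord X j Y`_i)
    = 1%:M.
Proof.
move=> bX bY; apply/matrixP=> i k; rewrite !mxE.
transitivity (coord X k (\sum_j coord Y j X`_i *: Y`_j)).
  by rewrite linear_sum; apply: eq_bigr => j _; rewrite !mxE [RHS]linearZ.
by rewrite -(coord_basis bY (memvf _)) coord_free 1?eq_sym ?(basis_free bX).
Qed.

Definition lincomb (S : 'M[K]_n) X : n.-tuple V :=
  [tuple \sum_l S j l *: X`_l | j < n].

Lemma lincombE S X (j : 'I_n) : (lincomb S X)`_j = \sum_l S j l *: X`_l.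
Proof. by rewrite -tnth_nth tnth_mktuple. Qed.

Lemma coord_lincomb S X (j l : 'I_n) : basis_of {:V} X ->
  coord X l (lincomb S X)`_j = S j l.
Proof.
by move=> bX; rewrite lincombE coord_sum_free // (basis_free bX).
Qed.

Lemma lincomb_basis S X : basis_of {:V} X -> S \in unitmx ->
  basis_of {:V} (lincomb S X).
Proof.
move=> bX uS; rewrite basisEfree subvf (size_basis bX) size_tuple leqnn !andbT.
apply/freeP => k k0 i; pose v := \row_j k j.
suff /rowP/(_ i) : v = 0 by rewrite !mxE.
rewrite -[v](mulmxK uS) (_ : v *m S = 0) ?mul0mx //; apply/rowP=> l.
rewrite !mxE; transitivity (coord X l (\sum_j k j *: (lincomb S X)`_j)).
  rewrite linear_sum; apply: eq_bigr => j _; rewrite linearZ /= coord_lincomb //.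
  by rewrite mxE.
by rewrite k0 linear0.
Qed.

End BasisChange.

Section CodimOneIdeal.
Variables (K : numFieldType) (g : vectType K) (br : lie_bracket g).
Hypothesis dim_g : \dim {:g} = 7%N.
Variables (u : {vspace g}).
Hypothesis u_ideal : lie_ideal br u.
Hypothesis u_abelian : lie_abelian br u.
Variable e7 : g.
Hypothesis e7_notin_u : e7 \notin u.
Variables (b : 6.-tuple (subvs_of u)) (J : 'M[K]_6).
Hypothesis b_basis : basis_of {:subvs_of u} b.
Hypothesis bJ : forall j : 'I_6, ad_restr br u e7 b`_j = \sum_i J i j *: b`_i.

Definition ext_basis : 7.-tuple g := [tuple of e7 :: map vsval b].
Let F := ext_basis.

Lemma ext_basis0 : F`_(ord0 : 'I_7) = e7. Proof. by []. Qed.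

Lemma ext_basisS (i : 'I_6) : F`_(lift ord0 i) = vsval b`_i.
Proof. by rewrite lift0 /= (nth_map 0) ?size_tuple. Qed.

Lemma ext_basisP : basis_of {:g} F.
Proof.
rewrite basisEfree subvf dim_g size_tuple leqnn !andbT free_cons.
have bu : (<<map vsval b>> <= u)%VS.
  by apply/span_subvP => x /mapP[y _ ->]; exact: subvsP.
rewrite (contra (subvP bu e7)) //=.
apply/(@freeP _ _ _ [tuple of map vsval b]) => k k0 i.
have b_free := basis_free b_basis; move/freeP: b_free; apply.
apply: subvs_inj; rewrite linear0 linear_sum -[RHS]k0; apply: eq_bigr => j _.
by rewrite linearZ /= (nth_map 0) // size_tuple.
Qed.

Definition e7_coord : g -> K := coord F ord0.

Lemma e7_coord_scalar : scalar e7_coord.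
Proof. by move=> c x y; rewrite /e7_coord linearP. Qed.

Definition ad_e7 : g -> g := br e7.

Lemma ad_e7_linear : linear ad_e7.
Proof. by move=> c x y; rewrite /ad_e7 linearP. Qed.

Lemma e7_coord_ideal x : x \in u -> e7_coord x = 0.
Proof.
move=> xu; rewrite -(vsprojK xu) (coord_basis b_basis (memvf (vsproj u x))).
rewrite linear_sum /e7_coord linear_sum big1 // => i _.
by rewrite /= !linearZ /= -ext_basisS coord_free ?(basis_free ext_basisP) ?mulr0.
Qed.

Lemma sub_e7_coord x : x - e7_coord x *: e7 \in u.
Proof.
rewrite {1}(coord_basis ext_basisP (memvf x)) big_ord_recl ext_basis0 -/(e7_coord x).
rewrite addrC addKr; apply: rpred_sum => i _; apply: rpredZ.
by rewrite -/F ext_basisS subvsP.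
Qed.

Lemma ad_e7_e7 : ad_e7 e7 = 0. Proof. exact: bracket_alt. Qed.

Lemma ad_e7_mod x : ad_e7 x = ad_e7 (x - e7_coord x *: e7).
Proof. by rewrite /ad_e7 linearB linearZ /= bracket_alt scaler0 subr0. Qed.

Lemma e7_coord_ad_e7 x : e7_coord (ad_e7 x) = 0.
Proof. by apply: e7_coord_ideal; rewrite ad_e7_mod; apply: u_ideal; apply: sub_e7_coord. Qed.

Lemma bracket_skew x y : br x y = - br y x.
Proof.
apply/eqP; rewrite -addr_eq0; have := bracket_alt br (x + y).
by rewrite linearDr /= !linearDl /= !bracket_alt add0r addr0 addrC => ->.
Qed.

Lemma bracketE x y : br x y = e7_coord x *: ad_e7 y - e7_coord y *: ad_e7 x.
Proof.
rewrite (ad_e7_mod x) (ad_e7_mod y); set x' := x - _; set y' := y - _.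
have -> : br x y = br (e7_coord x *: e7 + x') (e7_coord y *: e7 + y').
  by rewrite !(addrC (_ *: e7)) !subrK.
have := sub_e7_coord x; have := sub_e7_coord y; rewrite -/x' -/y' => y'u x'u.
move: x' y' x'u y'u (e7_coord x) (e7_coord y) => x' y' x'u y'u s t.
rewrite linearDr /= !linearDl /= (u_abelian x'u y'u) addr0.
rewrite !linearZr_LR /= !linearZl_LR /= bracket_alt !scaler0 add0r.
by rewrite [br x' e7]bracket_skew scalerN addrC.
Qed.

Lemma ad_e7_basis (i : 'I_6) :
  ad_e7 (vsval b`_i) = \sum_j J j i *: vsval b`_j.
Proof.
transitivity (vsval (ad_restr br u e7 b`_i)).
  by rewrite lfunE /= vsprojK // u_ideal // subvsP.
by rewrite bJ linear_sum; apply: eq_bigr => j _; rewrite linearZ.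
Qed.

Section AdaptedBasis.
Variable E : 7.-tuple g.
Hypothesis E_basis : basis_of {:g} E.

Definition ad_mx : 'M[K]_7 := \matrix_(k, j) coord E k (ad_e7 E`_j).
Definition adapted_e7_coord (j : 'I_7) : K := e7_coord E`_j.
Definition ext_coord : 'M[K]_(1 + 6, 7) := \matrix_(i, j) coord E j F`_i.
Let G := ext_coord.

Lemma ext_coord_unit : (G : 'M_7) \in unitmx.
Proof. by have /mulmx1_unit[] := basis_change ext_basisP E_basis. Qed.

Lemma ext_coord_ad : G *m ad_mx^T = block_mx 0 0 0 J^T *m G.
Proof.
have DF (i : 'I_(1 + 6)) : ad_e7 F`_i =
    \sum_l (block_mx 0 0 0 J^T : 'M_(1 + 6)) i l *: F`_l.
  case: (split_ordP i) => j ->.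
    rewrite (ord1 j) -[F`_(lshift 6 0)]/e7 ad_e7_e7 big1 // => l _.
    by case: (split_ordP l) => m ->; rewrite ?block_mxEul ?block_mxEur mxE scale0r.
  have E1 (l : 'I_6) : F`_(rshift 1 l) = vsval b`_l.
    by rewrite -ext_basisS; congr nth.
  rewrite E1 ad_e7_basis [RHS]big_split_ord big_ord1 block_mxEdl mxE scale0r [RHS]add0r.
  by apply: eq_bigr => l _; rewrite block_mxEdr mxE E1.
apply/matrixP=> i k; rewrite !mxE.
transitivity (coord E k (ad_e7 F`_i)).
  rewrite [in RHS](coord_basis E_basis (memvf F`_i)).
  rewrite [ad_e7 _]linear_sum linear_sum; apply: eq_bigr => j _.
  by rewrite !mxE /ad_e7 /= linearZ_LR /= linearZ_LR.
rewrite DF linear_sum; apply: eq_bigr => l _.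
by rewrite [LHS]linearZ !mxE.
Qed.

Lemma ext_coord_e7 : G *m \col_j adapted_e7_coord j = delta_mx 0 0.
Proof.
apply/matrixP=> i k; rewrite !mxE ord1 eqxx andbT.
transitivity (e7_coord F`_i).
  rewrite [in RHS](coord_basis E_basis (memvf F`_i)) (scalar_sum _ _ e7_coord_scalar).
  by apply: eq_bigr => j _; rewrite !mxE.
rewrite /e7_coord coord_free ?(basis_free ext_basisP) //.
Qed.

Lemma tr_ad_mx : \tr ad_mx = \tr J.
Proof.
rewrite -mxtrace_tr -(mulKmx ext_coord_unit ad_mx^T) ext_coord_ad.
rewrite mxtrace_mulC -mulmxA mulmxV ?ext_coord_unit // mulmx1.
by rewrite (@mxtrace_block _ 1 6) mxtrace0 add0r mxtrace_tr.
Qed.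

(** Subspaces of [u] are invariant in the coordinates of [b] if and only if they
    are in those of the adapted basis. *)
Lemma ext_coord_lower m (Y : 'M[K]_(m, 6)) (M : 'M[K]_m) :
  Y *m J^T = M *m Y <-> (row_mx 0 Y *m G) *m ad_mx^T = M *m (row_mx 0 Y *m G).
Proof.
rewrite -mulmxA ext_coord_ad !mulmxA mul_row_block !mulmx0 !add0r.
rewrite mul_mx_row mulmx0; split=> [->//|/(row_free_inj (A := G))].
by rewrite row_free_unit ext_coord_unit => /(_ isT)/eq_row_mx[].
Qed.

End AdaptedBasis.

Lemma closed_resid (E : 7.-tuple g) : basis_of {:g} E ->
  (forall v, ext_diff br (form_of E (k := 4) psi7) v = 0) <->
  bivector_resid E e7_coord ad_e7 = 0.
Proof.
move=> bE; rewrite (resid_eq0P bE e7_coord_scalar ad_e7_linear).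
have palt := form_of_alternating E 4 psi7.
by split=> E0 v; have := ext_diff_lie_form bracketE e7_coord_ad_e7 palt v; rewrite E0 ?oppr0 //;
  move/eqP; rewrite eq_sym oppr_eq0 => /eqP.
Qed.

Lemma resid_eq0E (E : 7.-tuple g) : basis_of {:g} E ->
  bivector_resid E e7_coord ad_e7 = 0 <->
  (ad_mx E)^T^T *m cross_mx (adapted_e7_coord E)
    + cross_mx (adapted_e7_coord E) *m (ad_mx E)^T =
    \tr J *: cross_mx (adapted_e7_coord E).
Proof.
move=> bE; rewrite trmxK -(tr_ad_mx bE).
rewrite -[bivector_resid _ _ _]/(\tr (ad_mx E) *: cross_mx (adapted_e7_coord E) -
  ad_mx E *m cross_mx (adapted_e7_coord E)
  - cross_mx (adapted_e7_coord E) *m (ad_mx E)^T).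
by rewrite -addrA -opprD; split=> [/eqP|->]; rewrite ?subrr // subr_eq0 => /eqP.
Qed.

(** The support of the bivector is killed by [e7_coord], because the cross product
    kills its own vector; hence its coordinate rows come from rows [Y] in [u]. *)
Lemma cocalibrated_sp : (exists phi vol, cocalibrated br phi vol) ->
  exists k (Y : 'M[K]_(k + k, 6)) (M : 'M[K]_(k + k)),
    [/\ (1 < k)%N, row_free Y, Y *m J^T = M *m Y &
        M *m Omega K k + Omega K k *m M^T = \tr J *: Omega K k].
Proof.
move/cocalibratedP => [E bE /(closed_resid bE)/(resid_eq0E bE)].
set c := adapted_e7_coord E => BD.
have [k [X [Xf BX _]]] := skew_normal_formE (cross_mx_skew c).
move: BD; rewrite BX => /(bivector_invariant _ _ Xf)[M XM MO].
have Gu := ext_coord_unit bE; set G := ext_coord E in Gu.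
have Gc : G *m \col_j c j = delta_mx 0 0 := ext_coord_e7 bE.
have Xc : X *m \col_j c j = 0.
  have E0 : X^T *m (Omega K k *m (X *m \col_j c j)) = 0.
    by rewrite !mulmxA -BX cross_mx_kernel.
  have [L XL] := row_freeP Xf.
  rewrite -(mulKmx (Omega_unit K k) (X *m _)) (_ : Omega K k *m _ = 0) ?mulmx0 //.
  by rewrite -[LHS]mul1mx -trmx1 -XL trmx_mul -mulmxA E0 mulmx0.
pose XG := X *m invmx G; pose Y := rsubmx (XG : 'M_(k + k, 1 + 6)).
have L0 : lsubmx (XG : 'M_(k + k, 1 + 6)) = 0.
  have : XG *m (G *m \col_j c j) = 0 by rewrite mulmxA mulmxKV.
  rewrite Gc -colE => /colP E0.
  apply/colP => i; have := E0 i; rewrite [LHS]mxE [RHS]mxE => E1.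
  rewrite [RHS]mxE -[RHS]E1.
  by rewrite [LHS]mxE; congr (XG _ _); apply: val_inj.
have XE : X = row_mx 0 Y *m G.
  by rewrite -[LHS](mulmxKV Gu) -/XG -L0 hsubmxK.
exists k, Y, M; split=> //.
- rewrite ltnNge; apply/negP => k1.
  (* Rank at most two would make the bivector decomposable, hence [e7_coord] zero. *)
  have [x [y Bxy]] : exists x y : 'rV_7, cross_mx c = x^T *m y - y^T *m x.
    move: X BX {Xf XM Xc XG Y L0 XE}; case: k k1 M MO => [|[|//]] _ _ _ X BX.
      by exists 0, 0; rewrite BX (flatmx0 X) !mulmx0 subrr.
    by exists (usubmx X), (dsubmx X); rewrite BX -mul_tr_Omega_mul vsubmxK.
  have c0 := cross_mx_indecomposable Bxy.
  move: Gc; rewrite (_ : \col_j c j = 0) ?mulmx0; last by apply/colP=> j; rewrite !mxE.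
  by move/matrixP/(_ 0 0); rewrite !mxE => /eqP; rewrite eq_sym oner_eq0.
- apply: inj_row_free => v vY; apply/eqP; rewrite -(mulmx_free_eq0 _ Xf) XE mulmxA.
  by rewrite mul_mx_row mulmx0 vY row_mx0 mul0mx.
by apply/(ext_coord_lower bE); rewrite -XE.
Qed.

(** The rows of [Y], preceded by [e7] and completed by [Z], form a basis [T] of the
    Lie algebra.  The adapted basis is chosen so that [T] is its [null_frame]; then
    [e7_coord] is the null covector and the support of its bivector is spanned by
    [Y]. *)
Lemma sp_cocalibrated (ii : K) : ii * ii = -1 -> sp_sub J^T (Omega K 2) ->
  exists phi vol, cocalibrated br phi vol.
Proof.
move=> ii2 [Y [M [Yf YJ MO]]]; apply/cocalibratedP.
have [Z ZY] : exists Z : 'M[K]_(2, 6), (col_mx Y Z : 'M_6) \in unitmx.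
  have [Z YZ] := row_free_complete Yf (erefl : (4 + 2 = 6)%N); exists Z.
  have rYZ : \rank (col_mx Y Z) = 6%N by rewrite -addsmxE (eqP YZ).
  by rewrite -row_full_unit /row_full; apply/eqP.
pose T : 'M[K]_7 := (block_mx 1%:M 0 0 (col_mx Y Z : 'M_6) : 'M_(1 + 6)).
have uT : T \in unitmx.
  by rewrite unitmxE (@det_ublock _ 1 6) det1 mul1r -unitmxE.
have QP := null_frameK ii2; have PQ := mulmx1C QP.
pose S := null_coframe ii *m T.
have uS : S \in unitmx by rewrite unitmx_mul uT; have [_ ->] := mulmx1_unit QP.
pose E := lincomb S F; have bE := lincomb_basis ext_basisP uS.
exists E => //; apply/(closed_resid bE)/(resid_eq0E bE).
have TG : T *m ext_coord E = null_frame ii.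
  have SG : S *m ext_coord E = 1%:M.
    rewrite -(basis_change bE ext_basisP); congr (_ *m _).
    by apply/matrixP=> i j; rewrite [RHS]mxE (coord_lincomb _ _ _ ext_basisP).
  by rewrite -[LHS]mul1mx -QP -!mulmxA (mulmxA (null_coframe ii)) SG mulmx1.
have T0 (l : 'I_7) : T l ord0 = (l == ord0)%:R.
  have o0 : ord0 = lshift 6 ord0 :> 'I_(1 + 6) by apply: val_inj.
  rewrite [X in T l X]o0 /T; case: (@split_ordP 1 6 l) => l' ->.
    by apply: (etrans (@block_mxEul _ 1 6 1 6 _ _ _ _ _ _)); rewrite mxE (ord1 l').
  by apply: (etrans (@block_mxEdl _ 1 6 1 6 _ _ _ _ _ _)); rewrite mxE.
have cE : adapted_e7_coord E = null_covector ii.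
  apply: boolp.funext => j.
  rewrite /adapted_e7_coord /e7_coord (coord_lincomb _ _ _ ext_basisP) mxE.
  rewrite (bigD1 (ord0 : 'I_7)) //= big1 => [|l /negPf nl]; last first.
    by rewrite T0 nl mulr0.
  rewrite T0 eqxx mulr1 addr0 mxE /null_covector.
  by case: j => [] [|[|[|[|[|[|[|j]]]]]]].
have XE : row_mx 0 Y *m ext_coord E = null_bivector ii.
  apply/matrixP=> i j.
  have /matrixP/(_ (rshift 1 (lshift 2 i)) j) := TG.
  rewrite mxE [RHS]mxE mxE [RHS in _ -> _ = RHS]mxE => <-.
  apply: eq_bigr => l _; congr (_ * _); case: (split_ordP l) => l' ->.
    by rewrite row_mxEl mxE; apply: esym;
      apply: (etrans (@block_mxEdl _ 1 6 1 6 _ _ _ _ _ _)); rewrite mxE.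
  rewrite row_mxEr; apply: esym.
  exact: etrans (@block_mxEdr _ 1 6 1 6 _ _ _ _ _ _) (@col_mxEu _ 4 2 6 _ _ _ _).
have Xf0 : row_free (null_bivector ii : 'M_(2 + 2, 7)).
  by rewrite -XE /row_free mxrankMfree ?row_free_unit ?ext_coord_unit //
    -[X in X == _](_ : \rank Y = _) // rank_row_0mx.
rewrite cE -(null_bivectorE ii2); apply/(bivector_invariant _ _ Xf0).
exists M; last exact: (etrans MO (congr1 (fun t => t *: Omega K 2) (mxtrace_tr J))).
by rewrite -XE; apply/(ext_coord_lower bE).
Qed.

End CodimOneIdeal.

(** * Matrices of linear maps *)

Section Coordinates.
Variable K : fieldType.
Implicit Types U V W : vectType K.

Definition vrow V n (e : n.-tuple V) (v : V) : 'rV[K]_n := \row_i coord e i v.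
Definition rvec V n (e : n.-tuple V) (r : 'rV[K]_n) : V := \sum_i r 0 i *: e`_i.

Lemma vrowK V n (e : n.-tuple V) v : basis_of {:V} e -> rvec e (vrow e v) = v.
Proof.
move=> be; rewrite [RHS](coord_basis be (memvf v)).
by apply: eq_bigr => i _; rewrite mxE.
Qed.

Lemma rvecK V n (e : n.-tuple V) r : basis_of {:V} e -> vrow e (rvec e r) = r.
Proof.
move=> be; apply/rowP => i; rewrite mxE /rvec.
by rewrite (coord_sum_free (fun i => r 0 i)) // (basis_free be).
Qed.

Lemma rvec_linear V n (e : n.-tuple V) : linear (rvec e).
Proof.
move=> c r s; rewrite /rvec scaler_sumr -big_split; apply: eq_bigr => i _.
by rewrite !mxE scalerDl scalerA.
Qed.

Lemma rvec0 V n (e : n.-tuple V) : rvec e 0 = 0.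
Proof. by rewrite /rvec big1 // => i _; rewrite mxE scale0r. Qed.

Lemma vrow_linear V n (e : n.-tuple V) : linear (vrow e).
Proof. by move=> c x y; apply/rowP => i; rewrite !mxE linearP. Qed.

Lemma rvec_inj V n (e : n.-tuple V) : basis_of {:V} e -> injective (rvec e).
Proof. by move=> be r s E; rewrite -(rvecK r be) E rvecK. Qed.

(** Matrices act on coordinate rows from the right. *)
Definition lmx U V m n (e : m.-tuple U) (e' : n.-tuple V) (f : 'Hom(U, V)) :
  'M[K]_(m, n) := \matrix_(i, j) coord e' j (f e`_i).

Lemma lmxE U V m n (e : m.-tuple U) (e' : n.-tuple V) (f : 'Hom(U, V)) r :
  basis_of {:V} e' -> f (rvec e r) = rvec e' (r *m lmx e e' f).
Proof.
move=> be'; rewrite -[LHS](vrowK _ be'); congr (rvec _ _); apply/rowP => j.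
rewrite !mxE /rvec !linear_sum; apply: eq_bigr => i _.
by rewrite mxE linearZ [LHS]linearZ.
Qed.

Lemma lmx_comp U V W m n p (e : m.-tuple U) (e' : n.-tuple V) (e'' : p.-tuple W)
    (f : 'Hom(U, V)) (h : 'Hom(V, W)) :
  basis_of {:V} e' -> basis_of {:W} e'' ->
  lmx e e'' (h \o f)%VF = lmx e e' f *m lmx e' e'' h.
Proof.
move=> be' be''; apply/row_matrixP => i; apply: (rvec_inj be'').
rewrite row_mul -lmxE // (_ : rvec e' _ = f e`_i).
  rewrite -[RHS](vrowK _ be''); congr rvec; apply/rowP=> j.
  by rewrite !mxE lfunE.
rewrite -[RHS](vrowK _ be'); congr rvec; apply/rowP=> j; by rewrite !mxE.
Qed.

Lemma lmx1 V n (e : n.-tuple V) : basis_of {:V} e -> lmx e e \1%VF = 1%:M.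
Proof.
move=> be; apply/matrixP=> i j; rewrite !mxE lfunE /= coord_free 1?eq_sym //.
exact: basis_free be.
Qed.

Definition mklin U V m n (e : m.-tuple U) (e' : n.-tuple V) (M : 'M[K]_(m, n)) :
  'Hom(U, V) := linfun (fun x => rvec e' (vrow e x *m M)).

Lemma mklin_fun U V m n (e : m.-tuple U) (e' : n.-tuple V) M x :
  mklin e e' M x = rvec e' (vrow e x *m M).
Proof.
pose f x := rvec e' (vrow e x *m M).
have flin : linear f.
  by move=> c y z; rewrite /f vrow_linear mulmxDl -scalemxAl rvec_linear.
pose fL : {linear U -> V} := HB.pack f (GRing.isLinear.Build K U V *:%R f flin).
exact: (lfunE fL x).
Qed.

Lemma mklinE U V m n (e : m.-tuple U) (e' : n.-tuple V) M r :
  basis_of {:U} e -> mklin e e' M (rvec e r) = rvec e' (r *m M).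
Proof. by move=> be; rewrite mklin_fun rvecK. Qed.

Lemma lmxK U V m n (e : m.-tuple U) (e' : n.-tuple V) M :
  basis_of {:U} e -> basis_of {:V} e' -> lmx e e' (mklin e e' M) = M.
Proof.
move=> be be'; apply/row_matrixP => i; apply: (rvec_inj be').
by rewrite !rowE -lmxE // mklinE.
Qed.

Lemma lmx_inj U V m n (e : m.-tuple U) (e' : n.-tuple V) (f h : 'Hom(U, V)) :
  basis_of {:U} e -> basis_of {:V} e' -> lmx e e' f = lmx e e' h -> f = h.
Proof.
move=> be be' E; apply/lfunP => x; rewrite -(vrowK x be).
by rewrite !(lmxE _ _ _ be') E.
Qed.

Lemma lftrace_basis V n (e : n.-tuple V) (f : 'End(V)) :
  basis_of {:V} e -> lftrace f = \tr (lmx e e f).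
Proof.
move=> be; have bv := vbasisP {:V}; set v := vbasis {:V} in bv.
have -> : lftrace f = \tr (lmx v v f).
  rewrite /lftrace; congr (\tr _); apply/matrixP=> i j.
  by rewrite /passmx.mxof mxE !mxE /= passmx.vecof_delta.
rewrite -[f in RHS](comp_lfun1r f) (lmx_comp _ _ _ bv be).
rewrite -[f in RHS](comp_lfun1l f) (lmx_comp _ _ _ bv be).
rewrite mxtrace_mulC -mulmxA -(lmx_comp _ _ _ be bv) comp_lfun1l.
by rewrite lmx1 // mulmx1.
Qed.

Lemma basis_exists V n : \dim {:V} = n -> exists e : n.-tuple V, basis_of {:V} e.
Proof. by move=> <-; exists (vbasis {:V}); apply: vbasisP. Qed.

End Coordinates.

(** * Block forms and invariant four-spaces *)

Section BlockForm.
Variables (K : numFieldType) (U : vectType K) (V2 V4 : {vspace U}).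
Hypothesis dimU : \dim {:U} = 6%N.
Hypothesis V24 : (V2 + V4 = fullv)%VS.
Variables (e2 : 2.-tuple (subvs_of V2)) (e4 : 4.-tuple (subvs_of V4)).
Hypothesis e2_basis : basis_of {:subvs_of V2} e2.
Hypothesis e4_basis : basis_of {:subvs_of V4} e4.
Variable omega : {skew_symmetric subvs_of V4}.
Hypothesis omega_nondeg : nondegenerate omega.
Variables (A : 'End(U)) (b : 6.-tuple U) (J : 'M[K]_6).
Hypothesis b_basis : basis_of {:U} b.
Hypothesis bJ : forall j : 'I_6, A b`_j = \sum_i J i j *: b`_i.

Definition split_basis : (2 + 4).-tuple U :=
  [tuple of map vsval e2 ++ map vsval e4].
Let w := split_basis.

Lemma rvec_split (r : 'rV[K]_2) (s : 'rV[K]_4) :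
  rvec w (row_mx r s) = vsval (rvec e2 r) + vsval (rvec e4 s).
Proof.
rewrite /rvec big_split_ord /=; congr (_ + _); rewrite linear_sum;
  apply: eq_bigr => i _; rewrite linearZ.
  rewrite row_mxEl /= nth_cat size_map size_tuple ltn_ord.
  by rewrite (nth_map 0) ?size_tuple.
rewrite row_mxEr /= nth_cat size_map size_tuple ltnNge leq_addr addKn.
by rewrite /= (nth_map 0) ?size_tuple.
Qed.

Lemma split_basisP : basis_of {:U} w.
Proof.
rewrite basisEdim size_tuple dimU leqnn andbT.
apply/subvP => x _; have : x \in (V2 + V4)%VS by rewrite V24 memvf.
case/memv_addP=> x2 x2V [x4 x4V ->].
rewrite -(vsprojK x2V) -(vsprojK x4V) -(vrowK (vsproj V2 x2) e2_basis).
rewrite -(vrowK (vsproj V4 x4) e4_basis) -rvec_split /rvec.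
by apply: rpred_sum => i _; apply/rpredZ/memv_span/mem_nth; rewrite size_tuple.
Qed.

Lemma lmx_jordan : lmx b b A = J^T.
Proof.
apply/matrixP=> i j; rewrite !mxE bJ.
by rewrite (coord_sum_free (fun j => J j i)) // (basis_free b_basis).
Qed.

Definition gram : 'M[K]_4 := \matrix_(i, j) omega e4`_i e4`_j.

Lemma omega_rvec r s : omega (rvec e4 r) (rvec e4 s) = (r *m gram *m s^T) 0 0.
Proof.
rewrite /rvec linear_sumr mxE; apply: eq_bigr => j _.
rewrite linear_sumlz !mxE mulr_suml; apply: eq_bigr => i _.
rewrite linearZr_LR linearZl_LR /= !mxE; ring.
Qed.

Lemma gram_skew : gram^T = - gram.
Proof. by apply/matrixP=> i j; rewrite !mxE hermC /= mulN1r. Qed.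

Lemma gram_unit : gram \in unitmx.
Proof.
rewrite -row_free_unit; apply: inj_row_free => r rW.
have : rvec e4 r \in (orthov omega fullv).
  apply/mem_orthovP => v _; rewrite -(vrowK v e4_basis) omega_rvec rW mul0mx.
  by rewrite mxE.
move: omega_nondeg; rewrite /nondegenerate => /eqP ->; rewrite memv0 => /eqP r0.
by rewrite -(rvecK r e4_basis) r0; apply/rowP => i; rewrite !mxE linear0.
Qed.

Lemma in_spP (f4 : 'End(subvs_of V4)) : in_sp omega f4 <->
  lmx e4 e4 f4 *m gram + gram *m (lmx e4 e4 f4)^T = 0.
Proof.
set N := lmx e4 e4 f4.
have E r s : omega (f4 (rvec e4 r)) (rvec e4 s) + omega (rvec e4 r) (f4 (rvec e4 s))
    = (r *m (N *m gram + gram *m N^T) *m s^T) 0 0.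
  rewrite !(lmxE _ _ _ e4_basis) !omega_rvec -/N mulmxDr mulmxDl [RHS]mxE.
  by rewrite trmx_mul !mulmxA.
split=> [sp|N0 v x]; last first.
  by rewrite -(vrowK v e4_basis) -(vrowK x e4_basis) E N0 mulmx0 mul0mx mxE.
apply/matrixP=> i j; rewrite [RHS]mxE.
have := E (delta_mx 0 i) (delta_mx 0 j); rewrite sp -rowE trmx_delta -colE.
by rewrite !mxE.
Qed.

Lemma lmx_split (f : 'End(U)) (f2 : 'End(subvs_of V2))
    (h : 'Hom(subvs_of V2, subvs_of V4)) (f4 : 'End(subvs_of V4)) c :
  (forall x, f (vsval x) = vsval (f2 x) + vsval (h x)) ->
  (forall y, f (vsval y) = c *: vsval y + vsval (f4 y)) ->
  lmx w w f = block_mx (lmx e2 e2 f2) (lmx e2 e4 h) 0 (c%:M + lmx e4 e4 f4).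
Proof.
move=> fV2 fV4; apply/row_matrixP => i; apply: (rvec_inj split_basisP).
rewrite rowE -(lmxE _ _ _ split_basisP) rowE.
case: (split_ordP i) => j ->.
  rewrite delta_mx_lshift rvec_split rvec0 linear0 addr0 fV2.
  rewrite (lmxE _ _ _ e2_basis) (lmxE _ _ _ e4_basis) -rvec_split.
  by rewrite mul_row_block !mul0mx !addr0.
rewrite delta_mx_rshift rvec_split rvec0 linear0 add0r fV4.
rewrite (lmxE _ _ _ e4_basis) -linearZ -linearD.
have -> : c *: rvec e4 (delta_mx 0 j) + rvec e4 (delta_mx 0 j *m lmx e4 e4 f4) =
    rvec e4 (delta_mx 0 j *m (c%:M + lmx e4 e4 f4)).
  by rewrite mulmxDr mul_mx_scalar rvec_linear.
by rewrite mul_row_block !mul0mx !add0r mulmx0 rvec_split rvec0 linear0 add0r.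
Qed.

(** In a basis adapted to [V2 + V4] the matrix of [f] is block triangular, and its
    lower rows give the invariant four-space.  As [f4] has trace zero, the trace
    of [f] is [- \tr f_2]. *)
Lemma block_form_sp_sub (f : 'End(U)) :
  sp_block_form V2 V4 omega f -> similar_GL A f -> sp_sub J^T gram.
Proof.
case=> f2 [h [f4 [sp fV2 fV4]]] [P [kerP fE]].
have := lmx_split fV2 fV4; set c := - _; set N := lmx e4 e4 f4 => fB.
have bw := split_basisP; move/in_spP: sp; rewrite -/N => sp.
have trN : \tr N = 0.
  have /eqP := sp_trace (t := 0) gram_unit (etrans sp (esym (scale0r _))).
  by rewrite mul0rn mulrn_eq0 => /eqP.
pose T := lmx w b P^-1%VF.
have TB : T *m J^T = lmx w w f *m T.
  rewrite -lmx_jordan -(lmx_comp _ _ _ b_basis b_basis) -(lmx_comp _ _ _ bw b_basis).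
  congr lmx; rewrite fE comp_lfunA comp_lfunA lker0_compVf // comp_lfun1l.
  by [].
have uT : (T : 'M_6) \in unitmx.
  have /mulmx1_unit[] : (T : 'M_6) *m lmx b w P = 1%:M; last by [].
  by rewrite -(lmx_comp _ _ _ b_basis bw) lker0_compfV // lmx1.
have trJ : \tr J = c *+ 2.
  rewrite -mxtrace_tr -(mulKmx uT J^T) TB mxtrace_mulC mulmxK // fB.
  rewrite (@mxtrace_block _ 2 4) mxtraceD trN addr0 mxtrace_scalar -lftrace_basis //.
  rewrite (_ : lftrace f2 = - (c *+ 2)); last by rewrite /c; field.
  ring.
exists (dsubmx T), (c%:M + N); split.
- have -> : dsubmx T = row_mx 0 1%:M *m T.
    by rewrite -[T in RHS]vsubmxK mul_row_col mul0mx add0r mul1mx.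
  rewrite /row_free mxrankMfree; last by rewrite row_free_unit.
  by rewrite rank_row_0mx mxrank1.
- have := congr1 dsubmx TB; rewrite -!mul_dsub_mx fB => ->.
  by rewrite block_mxEv col_mxKd -[T in LHS]vsubmxK mul_row_col mul0mx add0r.
rewrite mxtrace_tr trJ mulmxDl linearD /= tr_scalar_mx mulmxDr addrACA sp addr0.
by rewrite mul_scalar_mx mul_mx_scalar -scalerDl mulr2n.
Qed.

(** Complete [Y] by rows [Z] to a basis; the map [P] that takes this basis to the
    one adapted to [V2 + V4] conjugates the endomorphism into block form. *)
Lemma sp_sub_block_form : sp_sub J^T gram ->
  exists2 f, sp_block_form V2 V4 omega f & similar_GL A f.
Proof.
case=> Y [M [Yf YJ MW]].
have bw := split_basisP.
have [Z uT] : exists Z : 'M[K]_(2, 6), (col_mx Z Y : 'M_6) \in unitmx.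
  have [Z YZ] := row_free_complete Yf (erefl : (4 + 2 = 6)%N); exists Z.
  have rYZ : \rank (col_mx Z Y) = 6%N by rewrite -addsmxE addsmxC (eqP YZ).
  by rewrite -row_full_unit /row_full; apply/eqP.
set T := (col_mx Z Y : 'M_6) in uT.
pose B : 'M[K]_(2 + 4) := (T *m J^T *m invmx T : 'M_6).
pose F2 := ulsubmx B; pose H := ursubmx B.
have dB : dsubmx B = row_mx 0 M.
  rewrite /B -mul_dsub_mx -mul_dsub_mx col_mxKd YJ -mulmxA.
  have YT : Y = (row_mx 0 1%:M : 'M_(4, 2 + 4)) *m T.
    by rewrite /T mul_row_col mul0mx add0r mul1mx.
  have -> : Y *m invmx T = (row_mx 0 1%:M : 'M_(4, 2 + 4)).
    by rewrite {1}YT mulmxK.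
  by rewrite mul_mx_row mulmx0 mulmx1.
have BE : B = block_mx F2 H 0 M.
  by rewrite -[LHS]submxK /F2 /H /dlsubmx /drsubmx dB row_mxKl row_mxKr.
have trM : \tr M = \tr J *+ 2.
  have /eqP := sp_trace gram_unit MW; rewrite mxtrace_tr -[4%N]/(2 * 2)%N mulrnA.
  by rewrite -subr_eq0 -mulrnBl mulrn_eq0 /= subr_eq0 => /eqP.
pose c := \tr J / 2; have c2 : \tr J = c *+ 2 by rewrite /c; field.
pose P := mklin b w (invmx T); pose Q := mklin w b T.
have PQ : (P \o Q = \1)%VF.
  apply: (lmx_inj bw bw); rewrite (lmx_comp _ _ _ b_basis bw) !lmxK // lmx1 //.
  exact: mulmxV.
have QP : (Q \o P = \1)%VF.
  apply: (lmx_inj b_basis b_basis); rewrite (lmx_comp _ _ _ bw b_basis) !lmxK //.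
  by rewrite lmx1 // mulVmx.
have kerP : lker P == 0%VS.
  apply/lker0P/(can_inj (g := Q)) => x.
  by move/lfunP/(_ x): QP; rewrite !lfunE.
have Pinv : (P^-1 = Q)%VF by rewrite -[LHS]comp_lfun1r -PQ lker0_compKf.
set f := (P \o A \o P^-1)%VF.
have fB r : f (rvec w r) = rvec w (r *m B).
  rewrite (lmxE _ _ _ bw); congr (rvec _ (_ *m _)).
  rewrite /f Pinv (lmx_comp _ _ _ b_basis bw) (lmx_comp _ _ _ b_basis bw).
  by rewrite !lmxK // lmx_jordan mulmxA.
exists f; last by exists P.
exists (mklin e2 e2 F2), (mklin e2 e4 H), (mklin e4 e4 (M - c%:M)).
have trF2 : lftrace (mklin e2 e2 F2) = - \tr J.
  rewrite (lftrace_basis _ e2_basis) lmxK //.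
  have : \tr B = \tr J by rewrite /B mxtrace_mulC mulKmx // mxtrace_tr.
  rewrite BE (@mxtrace_block _ 2 4) trM => E.
  by apply: (addIr (\tr J *+ 2)); rewrite E; ring.
split.
- apply/in_spP; rewrite lmxK // mulmxBl linearB /= tr_scalar_mx mulmxBr addrACA MW.
  rewrite mxtrace_tr c2 mul_scalar_mx mul_mx_scalar -opprD -scalerDl -mulr2n.
  by rewrite subrr.
- move=> x; rewrite -(vrowK x e2_basis) !mklinE // -rvec_split.
  have -> : vsval (rvec e2 (vrow e2 x)) = rvec w (row_mx (vrow e2 x) 0).
    by rewrite rvec_split rvec0 linear0 addr0.
  by rewrite fB BE mul_row_block !mul0mx !addr0.
move=> y; rewrite -(vrowK y e4_basis) mklinE //.
have -> : vsval (rvec e4 (vrow e4 y)) = rvec w (row_mx 0 (vrow e4 y)).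
  by rewrite rvec_split rvec0 linear0 add0r.
rewrite fB BE mul_row_block !mul0mx !add0r mulmx0 trF2 mulNr opprK -/c.
rewrite !rvec_split !rvec0 !linear0 !add0r -linearZ -linearD; congr vsval.
by rewrite -rvec_linear -mul_mx_scalar -mulmxDr addrC subrK.
Qed.

End BlockForm.

(** * The equivalence *)

Theorem theorem1p4 (R : realType) (g : vectType R[i]) (br : lie_bracket g)
    (dim_g : \dim {:g} = 7%N)
    (u : {vspace g}) (dim_u : \dim u = 6%N)
    (u_ideal : lie_ideal br u) (u_abelian : lie_abelian br u)
    (e7 : g) (e7_notin_u : e7 \notin u)
    (V2 V4 : {vspace subvs_of u})
    (dim_V2 : \dim V2 = 2%N) (dim_V4 : \dim V4 = 4%N)
    (V2V4_sum : (V2 + V4 = fullv)%VS) (V2V4_direct : directv (V2 + V4))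
    (omega : {skew_symmetric subvs_of V4}) (omega_nondeg : nondegenerate omega)
    (J : 'M[R[i]]_6) (JB : 'I_6 -> nat)
    (J_jordan : jordan_normal_form (ad_restr br u e7) J JB) :
  [<-> (* a *) exists phi vol, cocalibrated br phi vol;
       (* b *) exists2 f, sp_block_form V2 V4 omega f
                 & similar_GL (ad_restr br u e7) f;
       (* c *) jordan_condition (fun i => J i i) JB].
Proof.
have [Jmx [b [b_basis bJ]]] := J_jordan.
have [JBJ JE JBle] := jordan_entries Jmx.
have dimU : \dim {: subvs_of u} = 6%N by rewrite dimvf.
have [e2 e2_basis] :
    exists e : 2.-tuple (subvs_of V2), basis_of {: subvs_of V2} e.
  by apply: basis_exists; rewrite dimvf.
have [e4 e4_basis] :
    exists e : 4.-tuple (subvs_of V4), basis_of {: subvs_of V4} e.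
  by apply: basis_exists; rewrite dimvf.
pose G := gram e4 omega.
have skG : G^T = - G by apply: gram_skew.
have uG : G \in unitmx by apply: gram_unit.
have skO : (Omega R[i] 2)^T = - Omega R[i] 2 by apply: Omega_skew.
have uO : Omega R[i] 2 \in unitmx by apply: Omega_unit.
have to_b : sp_sub J^T G -> exists2 f, sp_block_form V2 V4 omega f
    & similar_GL (ad_restr br u e7) f.
  exact: (sp_sub_block_form dimU V2V4_sum e2_basis e4_basis omega_nondeg
    b_basis bJ).
tfae.
- case/(cocalibrated_sp dim_g u_ideal u_abelian e7_notin_u b_basis bJ).
  move=> k [Y [M [k1 Yf YJ MW]]]; apply: to_b.
  have : (k + k <= 6)%N by rewrite -(eqP Yf) rank_leq_col.
  (* The support of the bivector has dimension [k + k], so [k] is 2 or 3; for 3 it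
     is the whole ideal, and the four-space is found through the eigenvalues. *)
  case: k Y M Yf YJ MW k1 => [|[|[|[|k]]]] Y M Yf YJ MW // _.
  - move=> _; apply: (sp_sub_congr skO uO skG uG).
    by exists Y, M; rewrite mxtrace_tr.
  - move=> _; have uY : Y \in unitmx by rewrite -row_free_unit.
    have [c] := sp6_pattern JBJ JE JBle (Omega_skew _ 3) (Omega_unit _ 3) uY YJ MW.
    exact: (pattern_sp_sub JBJ JE JBle skG uG).
  lia.
- case=> f Bf fA.
  have := block_form_sp_sub dimU V2V4_sum e2_basis e4_basis omega_nondeg
    b_basis bJ Bf fA.
  by case/(sp_sub_pattern JBJ JE JBle skG uG) => c /(pattern_jordan_condition JBJ).
move=> /jordan_condition_pattern[c cP].
apply: (sp_cocalibrated dim_g u_ideal u_abelian e7_notin_u b_basis bJ (ii := 'i%C)).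
  exact: (sqr_i R).
exact: (pattern_sp_sub JBJ JE JBle skO uO cP).
Qed.
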